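(* Let $\mu$ be an $m$-increasing Borel probability measure on $[0,1)$ and let $b\in\mathrm{BMO}(\mu)$ be non-constant. Let $H_{\mathscr D}$ be the dyadic Hilbert transform associated with $\mu$. Then (i) the commutator $[H_{\mathscr D},b]$ is bounded from $H_1(\mu)$ to $L^{1,\infty}(\mu)$; (ii) the commutator $[H_{\mathscr D},b]$ is bounded from $H_1^b(\mu)$ to $L^1(\mu)$.
   Context: $\mathbb Z_+=\{0,1,2,\dots\}$, $\mathbb N=\{1,2,\dots\}$. On $[0,1)$, $\mathcal F_n$ is the $\sigma$-algebra generated by the dyadic intervals $[k2^{-n},(k+1)2^{-n})$, $0\le k<2^n$, and $\mathcal F=\sigma(\bigcup_n\mathcal F_n)$; $\mu$ is a probability measure on $([0,1),\mathcal F)$, with $\mu(I)>0$ for all dyadic intervals $I$ so that the quantities below make sense. $\mathbb E$, $\mathbb E_n$ are the expectation and conditional expectation given $\mathcal F_n$ with respect to $\mu$. $A(\mathcal F_n)$ is the set of dyadic intervals in $\mathcal F_n$ of length $2^{-n}$, $A(\mathcal F)=\bigcup_nA(\mathcal F_n)$. For $I\in A(\mathcal F)$, $I_-$ and $I_+$ are its left and right dyadic children and $\widehat I$ its dyadic parent. Put $m(I):=\frac{\mu(I_-)\mu(I_+)}{\mu(I)}$ and $h_I:=\sqrt{m(I)}\left[\frac{\mathbf 1_{I_-}}{\mu(I_-)}-\frac{\mathbf 1_{I_+}}{\mu(I_+)}\right]$. $\mu$ is $m$-increasing if there is $C>0$ with $m(I)\le Cm(\widehat I)$ for every $I\in A(\mathcal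 F)$ (having a parent in $[0,1)$). Dyadic Hilbert transform: $H_{\mathscr D}(f)(x):=\sum_{k\in\mathbb N}\sum_{I\in A(\mathcal F_k)}\delta(I)\langle f,h_{\widehat I}\rangle h_I(x)$, where $\delta(I)=1$ if $I=(\widehat I)_-$, $\delta(I)=-1$ if $I=(\widehat I)_+$, and $\langle f,h_{\widehat I}\rangle:=\mathbb E(fh_{\widehat I})$. For a martingale $f=(f_n)$: $f_{-1}:=0$, $d_nf:=f_n-f_{n-1}$, $S(f):=(\sum_{n\ge0}|d_nf|^2)^{1/2}$. $H_1(\mu)$: martingales with $\|f\|_{H_1(\mu)}:=\|S(f)\|_{L^1(\mu)}<\infty$. $\mathrm{BMO}(\mu)$: martingales with $\|f\|_{\mathrm{BMO}_p}:=\sup_{n\in\mathbb Z_+}\|\mathbb E_n(|f-f_{n-1}|^p)\|_{L^\infty}^{1/p}<\infty$ (equivalent norms for all $p\in[1,\infty)$). $\|f\|_{L^{1,\infty}(\mu)}:=\sup_{t>0}t\,\mu(|f|>t)$. Commutator of a linear operator $T$: $[T,b](f):=T(bf)-bT(f)$ for $f\in L^2(\mu)$ (in particular $[\mathbb E_n,b](f)=\mathbb E_n(bf)-b\,\mathbb E_n(f)$), and for $f\in H_1(\mu)$ it is defined by continuity from the dense subspace $L^2(\mu)$. $H_1^b(\mu)$: martingales $f$ (in $H_1(\mu)$) with $\|f\|_{H_1^b}:=\|f\|_{H_1(\mu)}\|b\|_{\mathrm{BMO}(\mu)}+\big\|\sup_{n\in\mathbb Z_+}|[\mathbb E_n,b](f)|\big\|_{L^1(\mu)}<\infty$.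 *)

(* Defs.v *)
From HB Require Import structures.
From mathcomp Require Import all_boot all_order all_algebra.
From mathcomp Require Import all_classical all_reals all_analysis.

Set Implicit Arguments.
Unset Strict Implicit.
Unset Printing Implicit Defensive.

Import Order.TTheory GRing.Theory Num.Theory.
Import numFieldNormedType.Exports.

Local Open Scope classical_set_scope.
Local Open Scope ring_scope.

(* A Borel probability measure on [0, 1[ is encoded as a Borel probability
   measure on R giving mass 1 to `[0, 1[. Hence functions on [0, 1[ are
   represented by functions on R whose values outside [0, 1[ are irrelevant,
   and all L^p norms (taken over R) are those of [0, 1[. *)

Section Dyadic.
Context {R : realType}.

(* For k < 2 ^ n these are the elements of A(F_n). The children of
   dyadic n k are dyadic n.+1 k.*2 (left) and dyadic n.+1 k.*2.+1 (right),
   and the parent of dyadic n.+1 k is dyadic n k./2. *)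
Definition dyadic (n k : nat) : set R :=
  `[k%:R / 2 ^+ n, k.+1%:R / 2 ^+ n[%classic.

Definition dyadics (n : nat) : set (set R) :=
  [set dyadic n k | k in [set k : nat | (k < 2 ^ n)%N]].

(* The sigma-algebra is generated on R, so that it also has the mu-null
   atom R \ [0, 1[. *)
Definition Fn_measurable (n : nat) (f : R -> R) : Prop :=
  @measurable_fun _ _ (g_sigma_algebraType (dyadics n)) (measurableTypeR R)
    setT f.

Variable mu : probability (measurableTypeR R) R.

Definition mass (n k : nat) : R := fine (mu (dyadic n k)).

Definition m_ (n k : nat) : R :=
  mass n.+1 k.*2 * mass n.+1 k.*2.+1 / mass n k.

Definition m_increasing : Prop :=
  exists2 C : R, 0 < C &
    forall n k, (k < 2 ^ n.+1)%N -> m_ n.+1 k <= C * m_ n k./2.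

Definition haar (n k : nat) (x : R) : R :=
  Num.sqrt (m_ n k) *
  (\1_(dyadic n.+1 k.*2) x / mass n.+1 k.*2 -
   \1_(dyadic n.+1 k.*2.+1) x / mass n.+1 k.*2.+1).

Definition haar_coef (f : R -> R) (n k : nat) : R :=
  \int[mu]_x (f x * haar n k x).

(* The term of index i collects the intervals of A(F_(i+1)). *)
Definition dyadic_hilbert (f : R -> R) (x : R) : R :=
  limn (series (fun i : nat =>
    \sum_(j < 2 ^ i.+1)
      (if odd j then -1 else 1) * haar_coef f i j./2 * haar i.+1 j x)).

(* Conditional expectation given F_n: F_n is generated by finitely many atoms,
   all of positive measure, so it is the average over the atom containing x.
   The extended real version is meant for nonnegative functions. See cond_expP
   below for the characteristic properties. *)
Definition econd_exp (n : nat) (f : R -> \bar R) (x : R) : \bar R :=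
  (\sum_(k < 2 ^ n)
    (\1_(dyadic n k) x / mass n k)%:E * \int[mu]_(y in dyadic n k) f y)%E.

Definition cond_exp (n : nat) (f : R -> R) (x : R) : R :=
  fine (econd_exp n (EFin \o f) x).

Definition is_martingale (f : nat -> R -> R) : Prop :=
  (forall n, Fn_measurable n (f n)) /\
  (forall n x, 0 <= x < 1 -> cond_exp n (f n.+1) x = f n x).

Definition martingale_of (f : R -> R) : nat -> R -> R := cond_exp ^~ f.

Definition prev (f : nat -> R -> R) (n : nat) : R -> R :=
  if n is n'.+1 then f n' else cst 0.

Definition square_fun (f : nat -> R -> R) (x : R) : \bar R :=
  sqrte (\sum_(0 <= n <oo) (`|f n x - prev f n x| ^+ 2)%:E)%E.

Definition H1_norm (f : nat -> R -> R) : \bar R := 'N[mu]_1[square_fun f].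

Definition H1 (f : nat -> R -> R) : Prop :=
  is_martingale f /\ (H1_norm f < +oo)%E.

(* Martingales in BMO are closed, so they are identified with functions. *)
Definition BMO_norm (p : R) (b : R -> R) : \bar R :=
  ereal_sup (range (fun n : nat =>
    ('N[mu]_+oo[econd_exp n
       (fun x => (`|b x - prev (martingale_of b) n x| `^ p)%:E)] `^ p^-1)%E)).

Definition BMO (p : R) (b : R -> R) : Prop :=
  b \in Lfun mu 1 /\ (BMO_norm p b < +oo)%E.

Definition weakL1_norm (f : R -> R) : \bar R :=
  ereal_sup [set (t%:E * mu [set x | (t < `|f x|)%R])%E | t in [set t : R | 0 < t]].

Definition L2_commutator (T : (R -> R) -> (R -> R)) (b f : R -> R) : R -> R :=
  T (b \* f) \- b \* T f.

(* g is the value at f of the extension of [T, b] from L^2 to H_1 by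
   continuity, the target being L^{1,oo}. *)
Definition is_commutator (T : (R -> R) -> (R -> R)) (b : R -> R)
    (f : nat -> R -> R) (g : R -> R) : Prop :=
  measurable_fun [set: measurableTypeR R] (g : measurableTypeR R -> R) /\
  forall u : nat -> R -> R,
    (forall i, u i \in Lfun mu 2%:E) ->
    H1_norm (fun n => martingale_of (u i) n \- f n) @[i --> \oo] --> 0%E ->
    weakL1_norm (L2_commutator T b (u i) \- g) @[i --> \oo] --> 0%E.

(* Determined only up to a mu-null set, and meaningless when there is no
   extension: existence has to be asserted separately. *)
Definition commutator (T : (R -> R) -> (R -> R)) (b : R -> R)
    (f : nat -> R -> R) : R -> R :=
  xget (cst 0) [set g | is_commutator T b f g].

Definition commutator_max (b : R -> R) (f : nat -> R -> R) (x : R) : \bar R :=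
  ereal_sup (range (fun n : nat => `|commutator (cond_exp n) b f x|%:E)).

(* p selects one of the equivalent norms of BMO. *)
Definition H1b_norm (p : R) (b : R -> R) (f : nat -> R -> R) : \bar R :=
  (H1_norm f * BMO_norm p b + 'N[mu]_1[commutator_max b f])%E.

Definition H1b (p : R) (b : R -> R) (f : nat -> R -> R) : Prop :=
  H1 f /\ (H1b_norm p b f < +oo)%E.

End Dyadic.

Section CondExp.
Context {R : realType}.
Variable mu : probability (measurableTypeR R) R.

Lemma dyadic_inj n k l (x : R) : dyadic n k x -> dyadic n l x -> k = l.
Proof.
have p2 : 0 < 2 ^+ n :> R by rewrite exprn_gt0.
rewrite /dyadic /= !in_itv /= => /andP[a b] /andP[c d].
have := le_lt_trans a d; have := le_lt_trans c b.
rewrite !ltr_pM2r ?invr_gt0// !ltr_nat !ltnS => h1 h2.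
by apply/eqP; rewrite eqn_leq h1 h2.
Qed.

Lemma dyadic_atom n (A : set R) k : <<s dyadics n >> A ->
  dyadic n k `<=` A \/ dyadic n k `<=` ~` A.
Proof.
pose G (B : set R) := dyadic n k `<=` B \/ dyadic n k `<=` ~` B.
move=> sA; apply: (sA G); split; first split.
- by right => x _ [].
- move=> B [H|H]; [right|left] => x Ix; first by move=> [_]; apply; exact: H.
  by split => //; exact: H.
- move=> F H; have [[m hm]|hn] := pselect (exists m, dyadic n k `<=` F m).
    by left => x /hm Fx; exists m.
  right => x Ix [m _ Fx]; have [h|h] := H m; first by apply: hn; exists m.
  exact: h Ix Fx.
- move=> _ [l _ <-]; have [kl|kl] := eqVneq k l; first by left; rewrite kl.
  by right => x Ix Il; rewrite (dyadic_inj Ix Il) eqxx in kl.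
Qed.

Lemma measurable_dyadic n k :
  measurable (dyadic n k : set (measurableTypeR R)).
Proof. exact: measurable_itv. Qed.

Lemma bigcup_dyadic n :
  \big[setU/set0]_(k < 2 ^ n) dyadic n k = `[0%R, 1%R[%classic :> set R.
Proof.
have p2 : 0 < 2 ^+ n :> R by rewrite exprn_gt0.
rewrite -(bigcup_mkord _ (fun k => dyadic n k)); apply/seteqP; split => x.
  move=> [k /= kn]; rewrite /dyadic /= !in_itv /= => /andP[a b].
  apply/andP; split; first by apply: le_trans a; rewrite divr_ge0// ltW.
  apply: lt_le_trans b _; rewrite ler_pdivrMr// mul1r -natrX ler_nat.
  exact: kn.
rewrite /= in_itv /= => /andP[x0 x1].
have h0 : 0 <= x * 2 ^+ n by rewrite mulr_ge0// ltW.
have /andP[a b] := Num.Theory.truncn_itv h0.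
exists (Num.truncn (x * 2 ^+ n)) => /=.
  rewrite -(ltr_nat R) natrX; apply: le_lt_trans a _.
  by rewrite gtr_pMl.
by rewrite /dyadic /= in_itv /= ler_pdivrMr// a ltr_pdivlMr.
Qed.

Lemma integral_dyadic n (A : set (measurableTypeR R)) (f : R -> R) :
  mu `[0%R, 1%R[%classic = 1%E -> measurable A ->
  mu.-integrable setT (EFin \o f) ->
  (\int[mu]_(x in A) (f x)%:E =
   \sum_(k < 2 ^ n) \int[mu]_(x in A `&` dyadic n k) (f x)%:E)%E.
Proof.
move=> m1 mA If.
have mI : measurable (`[0%R, 1%R[%classic : set (measurableTypeR R)) by exact: measurable_itv.
have IA : mu.-integrable A (EFin \o f) by exact: integrableS If.
have mC : mu (~` `[0%R, 1%R[%classic) = 0%E.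
  by rewrite (probability_setC mu mI) m1 subee.
rewrite (negligible_integral (measurableC mI) mA IA mC).
rewrite setDE setCK -(bigcup_dyadic n) big_distrr/=.
rewrite -(big_mkord xpredT (fun k => A `&` dyadic n k)).
rewrite -(big_mkord xpredT (fun k => \int[mu]_(x in A `&` dyadic n k) (f x)%:E)%E).
rewrite integral_bigsetU_EFin//.
- by move=> k; apply: measurableI => //; exact: measurable_dyadic.
- exact: iota_uniq.
- move=> i j _ _ [x [[_ a] [_ b]]]; exact: dyadic_inj a b.
- apply: (measurable_funS measurableT _ (measurable_int mu If)) => //.
Qed.

Lemma cond_expE n (f : R -> R) (x : R) :
  mu.-integrable setT (EFin \o f) ->
  cond_exp mu n f x =
  \sum_(k < 2 ^ n) \1_(dyadic n k) x *
     ((mass mu n k)^-1 * fine (\int[mu]_(y in dyadic n k) (f y)%:E)).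
Proof.
move=> If; rewrite /cond_exp /econd_exp.
rewrite -[RHS]/(fine _%:E) -sumEFin; congr fine; apply: eq_bigr => k _.
rewrite /= [in RHS]mulrA [in RHS]EFinM fineK// integrable_fin_num//.
  exact: measurable_dyadic.
apply: (integrableS measurableT _ _ If) => //; exact: measurable_dyadic.
Qed.

Lemma cond_expP n (f : R -> R) :
  mu `[0%R, 1%R[%classic = 1%E ->
  (forall k, (k < 2 ^ n)%N -> (0 < mu (dyadic n k))%E) ->
  f \in Lfun mu 1 ->
  Fn_measurable n (cond_exp mu n f) /\
  forall A : set R, <<s dyadics n >> A ->
    (\int[mu]_(x in A) (cond_exp mu n f x)%:E = \int[mu]_(x in A) (f x)%:E)%E.
Proof.
move=> m1 mpos /Lfun1_integrable If.
have -> : cond_exp mu n f = (fun x => \sum_(k < 2 ^ n) \1_(dyadic n k) x *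
     ((mass mu n k)^-1 * fine (\int[mu]_(y in dyadic n k) (f y)%:E))).
  by apply/funext => x; exact: cond_expE.
split.
  apply: measurable_sum => k.
  apply: (@measurable_realfun.measurable_funM _ (g_sigma_algebraType (dyadics n))) => //; apply: measurable_realfun.measurable_indic.
  by apply: sub_sigma_algebra; exists k => //=.
move=> A sA.
have mA : measurable (A : set (measurableTypeR R)).
  have h : <<s dyadics n >> `<=` (measurable : set (set (measurableTypeR R))).
    apply: smallest_sub; first exact: sigma_algebra_measurable.
    by move=> _ [k _ <-]; exact: measurable_dyadic.
  exact: h.
rewrite [RHS](integral_dyadic n)//.
under eq_integral do rewrite -sumEFin.
have mk k : measurable (dyadic n k : set (measurableTypeR R)) by exact: measurable_dyadic.
rewrite integral_sum//; last first.
  move=> k; under eq_fun do rewrite EFinM muleC.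
  apply: integrableZl => //.
  exact: (integrableS measurableT mA _ (integrable_indic mu (mk k))).
apply: eq_bigr => k _.
set c := (_ * fine _).
under eq_integral do rewrite EFinM muleC.
rewrite integralZl//; last exact: (integrableS measurableT mA _ (integrable_indic mu (mk k))).
rewrite integral_indic// setIC.
have [kA|kA] := dyadic_atom k sA.
  have -> : A `&` dyadic n k = dyadic n k by apply/setIidPr.
  rewrite /c EFinM fineK; last first.
    by apply: integrable_fin_num => //; exact: (integrableS measurableT).
  have mf : mu (dyadic n k) \is a fin_num by exact: fin_num_measure.
  have fm : (mass mu n k)%:E = mu (dyadic n k) by rewrite fineK.
  rewrite -[X in (_ * X = _)%E]fm muleAC -EFinM mulVf ?mul1e//.
  by rewrite gt_eqF// fine_gt0// mpos//= ltey_eq mf.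
have -> : A `&` dyadic n k = set0.
  by apply/seteqP; split => // x [Ax /kA].
by rewrite measure0 mule0 integral_set0.
Qed.
End CondExp.

(* Main.v *)
Require Import Defs.
From HB Require Import structures.
From mathcomp Require Import all_boot all_order all_algebra.
From mathcomp Require Import all_classical all_reals all_analysis.
From mathcomp Require Import measurable_realfun ess_sup_inf ring lra.

Set Implicit Arguments.
Unset Strict Implicit.
Unset Printing Implicit Defensive.

Import Order.TTheory GRing.Theory Num.Theory.
Import numFieldNormedType.Exports.

Local Open Scope classical_set_scope.
Local Open Scope ring_scope.

(* On the dyadic tree everything is a finite martingale computation. Split the
   product b f into its diagonal part sum_k d_k b d_k f and two paraproducts.
   The martingale G_n = E_n(diagonal part) converges because sum |d_k b| |d_k f|
   is integrable (duality of H_1 and BMO), and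
     [E_n, b] f = G_n - (diagonal part up to n) - (b - b_n) f_n,
     [H_D, b] f = P(b, f) + H_D G,
   where P(b, f) collects terms such as f_k d_k(H_D b) and d_k b H_D(f)_k. The
   maximal functions of the partial sums of P(b, f) and of
   sup_n |f_n| |b - b_n| are integrable with norm at most C |f|_{H_1}: write
   f = g + h by a Davis decomposition, use weighted L^2 estimates with an
   increasing weight for g, and bounded variation for h. So everything depends
   on H_D G: a stopping time argument gives the weak type bound in terms of
   sup_n E|G_n|, hence (i), while (ii) follows from the boundedness of H_D on
   H_1 because the identity for [E_n, b] f bounds sup_n |G_n| by
   sup_n |[E_n, b] f| up to an error of norm at most C |f|_{H_1}. The
   m-increasing hypothesis is used only in the L^1 bound for a single level of
   H_D. Almost everywhere convergence of the partial sums comes from approximating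
   f by the stopped martingales, which also determine the commutators. *)

(** * Martingales on a dyadic tree *)

(** For f in H_1 the product b f need not be integrable, so neither H_D(b f) nor E_n(b f) can be
    estimated by itself. The martingale [Gf] replaces it; it is only bounded in L^1, where H_D is of
    weak type, and this is the gap between the two claims.

    Why weights: with y = sqrt(a) z, summation by parts takes sqrt(a) out of the partial sums, and 2
    u v <= u^2 + v^2 separates E a_N from a maximal function of z that Doob controls in L^2. On the
    BMO side the matching fact is sum_k E(a_k |d_k b|^2) <= B E a_N. It needs conditional variances,
    while the norm of b is an L^p one with arbitrary p >= 1; a John-Nirenberg argument closes that
    gap.

    Bounds are stated with a number A > 0 not below the H_1 norm, because A is added to weights to
    keep them positive; A decreases to the norm at the very end. Constants are explicit, uniform in
    the level, and pass to the limit by Fatou's lemma or continuity from below. Since a commutator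
    is a chosen representative of a continuous extension, each one must be identified almost
    everywhere with an explicit limit. *)

(* A dyadic filtration seen from its points: [idx n x] is the position of the
   cell of level [n] containing [x], [rep n k] a point of the cell number [k]
   and [wt n k] its mass. Expectations of adapted functions are thus finite
   sums over representatives. *)
Record tree (R : rcfType) := Tree {
  pt :> Type;
  idx : nat -> pt -> nat;
  rep : nat -> nat -> pt;
  wt : nat -> nat -> R;
  idx_lt : forall n x, (idx n x < 2 ^ n)%N;
  idx_half : forall n x, (idx n.+1 x)./2 = idx n x;
  idx_rep : forall n k, (k < 2 ^ n)%N -> idx n (rep n k) = k;
  wt_gt0 : forall n k, (k < 2 ^ n)%N -> 0 < wt n k;
  wt_split : forall n k, (k < 2 ^ n)%N ->
    wt n k = wt n.+1 k.*2 + wt n.+1 k.*2.+1;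
  wt_root : wt 0 0 = 1 }.

Section Tree.
Context {R : rcfType} {D : tree R}.
Implicit Types (X Y a : D -> R) (n N : nat) (x : D).

Definition ad n X := forall x y, idx n x = idx n y -> X x = X y.

(** This is the expectation of [X] when [ad N X] holds, and otherwise just a weighted sum over
    representatives; linearity and monotonicity hold in both cases. *)
Definition Ex N X : R := \sum_(k < 2 ^ N) wt D N k * X (rep D N k).

Definition lch n (x : D) : D := rep D n.+1 (idx n x).*2.
Definition rch n (x : D) : D := rep D n.+1 (idx n x).*2.+1.
Definition wl n (x : D) : R := wt D n.+1 (idx n x).*2.
Definition wr n (x : D) : R := wt D n.+1 (idx n x).*2.+1.
Definition wn n (x : D) : R := wt D n (idx n x).

Definition E1 n X (x : D) : R :=
  (wl n x * X (lch n x) + wr n x * X (rch n x)) / wn n x.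

Lemma dbl_lt n k : (k < 2 ^ n)%N -> (k.*2.+1 < 2 ^ n.+1)%N.
Proof. by move=> kn; rewrite expnS mul2n ltn_Sdouble. Qed.

Lemma idxS_lch n x : idx n.+1 (lch n x) = (idx n x).*2.
Proof. by rewrite idx_rep// ltnW// dbl_lt// idx_lt. Qed.

Lemma idxS_rch n x : idx n.+1 (rch n x) = (idx n x).*2.+1.
Proof. by rewrite idx_rep// dbl_lt// idx_lt. Qed.

Lemma idx_lch n x : idx n (lch n x) = idx n x.
Proof. by rewrite -idx_half idxS_lch doubleK. Qed.

Lemma idx_rch n x : idx n (rch n x) = idx n x.
Proof. by rewrite -idx_half idxS_rch /= uphalf_double. Qed.

Lemma idxW n N x (y : D) : (n <= N)%N -> idx N x = idx N y -> idx n x = idx n y.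
Proof.
move=> /subnK <-; elim: (N - n)%N => [//|d ih]; rewrite addSn => e.
by apply: ih; rewrite -[LHS]idx_half e idx_half.
Qed.

Lemma adW n N X : (n <= N)%N -> ad n X -> ad N X.
Proof. by move=> nN aX x y e; apply: aX; exact: idxW e. Qed.

Lemma wl_gt0 n x : 0 < wl n x.
Proof. by rewrite wt_gt0// ltnW// dbl_lt// idx_lt. Qed.

Lemma wr_gt0 n x : 0 < wr n x.
Proof. by rewrite wt_gt0// dbl_lt// idx_lt. Qed.

Lemma wn_gt0 n x : 0 < wn n x.
Proof. by rewrite wt_gt0// idx_lt. Qed.

Lemma wnE n x : wn n x = wl n x + wr n x.
Proof. by rewrite /wn wt_split// idx_lt. Qed.

Lemma Ex_ext N X Y : (forall x, X x = Y x) -> Ex N X = Ex N Y.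
Proof. by move=> e; apply: eq_bigr => k _; rewrite e. Qed.

Lemma ExD N X Y : Ex N (fun x => X x + Y x) = Ex N X + Ex N Y.
Proof. by rewrite -big_split; apply: eq_bigr => k _; rewrite mulrDr. Qed.

Lemma ExZ N c X : Ex N (fun x => c * X x) = c * Ex N X.
Proof. by rewrite mulr_sumr; apply: eq_bigr => k _; rewrite mulrCA. Qed.

Lemma ExB N X Y : Ex N (fun x => X x - Y x) = Ex N X - Ex N Y.
Proof. by rewrite -sumrB; apply: eq_bigr => k _; rewrite mulrBr. Qed.

Lemma Ex_sum N m (F : nat -> D -> R) :
  Ex N (fun x => \sum_(k < m) F k x) = \sum_(k < m) Ex N (F k).
Proof.
rewrite exchange_big; apply: eq_bigr => k _.
by rewrite mulr_sumr.
Qed.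

Lemma le_Ex N X Y : (forall x, X x <= Y x) -> Ex N X <= Ex N Y.
Proof.
by move=> le; apply: ler_sum => k _; rewrite ler_wpM2l// ltW// wt_gt0.
Qed.

Lemma Ex_ge0 N X : (forall x, 0 <= X x) -> 0 <= Ex N X.
Proof. by move=> X0; apply: sumr_ge0 => k _; rewrite mulr_ge0// ltW// wt_gt0. Qed.

Lemma E1_ad n X : ad n (E1 n X).
Proof. by move=> x y e; rewrite /E1 /wl /wr /wn /lch /rch e. Qed.

Lemma E1_id n X x : ad n X -> E1 n X x = X x.
Proof.
move=> aX; rewrite /E1 (aX _ x (idx_lch n x)) (aX _ x (idx_rch n x)).
by rewrite -mulrDl -wnE mulrAC divff ?mul1r// gt_eqF// wn_gt0.
Qed.

Lemma E1_pull n a X x : ad n a -> E1 n (fun y => a y * X y) x = a x * E1 n X x.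
Proof.
move=> aa; rewrite /E1 (aa _ x (idx_lch n x)) (aa _ x (idx_rch n x)).
ring.
Qed.

Lemma E1_ext n X Y x : (forall y, X y = Y y) -> E1 n X x = E1 n Y x.
Proof. by move=> e; rewrite /E1 !e. Qed.

Lemma E1D n X Y x : E1 n (fun y => X y + Y y) x = E1 n X x + E1 n Y x.
Proof. rewrite /E1; ring. Qed.

Lemma E1B n X Y x : E1 n (fun y => X y - Y y) x = E1 n X x - E1 n Y x.
Proof. rewrite /E1; ring. Qed.

Lemma E1Z n c X x : E1 n (fun y => c * X y) x = c * E1 n X x.
Proof. rewrite /E1; ring. Qed.

Lemma le_E1_cell n X Y x : (forall y, idx n y = idx n x -> X y <= Y y) ->
  E1 n X x <= E1 n Y x.
Proof.
move=> le; rewrite ler_pM2r ?invr_gt0 ?wn_gt0// lerD// ler_wpM2l//.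
- exact/ltW/wl_gt0.
- by rewrite le// idx_lch.
- exact/ltW/wr_gt0.
- by rewrite le// idx_rch.
Qed.

Lemma le_E1 n X Y x : (forall y, X y <= Y y) -> E1 n X x <= E1 n Y x.
Proof. by move=> le; apply: le_E1_cell => y _. Qed.

Lemma E1_ge0 n X x : (forall y, 0 <= X y) -> 0 <= E1 n X x.
Proof.
move=> X0; rewrite divr_ge0 ?(ltW (wn_gt0 _ _))// addr_ge0// mulr_ge0//.
  exact/ltW/wl_gt0.
exact/ltW/wr_gt0.
Qed.

Lemma E1_cst n c x : E1 n (fun=> c) x = c.
Proof. exact: E1_id. Qed.

Lemma abs_E1 n X x : `|E1 n X x| <= E1 n (fun y => `|X y|) x.
Proof.
rewrite ler_norml -[- E1 n _ x]mulN1r -E1Z !le_E1//= => y.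
  exact: ler_norm.
by rewrite mulN1r lerNl -normrN ler_norm.
Qed.

Lemma sum_pairs m (F : nat -> R) :
  \sum_(k < m.*2) F k = \sum_(k < m) (F k.*2 + F k.*2.+1).
Proof.
elim: m => [|m ih]; first by rewrite !big_ord0.
by rewrite doubleS !big_ord_recr/= ih addrA.
Qed.

Lemma Ex_step n X : Ex n.+1 X = Ex n (E1 n X).
Proof.
rewrite /Ex expnS mul2n (sum_pairs _ (fun k => wt D n.+1 k * X (rep D n.+1 k))).
apply: eq_bigr => k _; rewrite /E1 /wl /wr /wn /lch /rch idx_rep//.
by rewrite mulrCA divff ?mulr1// gt_eqF// wt_gt0.
Qed.

Lemma Ex_ad n N X : (n <= N)%N -> ad n X -> Ex N X = Ex n X.
Proof.
move=> /subnK <-; elim: (N - n)%N => [//|d ih] aX.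
rewrite -ih// addSn Ex_step; apply: Ex_ext => x; rewrite E1_id//.
by apply: adW aX; rewrite leq_addl.
Qed.

Lemma Ex_tower n N X : (n < N)%N -> ad n.+1 X -> Ex N X = Ex N (E1 n X).
Proof.
move=> nN aX; rewrite (Ex_ad nN aX) Ex_step.
by rewrite (Ex_ad (ltnW nN))//; exact: E1_ad.
Qed.

Lemma Ex_cst N c : Ex N (fun=> c) = c.
Proof.
rewrite (@Ex_ad 0)//= /Ex big_ord_recl big_ord0/=.
by rewrite wt_root mul1r addr0.
Qed.

Lemma Ex_cond n N a X : (n < N)%N -> ad n a -> ad n.+1 X ->
  Ex N (fun x => a x * X x) = Ex N (fun x => a x * E1 n X x).
Proof.
move=> nN aa aX; rewrite (Ex_tower nN); last first.
  by move=> x y e; rewrite (aX _ _ e) (adW _ aa e).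
by apply: Ex_ext => x; rewrite E1_pull.
Qed.

Lemma Ex_cond0 n N a X : (n < N)%N -> ad n a -> ad n.+1 X ->
  (forall x, E1 n X x = 0) -> Ex N (fun x => a x * X x) = 0.
Proof.
move=> nN aa aX X0; rewrite (Ex_cond nN aa aX) (Ex_ext _ (Y := fun=> 0)) ?Ex_cst//.
by move=> x; rewrite X0 mulr0.
Qed.

Definition mart (f : nat -> D -> R) :=
  (forall n, ad n (f n)) /\ (forall n x, E1 n (f n.+1) x = f n x).

Definition mdiff (y : nat -> D -> R) :=
  (forall n, ad n.+1 (y n)) /\ (forall n x, E1 n (y n) x = 0).

Definition psum (y : nat -> D -> R) n x : R := \sum_(k < n) y k x.

(** In the usual indexing this is d_{n+1} f, measurable at level [n.+1]. The initial difference d_0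
    f = f_0 is not an increment, so it is carried separately in [Sq], [davis] and [PiN]. *)
Definition incr (f : nat -> D -> R) n x : R := f n.+1 x - f n x.

Fixpoint mx (f : nat -> D -> R) n x : R :=
  if n is n'.+1 then Num.max (mx f n' x) `|f n x| else `|f 0 x|.

(** Weights multiply differences from level [k] to [k.+1], so adaptedness makes [a k] predictable
    there; monotonicity serves summation by parts. *)
Definition weight (a : nat -> D -> R) :=
  [/\ forall n, ad n (a n), forall n x, 0 < a n x &
      forall n x, a n x <= a n.+1 x].

Lemma psumS y n x : psum y n.+1 x = psum y n x + y n x.
Proof. by rewrite /psum big_ord_recr. Qed.

Lemma psum0 y x : psum y 0 x = 0.
Proof. by rewrite /psum big_ord0. Qed.

Lemma psum_incr f n x : psum (incr f) n x = f n x - f 0 x.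
Proof.
by elim: n => [|n ih]; rewrite ?psum0 ?subrr// psumS ih /incr; ring.
Qed.

Lemma psum_ad y n : (forall k, ad k.+1 (y k)) -> ad n (psum y n).
Proof.
move=> ay; elim: n => [|n ih] x z e; first by rewrite !psum0.
by rewrite !psumS (ay n _ _ e) (ih x z)//; exact: idxW e.
Qed.

Lemma mdiff_mart y : mdiff y -> mart (psum y).
Proof.
move=> [ay y0]; split=> [n|n x]; first exact: psum_ad.
rewrite (E1_ext _ _ (Y := fun x => psum y n x + y n x)); last by move=> z; exact: psumS.
by rewrite E1D y0 addr0 E1_id//; exact: psum_ad.
Qed.

Lemma mart_mdiff f : mart f -> mdiff (incr f).
Proof.
move=> [af fE]; split=> [n x y e|n x].
  by rewrite /incr (af n.+1 _ _ e) (af n x y)//; exact: idxW e.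
by rewrite E1B fE E1_id ?subrr.
Qed.

Lemma mx_ge f n k x : (k <= n)%N -> `|f k x| <= mx f n x.
Proof.
elim: n => [|n ih]; first by rewrite leqn0 => /eqP ->.
rewrite leq_eqVlt => /predU1P[->|]/=; first by rewrite le_max lexx orbT.
by rewrite ltnS le_max => /ih ->.
Qed.

Lemma mx_le f n x c : (forall k, (k <= n)%N -> `|f k x| <= c) -> mx f n x <= c.
Proof.
elim: n => [|n ih] h /=; first exact: h.
by rewrite ge_max h// andbT ih// => k kn; apply: h; exact: leqW.
Qed.

Lemma mx_ge0 f n x : 0 <= mx f n x.
Proof. exact: le_trans (mx_ge f x (leq0n n)). Qed.

Lemma mx_ad f n : (forall k, ad k (f k)) -> ad n (mx f n).
Proof.
move=> af; elim: n => [|n ih] x y e /=; first by rewrite (af 0 _ _ e).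
by rewrite (af n.+1 _ _ e) (ih x y)//; exact: idxW e.
Qed.

Lemma mx_mono f n x : mx f n x <= mx f n.+1 x.
Proof. by rewrite /= le_max lexx. Qed.

(** Induction along the path: nothing changes while the maximum stays, and when it rises from M to s
    the right side gains (s - M)^2 more than the left. The last sum has nonnegative expectation
    because |f| is a submartingale. *)
Lemma doob_path f n x : mx f n x ^+ 2 <= 2 * `|f n x| * mx f n x -
  2 * \sum_(k < n) mx f k x * (`|f k.+1 x| - `|f k x|).
Proof.
elim: n => [|n ih] /=; first by rewrite big_ord0; nra.
rewrite big_ord_recr/=; move: ih; set s := \sum_(k < n) _.
have := mx_ge0 f n x; have := normr_ge0 (f n x); have := normr_ge0 (f n.+1 x).
rewrite maxEle; case: ifPn => [|_]; nra.
Qed.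

Lemma doob f N : mart f ->
  Ex N (fun x => mx f N x ^+ 2) <= 4 * Ex N (fun x => f N x ^+ 2).
Proof.
move=> mf; have [af fE] := mf.
pose A := Ex N (fun x => 2 * `|f N x| * mx f N x).
have h0 k : (k < N)%N -> 0 <= Ex N (fun x => mx f k x * (`|f k.+1 x| - `|f k x|)).
  move=> kN; rewrite (Ex_cond kN); [|exact: mx_ad|]; last first.
    by move=> x y e; rewrite (af k.+1 _ _ e) (af k x y)//; exact: idxW e.
  apply: Ex_ge0 => x; rewrite mulr_ge0 ?mx_ge0// E1B subr_ge0.
  rewrite [leLHS]E1_id; last by move=> u v e; rewrite (af k _ _ e).
  by rewrite -fE; exact: abs_E1.
have h1 : Ex N (fun x => mx f N x ^+ 2) <= A.
  apply: le_trans (le_Ex N (doob_path f N)) _.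
  rewrite ExB ExZ (Ex_sum N N (fun k x => mx f k x * (`|f k.+1 x| - `|f k x|))).
  rewrite lerBlDr lerDl mulr_ge0// sumr_ge0// => k _.
  exact: h0.
(* Young's inequality 2 u v <= 2 u^2 + v^2 / 2; absorbing half of the left side leaves the constant
   4. *)
have h2 : A <= Ex N (fun x => 2 * f N x ^+ 2 + 2^-1 * mx f N x ^+ 2).
  apply: le_Ex => x; rewrite -[f N x ^+ 2]real_normK ?num_real//.
  have := sqr_ge0 (2 * `|f N x| - mx f N x); lra.
by move: h2; rewrite ExD !ExZ; lra.
Qed.

Lemma orthogonality y n N : mdiff y -> (n <= N)%N ->
  Ex N (fun x => psum y n x ^+ 2) = Ex N (fun x => \sum_(k < n) y k x ^+ 2).
Proof.
move=> my; have [ay y0] := my; elim: n => [|n ih] nN.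
  by apply: Ex_ext => x; rewrite psum0 big_ord0 expr0n.
rewrite (Ex_ext _ (Y := fun x => psum y n x ^+ 2 + (2 * (psum y n x * y n x) + y n x ^+ 2))); last by move=> x; rewrite psumS; ring.
rewrite ExD ih 1?ltnW// ExD ExZ (Ex_cond0 nN)//; last exact: psum_ad.
by rewrite mulr0 add0r -ExD; apply: Ex_ext => x; rewrite big_ord_recr.
Qed.

(** Summation by parts, where the variation of [c] telescopes. It is applied along paths, [c] being
    the square root of a weight. *)
Lemma abel (c z : nat -> R) M n : (forall k, 0 <= c k) -> (forall k, c k <= c k.+1) ->
  (forall k, (k <= n)%N -> `|\sum_(j < k) z j| <= M) ->
  `|\sum_(k < n) c k * z k| <= 2 * c n * M.
Proof.
move=> c0 cS zM.
have M0 : 0 <= M by apply: le_trans (zM 0 _).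
have : `|\sum_(k < n) c k * z k - c n * \sum_(k < n) z k| <= M * (c n - c 0).
  elim: n zM => [|n ih] zM; first by rewrite !big_ord0 mulr0 subrr normr0 subrr mulr0.
  rewrite [X in X - _]big_ord_recr/=.
  have -> : \sum_(i < n) c i * z i + c n * z n - c n.+1 * \sum_(k < n.+1) z k =
      (\sum_(i < n) c i * z i - c n * \sum_(k < n) z k) +
      (c n - c n.+1) * \sum_(k < n.+1) z k.
    by rewrite big_ord_recr/=; ring.
  apply: le_trans (ler_normD _ _) _.
  have := ih (fun k kn => zM k (leqW kn)).
  have := zM n.+1 (leqnn _); rewrite normrM (ler0_norm (_ : c n - c n.+1 <= 0)) ?subr_le0//.
  have := cS n; set s := `|\sum_(k < n.+1) _|; nra.
have := zM n (leqnn _); have := c0 0%N; have := c0 n.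
set s := \sum_(k < n) z k; set t := \sum_(k < n) _ * _ => cn0 c00 sM h.
have : `|t| <= `|t - c n * s| + `|c n * s|.
  by rewrite -{1}(subrK (c n * s) t) ler_normD.
rewrite normrM (ger0_norm cn0).
nra.
Qed.

End Tree.

(** * Weighted maximal inequalities and Davis decompositions *)

Section Weights.
Context {R : rcfType} {D : tree R}.
Implicit Types (X Y : D -> R) (n N : nat) (x : D) (a b f g h : nat -> D -> R).

Lemma weight_le a m n x : weight a -> (m <= n)%N -> a m x <= a n x.
Proof.
move=> [_ _ aS] /subnK <-; elim: (n - m)%N => [//|d ih].
exact: le_trans ih (aS _ _).
Qed.

Lemma mdiff_scale a y : (forall n, ad n (a n)) -> mdiff y ->
  mdiff (fun k x => a k x * y k x).
Proof.
move=> aa [ay y0]; split=> [n x z e|n x].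
  by rewrite (ay _ _ _ e) (aa n x z)//; exact: idxW e.
by rewrite E1_pull// y0 mulr0.
Qed.

Lemma weighted_doob y a N : mdiff y -> (forall n, ad n (a n)) ->
  Ex N (fun x => mx (psum (fun k x => a k x * y k x)) N x ^+ 2) <=
  4 * Ex N (fun x => \sum_(k < N) a k x ^+ 2 * y k x ^+ 2).
Proof.
move=> my aa; have mz := mdiff_scale aa my.
apply: le_trans (doob N (mdiff_mart mz)) _.
rewrite orthogonality// ler_wpM2l// le_Ex// => x.
by apply: ler_sum => k _; rewrite exprMn.
Qed.

(** With y = sqrt(a) z, [abel] gives |psum y n| <= 2 sqrt(a_N) mx(psum z), hence at most a_N plus
    the square of that maximal function, which Doob's inequality bounds. An L^1 maximal estimate
    thus follows from L^2 alone. *)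
Lemma weighted_max y a N : mdiff y -> weight a ->
  Ex N (mx (psum y) N) <=
  Ex N (a N) + 4 * Ex N (fun x => \sum_(k < N) y k x ^+ 2 / a k x).
Proof.
move=> my wa; have [aa a0 aS] := wa.
pose c k (x : D) := Num.sqrt (a k x).
have c0 k x : 0 < c k x by rewrite sqrtr_gt0.
have ac n : ad n (fun x => (c n x)^-1) by move=> x z e; rewrite /c (aa n x z e).
pose z k (x : D) := (c k x)^-1 * y k x.
have yE k x : y k x = c k x * z k x by rewrite /z mulVKf// gt_eqF.
have h : Ex N (mx (psum y) N) <= Ex N (fun x => a N x + mx (psum z) N x ^+ 2).
  apply: le_Ex => x; apply: mx_le => n nN.
  have : `|psum y n x| <= 2 * c n x * mx (psum z) N x.
    rewrite /psum (eq_bigr (fun k : 'I_n => c k x * z k x)) => [|k _]; last exact: yE.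
    apply: (abel (c := c ^~ x) (z := z ^~ x)) => [k|k|k kn].
    - exact/ltW/c0.
    - by rewrite ler_wsqrtr.
    - by apply: (mx_ge (psum z)); exact: leq_trans nN.
  have : c n x <= c N x by rewrite ler_wsqrtr// weight_le.
  have := mx_ge0 (psum z) N x; have := sqr_sqrtr (ltW (a0 N x)).
  rewrite -/(c N x); set M := mx _ _ _ => <- M0 cnN le.
  have := ler_wpM2r M0 cnN; have := sqr_ge0 (c N x - M); lra.
apply: le_trans h _; rewrite ExD lerD2l.
apply: le_trans (weighted_doob N my ac) _.
rewrite ler_wpM2l// le_Ex// => x; apply: ler_sum => k _.
by rewrite exprVn sqr_sqrtr ?(ltW (a0 _ _))// mulrC.
Qed.

Lemma abel_dec (c z : nat -> R) M n : (forall k, 0 <= c k) -> (forall k, c k.+1 <= c k) ->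
  (forall k, (k <= n)%N -> `|\sum_(j < k) z j| <= M) ->
  `|\sum_(k < n) c k * z k| <= c 0%N * M.
Proof.
move=> c0 cS zM.
have M0 : 0 <= M by apply: le_trans (zM 0%N _).
have : `|\sum_(k < n) c k * z k - c n * \sum_(k < n) z k| <= M * (c 0%N - c n).
  elim: n zM => [|n ih] zM; first by rewrite !big_ord0 mulr0 subrr normr0 subrr mulr0.
  have -> : \sum_(k < n.+1) c k * z k - c n.+1 * \sum_(k < n.+1) z k =
      (\sum_(i < n) c i * z i - c n * \sum_(k < n) z k) +
      (c n - c n.+1) * \sum_(k < n.+1) z k.
    by rewrite !big_ord_recr/=; ring.
  apply: le_trans (ler_normD _ _) _.
  have := ih (fun k kn => zM k (leqW kn)).
  have := zM n.+1 (leqnn _); rewrite normrM (ger0_norm (_ : 0 <= c n - c n.+1)) ?subr_ge0//.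
  have := cS n; set s := `|\sum_(k < n.+1) _|; nra.
have := zM n (leqnn _); have := c0 n.
set s := \sum_(k < n) z k; set t := \sum_(k < n) _ * _ => cn0 sM h.
have : `|t| <= `|t - c n * s| + `|c n * s|.
  by rewrite -{1}(subrK (c n * s) t) ler_normD.
rewrite normrM (ger0_norm cn0); nra.
Qed.

(** The tail b_N - b_n is a sum of the differences sqrt(a_k) d b_k with decreasing coefficients 1 /
    sqrt(a_k), so [abel_dec] bounds it by 1 / sqrt(a_n) times a maximal function. Multiplication by
    a_n leaves sqrt(a_n), and the product is split as in [weighted_max]. *)
Lemma weighted_gap b a N : mart b -> weight a ->
  Ex N (mx (fun n x => a n x * (b N x - b n x)) N) <=
  Ex N (a N) + 4 * Ex N (fun x => \sum_(k < N) a k x * incr b k x ^+ 2).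
Proof.
move=> mb wa; have [aa a0 aS] := wa.
pose c k (x : D) := Num.sqrt (a k x).
have c0 k x : 0 < c k x by rewrite sqrtr_gt0.
have ac n : ad n (c n) by move=> x z e; rewrite /c (aa n x z e).
pose z k (x : D) := c k x * incr b k x.
have h : Ex N (mx (fun n x => a n x * (b N x - b n x)) N) <=
    Ex N (fun x => a N x + mx (psum z) N x ^+ 2).
  apply: le_Ex => x; apply: mx_le => n nN.
  have : `|b N x - b n x| <= (c n x)^-1 * (2 * mx (psum z) N x).
    have -> : b N x - b n x =
        \sum_(k < N - n) (c (n + k)%N x)^-1 * z (n + k)%N x.
      rewrite (eq_bigr (fun k : 'I_(N - n) => b (n + k).+1 x - b (n + k)%N x)).
        rewrite -(big_mkord xpredT (fun k => b (n + k).+1 x - b (n + k)%N x)).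
        rewrite (telescope_sumr_eq (fun k => b (n + k)%N x))//.
          by rewrite addn0 subnKC.
        by move=> k _; rewrite addnS.
      by move=> k _; rewrite /z mulKf// gt_eqF.
    have := @abel_dec (fun k => (c (n + k)%N x)^-1) (fun k => z (n + k)%N x)
      (2 * mx (psum z) N x) (N - n).
    rewrite addn0; apply.
    - by move=> k; rewrite invr_ge0 ltW.
    - by move=> k; rewrite lef_pV2 ?posrE// addnS ler_wsqrtr.
    (* A partial sum that starts at [n] is a difference of two that start at 0, hence the 2 in the
       bound. *)
    - move=> k kN.
      have -> : \sum_(j < k) z (n + j)%N x = psum z (n + k) x - psum z n x.
        by rewrite /psum big_split_ord/= addrAC subrr add0r.
      apply: le_trans (ler_normB _ _) _.
      have := mx_ge (psum z) x nN.
      have : (n + k <= N)%N by rewrite -leq_subRL.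
      by move=> /(mx_ge (psum z) x); lra.
  rewrite normrM gtr0_norm//.
  have : c n x <= c N x by rewrite ler_wsqrtr// weight_le.
  have := mx_ge0 (psum z) N x; have := sqr_sqrtr (ltW (a0 N x)).
  have := sqr_sqrtr (ltW (a0 n x)); have := c0 n x.
  rewrite -/(c N x) -/(c n x); set M := mx _ _ _; set t := `|_|.
  move=> cn0 an aN M0 cnN tM.
  have : c n x * t <= 2 * M.
    by move: tM; rewrite ler_pdivlMl.
  rewrite -aN -an => le; have := ler_wpM2l (ltW cn0) le.
  have := ler_wpM2r M0 cnN; have := sqr_ge0 (c N x - M); lra.
apply: le_trans h _; rewrite ExD lerD2l.
apply: le_trans (weighted_doob N (mart_mdiff mb) ac) _.
rewrite ler_wpM2l// le_Ex// => x; apply: ler_sum => k _.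
by rewrite sqr_sqrtr// ltW.
Qed.

(* [v] stands for the conditional variance of [b N]. *)
Definition bmo2 b (B : R) := [/\ mart b, forall n x, `|incr b n x| <= B &
  forall N, exists v : nat -> D -> R, [/\ forall n, (n <= N)%N -> ad n (v n),
    forall n x, (n <= N)%N -> 0 <= v n x <= B &
    forall n x, (n < N)%N ->
      E1 n (fun y => incr b n y ^+ 2) x + E1 n (v n.+1) x <= v n x]].

Lemma bmo2_ge0 b B (x : D) : bmo2 b B -> 0 <= B.
Proof. by move=> [_ /(_ 0%N x) h _]; exact: le_trans h. Qed.

Lemma ad_sqr_incr b n : mart b -> ad n.+1 (fun x => incr b n x ^+ 2).
Proof. by move=> /mart_mdiff[ab _] x y e; rewrite (ab _ _ _ e). Qed.

(** Induction on the level [m], with E(a_m v_m) as the variance still to be spent: raising the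
    weight from a_m to a_{m+1} costs at most B (a_{m+1} - a_m), because v <= B. *)
Lemma bmo2_weight b B a N : bmo2 b B -> weight a ->
  Ex N (fun x => \sum_(k < N) a k x * incr b k x ^+ 2) <= B * Ex N (a N).
Proof.
move=> [mb _ /(_ N)[v [av v0B vE]]] [aa a0 aS].
rewrite (Ex_sum N N (fun k x => a k x * incr b k x ^+ 2)).
have : forall m, (m <= N)%N ->
    \sum_(k < m) Ex N (fun x => a k x * incr b k x ^+ 2) +
    Ex N (fun x => a m x * v m x) <= B * Ex N (a m).
  elim=> [_|m ih mN].
    rewrite big_ord0 add0r -ExZ; apply: le_Ex => x.
    by have := a0 0%N x; have /andP[] := v0B 0%N x (leq0n N); nra.
  have {ih} := ih (ltnW mN); rewrite big_ord_recr/=.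
  have h1 : Ex N (fun x => a m x * incr b m x ^+ 2) +
      Ex N (fun x => a m x * v m.+1 x) <= Ex N (fun x => a m x * v m x).
    rewrite (Ex_cond mN (aa m) (ad_sqr_incr mb)).
    rewrite (Ex_cond mN (aa m) (av _ mN)) -ExD; apply: le_Ex => x.
    by rewrite -mulrDr ler_wpM2l ?vE// ltW.
  have h2 : Ex N (fun x => a m.+1 x * v m.+1 x) - Ex N (fun x => a m x * v m.+1 x)
      <= B * Ex N (a m.+1) - B * Ex N (a m).
    rewrite -mulrBr -!ExB -ExZ; apply: le_Ex => x.
    by have := aS m x; have /andP[] := v0B m.+1 x mN; nra.
  by move: h1 h2; set s := \sum_(k < m) _; lra.
move=> /(_ N (leqnn N)); apply: le_trans; rewrite lerDl Ex_ge0// => x.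
by rewrite mulr_ge0 ?(ltW (a0 _ _))//; have /andP[] := v0B N x (leqnn N).
Qed.

(* Davis decomposition [f = g + h] up to level [N]: [g] is square integrable
   against the inverse of an increasing weight [a], and [h] has integrable
   variation. *)
Definition davis N f (A : R) := exists g h a,
  [/\ [/\ mart g, mart h, weight a & forall n x, f n x = g n x + h n x],
      forall x, g 0%N x = 0, Ex N (a N) <= A,
      Ex N (fun x => \sum_(k < N) incr g k x ^+ 2 / a k x) <= A &
      Ex N (fun x => `|h 0%N x| + \sum_(k < N) `|incr h k x|) <= A].

Section Split.
Variables (f : nat -> D -> R) (big : nat -> D -> bool).
Hypotheses (mf : mart f).
Hypothesis abig : forall n x (y : D), idx n.+1 x = idx n.+1 y -> big n x = big n y.

Let sm n x := if big n x then 0 else incr f n x.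
Let bg n x := if big n x then incr f n x else 0.

(** Dropping the increments marked by [big] destroys the martingale property, so the others are
    recentred by their conditional mean. [big_part] receives the marked increments, the compensator
    and the initial value. A mark may depend on the jump itself, hence is known one level later. *)
Definition small_part := psum (fun n x => sm n x - E1 n (sm n) x).
Definition big_part n x := f n x - small_part n x.

Let ad_incr n : ad n.+1 (incr f n).
Proof. by have [] := mart_mdiff mf. Qed.

Let ad_sm n : ad n.+1 (sm n).
Proof. by move=> x y e; rewrite /sm (abig e) (ad_incr e). Qed.

Let ad_bg n : ad n.+1 (bg n).
Proof. by move=> x y e; rewrite /bg (abig e) (ad_incr e). Qed.

Lemma mart_small : mart small_part.
Proof.
apply: mdiff_mart; split=> [n x y e|n x].
  by rewrite (ad_sm e); congr (_ - _); apply: E1_ad; exact: idxW e.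
by rewrite E1B [X in _ - X]E1_id ?subrr//; exact: E1_ad.
Qed.

Lemma mart_big : mart big_part.
Proof.
have [as_ sE] := mart_small; have [af fE] := mf.
split=> [n x y e|n x]; first by rewrite /big_part (as_ _ _ _ e) (af _ _ _ e).
by rewrite E1B fE sE.
Qed.

Lemma incr_small n x : incr small_part n x = sm n x - E1 n (sm n) x.
Proof. by rewrite /incr /small_part psumS addrAC subrr add0r. Qed.

Lemma incr_big n x : incr big_part n x = bg n x - E1 n (bg n) x.
Proof.
have -> : E1 n (bg n) x = - E1 n (sm n) x.
  apply/eqP; rewrite -addr_eq0 -E1D -[X in _ == X](proj2 (mart_mdiff mf) n x).
  by apply/eqP/E1_ext => y; rewrite /bg /sm; case: ifP; rewrite ?addr0 ?add0r.
rewrite opprK; have := incr_small n x; rewrite /incr /big_part /bg /sm /incr.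
by case: ifP => _; lra.
Qed.

(** Recentring replaces a conditional second moment by the conditional variance, which is
    smaller. *)
Lemma small_sqr c n N : (n < N)%N -> ad n c -> (forall x, 0 <= c x) ->
  Ex N (fun x => c x * incr small_part n x ^+ 2) <= Ex N (fun x => c x * sm n x ^+ 2).
Proof.
move=> nN ac c0; rewrite (Ex_cond nN ac (ad_sqr_incr mart_small)).
rewrite [leRHS](Ex_cond nN ac); last by move=> x y e; rewrite (ad_sm e).
apply: le_Ex => x; rewrite ler_wpM2l//.
rewrite (E1_ext _ _ (Y := fun y => sm n y ^+ 2 -
  (2 * (E1 n (sm n) y * sm n y) - E1 n (sm n) y ^+ 2))); last first.
  by move=> y; rewrite incr_small; ring.
rewrite E1B E1B E1Z E1_pull; last exact: E1_ad.
rewrite (E1_id (X := fun y => E1 n (sm n) y ^+ 2)); last first.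
  by move=> y z e; congr (_ ^+ 2); exact: E1_ad.
have := sqr_ge0 (E1 n (sm n) x); lra.
Qed.

(** In L^1 the compensator costs at most as much as the jumps, hence the 2. *)
Lemma big_abs n N : (n < N)%N ->
  Ex N (fun x => `|incr big_part n x|) <= 2 * Ex N (fun x => `|bg n x|).
Proof.
move=> nN.
have -> : 2 * Ex N (fun x => `|bg n x|) =
    Ex N (fun x => `|bg n x| + E1 n (fun y => `|bg n y|) x).
  rewrite ExD -(Ex_tower nN); last by move=> x y e; rewrite (ad_bg e).
  ring.
apply: le_Ex => x; rewrite incr_big; apply: le_trans (ler_normB _ _) _.
by rewrite lerD2l abs_E1.
Qed.

Lemma small_bound n x (M : D -> R) : ad n M -> (forall y, `|sm n y| <= M y) ->
  `|incr small_part n x| <= 2 * M x.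
Proof.
move=> aM smM; rewrite incr_small; apply: le_trans (ler_normB _ _) _.
have h : E1 n (fun y => `|sm n y|) x <= M x by rewrite -(E1_id x aM) le_E1.
have := le_trans (abs_E1 n (sm n) x) h; have := smM x; lra.
Qed.

End Split.

Definition Sq f n x : R := Num.sqrt (f 0%N x ^+ 2 + \sum_(k < n) incr f k x ^+ 2).

Lemma Sq_sum_ge0 f n x : 0 <= f 0%N x ^+ 2 + \sum_(k < n) incr f k x ^+ 2.
Proof. by rewrite addr_ge0 ?sqr_ge0// sumr_ge0// => k _; rewrite sqr_ge0. Qed.

Lemma SqS f n x : Sq f n.+1 x ^+ 2 = Sq f n x ^+ 2 + incr f n x ^+ 2.
Proof. by rewrite !sqr_sqrtr ?Sq_sum_ge0// big_ord_recr addrA. Qed.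

Lemma Sq_ge0 f n x : 0 <= Sq f n x. Proof. exact: sqrtr_ge0. Qed.

Lemma Sq_mono f n x : Sq f n x <= Sq f n.+1 x.
Proof.
by rewrite ler_wsqrtr// big_ord_recr/= addrA lerDl sqr_ge0.
Qed.

Lemma Sq_ad f n : mart f -> ad n (Sq f n).
Proof.
move=> mf; have [af _] := mf; have [ai _] := mart_mdiff mf.
move=> x y e; rewrite /Sq (af 0%N x y) ?(idxW _ e)//.
congr (Num.sqrt (_ + _)); apply: eq_bigr => k _.
by rewrite (ai k x y)// (idxW _ e).
Qed.

(** Let S be the square function and call a jump d big when |d| > 2 S_k. A small jump has d^2 =
    (S_{k+1} - S_k)(S_{k+1} + S_k) <= 4 S_k (S_{k+1} - S_k); a big one has |d| <= S_{k+1} and |d| <=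
    2 (S_{k+1} - S_k). Divided by the weight, respectively doubled by [big_abs], both telescope with
    constant 4. The term [e] keeps the weight S + e positive. *)
Lemma davis_Sq f N e : mart f -> 0 < e -> davis N f (4 * Ex N (Sq f N) + e).
Proof.
move=> mf e0; have [ai _] := mart_mdiff mf.
pose big n x := 2 * Sq f n x < `|incr f n x|.
have abig n x (y : D) : idx n.+1 x = idx n.+1 y -> big n x = big n y.
  by move=> xy; rewrite /big (ai _ _ _ xy) (Sq_ad (n := n) mf (y := y))// (idxW _ xy).
have ES0 : 0 <= Ex N (Sq f N) by apply: Ex_ge0 => x; exact: Sq_ge0.
exists (small_part f big), (big_part f big), (fun n x => Sq f n x + e); split.
- split; [exact: mart_small|exact: mart_big| |].
    split=> [n x y xy|n x|n x]; first by rewrite (Sq_ad mf xy).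
      by rewrite ltr_wpDl// Sq_ge0.
    by rewrite lerD2r Sq_mono.
  by move=> n x; rewrite /big_part addrC subrK.
- by move=> x; rewrite /small_part psum0.
- by rewrite ExD Ex_cst; lra.
- rewrite (Ex_sum N N (fun k x => incr (small_part f big) k x ^+ 2 / (Sq f k x + e))).
  apply: (@le_trans _ _ (\sum_(k < N) Ex N (fun x => 4 * (Sq f k.+1 x - Sq f k x)))).
    apply: ler_sum => k _.
    rewrite (Ex_ext N (Y := fun x => (Sq f k x + e)^-1 *
      incr (small_part f big) k x ^+ 2)); last by move=> x; rewrite mulrC.
    apply: le_trans (small_sqr mf abig (ltn_ord k) _ _) _.
      by move=> x y xy; rewrite (Sq_ad mf xy).
    - by move=> x; rewrite invr_ge0 addr_ge0 ?Sq_ge0// ltW.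
    apply: le_Ex => x; have := Sq_ge0 f k x; have := SqS f k x.
    have := Sq_mono f k x; rewrite /big; case: ifPn => [|].
      by rewrite expr0n mulr0; lra.
    rewrite -leNgt => le mo SE S0.
    rewrite mulrC ler_pdivrMr ?ltr_wpDl//.
    have F2 : incr f k x ^+ 2 <= 4 * Sq f k x ^+ 2.
      by rewrite -[incr f k x ^+ 2]real_normK ?num_real//; have := normr_ge0 (incr f k x); nra.
    have : Sq f k.+1 x <= 3 * Sq f k x by rewrite -ler_sqr ?nnegrE ?mulr_ge0// ?Sq_ge0//; nra.
    by nra.
  rewrite -(Ex_sum N N (fun k x => 4 * (Sq f k.+1 x - Sq f k x))).
  rewrite (_ : 4 * Ex N (Sq f N) + e = Ex N (fun x => 4 * Sq f N x + e)); last first.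
    by rewrite ExD Ex_cst ExZ.
  apply: le_Ex => x; rewrite -mulr_sumr.
  rewrite -[X in 4 * X]/(psum (incr (Sq f)) N x) psum_incr.
  by have := Sq_ge0 f 0%N x; lra.
- rewrite ExD (Ex_sum N N (fun k x => `|incr (big_part f big) k x|)).
  apply: (@le_trans _ _ (Ex N (Sq f 0) +
      \sum_(k < N) Ex N (fun x => 4 * (Sq f k.+1 x - Sq f k x)))).
    apply: lerD.
      apply: le_Ex => x; rewrite /big_part /small_part psum0 subr0.
      by rewrite /Sq big_ord0 addr0 sqrtr_sqr.
    apply: ler_sum => k _; apply: le_trans (big_abs mf abig (ltn_ord k)) _.
    rewrite -ExZ; apply: le_Ex => x.
    have := Sq_ge0 f k x; have := SqS f k x; have := Sq_ge0 f k.+1 x.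
    have := Sq_mono f k x; rewrite /big; case: ifPn => [|_]; last by rewrite normr0; lra.
    move=> le mo S1 SE S0.
    have : `|incr f k x| <= Sq f k.+1 x.
      by rewrite -ler_sqr ?nnegrE// real_normK ?num_real// SE; nra.
    by lra.
  rewrite -(Ex_sum N N (fun k x => 4 * (Sq f k.+1 x - Sq f k x))) -ExD.
  rewrite (_ : 4 * Ex N (Sq f N) + e = Ex N (fun x => 4 * Sq f N x + e)); last first.
    by rewrite ExD Ex_cst ExZ.
  apply: le_Ex => x; rewrite -mulr_sumr.
  rewrite -[X in 4 * X]/(psum (incr (Sq f)) N x) psum_incr.
  by have := Sq_ge0 f 0%N x; lra.
Qed.

End Weights.

(** * The dyadic Hilbert transform *)

Section Maximal.
Context {R : rcfType} {D : tree R}.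
Implicit Types (X Y : D -> R) (n N : nat) (x : D) (a b f g h : nat -> D -> R).

(** Meant for [Gf], about which claim (ii) gives the maximal function and not the square function.
    The weight also contains the variation [V] of h, so that it dominates g = f - h. *)
Lemma davis_mx f N e : mart f -> 0 < e -> davis N f (64 * Ex N (mx f N) + 8 * e).
Proof.
move=> mf e0; have [af fE] := mf; have [ai _] := mart_mdiff mf.
pose big n x := 3 * mx f n x < `|incr f n x|.
have abig n x (y : D) : idx n.+1 x = idx n.+1 y -> big n x = big n y.
  by move=> xy; rewrite /big (ai _ _ _ xy) (mx_ad (n := n) af (y := y))// (idxW _ xy).
pose g := small_part f big; pose h := big_part f big.
have mg : mart g by exact: mart_small.
have mh : mart h by exact: mart_big.
have [ag _] := mg; have [ah _] := mh; have [aih _] := mart_mdiff mh.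
have fgh n x : f n x = g n x + h n x by rewrite /h /big_part addrC subrK.
have h0 x : h 0%N x = f 0%N x by rewrite /h /big_part /small_part psum0 subr0.
have M0 : 0 <= Ex N (mx f N) by apply: Ex_ge0 => x; exact: mx_ge0.
pose V n x : R := `|h 0%N x| + \sum_(k < n) `|incr h k x|.
have V0 n x : 0 <= V n x by rewrite addr_ge0// sumr_ge0.
have VS n x : V n.+1 x = V n x + `|incr h n x| by rewrite /V big_ord_recr addrA.
have hV n x : `|h n x| <= V n x.
  elim: n => [|n ih]; first by rewrite /V big_ord0 addr0.
  rewrite VS -(subrK (h n x) (h n.+1 x)) -/(incr h n x) addrC.
  by apply: le_trans (ler_normD _ _) _; rewrite lerD2r.
have aV n : ad n (V n).
  elim: n => [|n ih] x y xy; first by rewrite /V !big_ord0 (ah _ _ _ xy).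
  by rewrite !VS (aih _ _ _ xy) (ih x y)// (idxW _ xy).
have VN : Ex N (V N) <= 7 * Ex N (mx f N).
  rewrite /V ExD (Ex_sum N N (fun k x => `|incr h k x|)).
  (* Write M for [mx f]. A big jump d has |d| > 3 M_k, so |f_{k+1}| > 2 M_k and |d| <= M_{k+1} + M_k
     <= 3 (M_{k+1} - M_k); the compensator doubles 3 to 6. *)
  apply: (@le_trans _ _ (Ex N (mx f 0) +
      \sum_(k < N) Ex N (fun x => 6 * (mx f k.+1 x - mx f k x)))).
    apply: lerD; first by apply: le_Ex => x; rewrite h0.
    apply: ler_sum => k _; apply: le_trans (big_abs mf abig (ltn_ord k)) _.
    rewrite -ExZ; apply: le_Ex => x.
    have m0 := mx_ge0 f k x; have mo := mx_mono f k x.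
    rewrite /big; case: ifPn => [|_]; last by rewrite normr0; lra.
    have := mx_ge f x (leqnn k); have := mx_ge f x (leqnn k.+1).
    have : `|incr f k x| <= `|f k.+1 x| + `|f k x| by exact: ler_normB.
    by move: mo m0; lra.
  rewrite -(Ex_sum N N (fun k x => 6 * (mx f k.+1 x - mx f k x))) -ExD -ExZ.
  apply: le_Ex => x; rewrite -mulr_sumr.
  rewrite -[X in 6 * X]/(psum (incr (mx f)) N x) psum_incr.
  by have := mx_ge0 f 0%N x; have := mx_ge f x (leq0n N); rewrite -[`|f 0%N x|]/(mx f 0 x); lra.
pose a n x := mx f n x + V n x + e.
have wa : weight a.
  split=> [n x y xy|n x|n x]; first by rewrite /a (mx_ad af xy) (aV n x y xy).
    by rewrite ltr_wpDl// addr_ge0 ?mx_ge0.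
  by rewrite lerD2r lerD ?mx_mono// VS lerDl.
have [aa a0 aS] := wa.
have aN : Ex N (a N) <= 8 * Ex N (mx f N) + e by rewrite /a 2!ExD Ex_cst; move: VN; lra.
have ga n x : `|g n x| <= a n x.
  have -> : g n x = f n x - h n x by rewrite fgh addrK.
  apply: le_trans (ler_normB _ _) _.
  by have := mx_ge f x (leqnn n); have := hV n x; rewrite /a; lra.
have iga n x : `|incr g n x| <= 6 * a n x.
  have : `|incr g n x| <= 2 * (3 * mx f n x).
    apply: (@small_bound _ _ f big n x (fun x => 3 * mx f n x)) => [y z yz|y].
      by rewrite (mx_ad af yz).
    by case: ifPn; rewrite /big -?leNgt// normr0 mulr_ge0 ?mx_ge0.
  have := V0 n x; rewrite /a; lra.
have ga7 n x : `|g n.+1 x| <= 7 * a n x.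
  have -> : g n.+1 x = incr g n x + g n x by rewrite /incr subrK.
  apply: le_trans (ler_normD _ _) _.
  by have := ga n x; have := iga n x; lra.
exists g, h, a; split.
- by split.
- by move=> x; rewrite /g /small_part psum0.
- lra.
- rewrite (Ex_sum N N (fun k x => incr g k x ^+ 2 / a k x)).
  (* As g is a martingale, E(d g_m^2 / a_m) = E((g_{m+1}^2 - g_m^2) / a_m). Changing the denominator
     to a_{m+1} costs g_{m+1}^2 (a_{m+1} - a_m) / (a_m a_{m+1}), at most 7 (a_{m+1} - a_m) since
     |g_{m+1}| is below both 7 a_m and a_{m+1}. The total is 8 E a_N, with E a_N <= 8 E(mx f N) +
     e. *)
  have key m : (m <= N)%N -> \sum_(k < m) Ex N (fun x => incr g k x ^+ 2 / a k x) <=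
      Ex N (fun x => g m x ^+ 2 / a m x + 7 * a m x).
    elim: m => [_|m ih mN].
      rewrite big_ord0 Ex_ge0// => x; have := a0 0%N x => /ltW a00.
      by rewrite addr_ge0// ?divr_ge0 ?sqr_ge0 ?mulr_ge0.
    rewrite big_ord_recr/=; have {ih} := ih (ltnW mN).
    set s := \sum_(k < m) _ => ih.
    have -> : Ex N (fun x => incr g m x ^+ 2 / a m x) =
        Ex N (fun x => (g m.+1 x ^+ 2 - g m x ^+ 2) / a m x).
      rewrite -[RHS]subr0 -[X in _ = _ - X](mulr0 2).
      rewrite -[X in _ = _ - 2 * X](@Ex_cond0 _ _ m N (fun x => g m x / a m x) (incr g m))//; last 3 first.
      + by move=> x y xy; rewrite (ag _ _ _ xy) (aa _ _ _ xy).
      + by have [] := mart_mdiff mg.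
      + by have [] := mart_mdiff mg.
      by rewrite -ExZ -ExB; apply: Ex_ext => x; rewrite /incr; ring.
    apply: le_trans (lerD ih (lexx _)) _; rewrite -ExD; apply: le_Ex => x.
    have am := a0 m x; have am1 := a0 m.+1 x; have amS := aS m x.
    have -> : g m x ^+ 2 / a m x + 7 * a m x + (g m.+1 x ^+ 2 - g m x ^+ 2) / a m x =
      g m.+1 x ^+ 2 / a m x + 7 * a m x by ring.
    suff : g m.+1 x ^+ 2 / a m x - g m.+1 x ^+ 2 / a m.+1 x <= 7 * (a m.+1 x - a m x) by lra.
    have -> : g m.+1 x ^+ 2 / a m x - g m.+1 x ^+ 2 / a m.+1 x =
       g m.+1 x ^+ 2 * (a m.+1 x - a m x) / (a m x * a m.+1 x).
      by field; rewrite !gt_eqF.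
    rewrite ler_pdivrMr ?mulr_gt0// -[_ ^+ 2]real_normK ?num_real//.
    rewrite mulrC (mulrC 7) -!mulrA ler_wpM2l ?subr_ge0// mulrA.
    by rewrite expr2 ler_pM.
  apply: le_trans (key N (leqnn N)) _.
  apply: (@le_trans _ _ (8 * Ex N (a N))); last lra.
  rewrite -ExZ; apply: le_Ex => x; have aN0 := a0 N x.
  suff : g N x ^+ 2 / a N x <= a N x by lra.
  rewrite ler_pdivrMr// -[_ ^+ 2]real_normK ?num_real//.
  by rewrite expr2 ler_pM.
- by rewrite -[X in X <= _]/(Ex N (V N)); lra.
Qed.

(* For the cell I of level n containing x, [mI n x] is m(I) and [hr n x] is
   h_I(x); [hs n X] sums the terms of the transform for the children of the
   cells of level n, [X] being the martingale at level n + 1. *)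
Definition sgn n x : R := if odd (idx n x) then -1 else 1.
Definition mI n x : R := wl n x * wr n x / wn n x.
Definition hr n x : R :=
  Num.sqrt (mI n x) * (if odd (idx n.+1 x) then - (wr n x)^-1 else (wl n x)^-1).
Definition hq n X x : R :=
  sgn n.+1 x * (Num.sqrt (mI n x) * (X (lch n x) - X (rch n x))).
Definition hs n X x : R := hq n X x * hr n.+1 x.

Lemma mI_gt0 n x : 0 < mI n x.
Proof. by rewrite divr_gt0 ?mulr_gt0 ?wl_gt0 ?wr_gt0 ?wn_gt0. Qed.

Lemma wl_ad n : ad n (wl n : D -> R). Proof. by move=> x y e; rewrite /wl e. Qed.
Lemma wr_ad n : ad n (wr n : D -> R). Proof. by move=> x y e; rewrite /wr e. Qed.
Lemma wn_ad n : ad n (wn n : D -> R). Proof. by move=> x y e; rewrite /wn e. Qed.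
Lemma mI_ad n : ad n (mI n).
Proof. by move=> x y e; rewrite /mI /wl /wr /wn e. Qed.

Lemma hq_ad n X : ad n.+1 (hq n X).
Proof.
move=> x y e; rewrite /hq /sgn e /lch /rch (mI_ad (n := n) (y := y)) ?(idxW _ e)//.
Qed.

Lemma hr_ad n : ad n.+1 (hr n).
Proof.
move=> x y e; have e' := idxW (leqnSn n) e.
by rewrite /hr e (mI_ad e') (wl_ad e') (wr_ad e').
Qed.

Lemma hs_ad n X : ad n.+2 (hs n X).
Proof.
move=> x y e; have e' := idxW (leqnSn n.+1) e.
by rewrite /hs (hr_ad e) (hq_ad X e').
Qed.

Lemma hr_lch n x : hr n (lch n x) = Num.sqrt (mI n x) / wl n x.
Proof.
rewrite /hr idxS_lch odd_double (mI_ad (idx_lch n x)).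
by rewrite (wl_ad (idx_lch n x)).
Qed.

Lemma hr_rch n x : hr n (rch n x) = - (Num.sqrt (mI n x) / wr n x).
Proof.
rewrite /hr idxS_rch/= odd_double/= (mI_ad (idx_rch n x)) mulrN.
by rewrite (wr_ad (idx_rch n x)).
Qed.

Lemma E1_hs n X x : E1 n.+1 (hs n X) x = 0.
Proof.
rewrite (E1_pull (hr n.+1) x (@hq_ad n X)) /E1 hr_lch hr_rch.
have := wl_gt0 n.+1 x; have := wr_gt0 n.+1 x => r0 l0.
rewrite mulrN (mulrC (wl _ _)) (mulrC (wr _ _)) !divfK ?gt_eqF//.
by rewrite subrr mul0r mulr0.
Qed.

Lemma hsD n X Y x : hs n (fun y => X y + Y y) x = hs n X x + hs n Y x.
Proof. rewrite /hs /hq; ring. Qed.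

Lemma hsB n X Y x : hs n (fun y => X y - Y y) x = hs n X x - hs n Y x.
Proof. rewrite /hs /hq; ring. Qed.

Lemma hs_ext n X Y x : (forall y, X y = Y y) -> hs n X x = hs n Y x.
Proof. by move=> e; rewrite /hs /hq !e. Qed.

(** [hs n] sees its argument only through the difference of its values on two sibling cells, so a
    factor measurable at level [n] passes through. *)
Lemma hs_pull n X Y x : ad n X -> hs n (fun y => X y * Y y) x = X x * hs n Y x.
Proof.
move=> aX; rewrite /hs /hq (aX _ _ (idx_lch n x)) (aX _ _ (idx_rch n x)); ring.
Qed.

Lemma hs0 n X x : ad n X -> hs n X x = 0.
Proof.
move=> aX; rewrite /hs /hq (aX _ _ (idx_lch n x)) (aX _ _ (idx_rch n x)); ring.
Qed.

Lemma hs_incr n f x : ad n (f n) -> hs n (incr f n) x = hs n (f n.+1) x.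
Proof. by move=> af; rewrite hsB [X in _ - X]hs0// subr0. Qed.

Lemma wn_lch n x : wn n.+1 (lch n x) = wl n x.
Proof. by rewrite /wn idxS_lch. Qed.

Lemma wn_rch n x : wn n.+1 (rch n x) = wr n x.
Proof. by rewrite /wn idxS_rch. Qed.

Lemma E1_inv_wn n x : E1 n (fun y => (wn n.+1 y)^-1) x = 2 / wn n x.
Proof.
by rewrite /E1 wn_lch wn_rch !mulfV ?gt_eqF ?wl_gt0 ?wr_gt0.
Qed.

Lemma E1_hr_sqr n x : E1 n (fun y => hr n y ^+ 2) x = (wn n x)^-1.
Proof.
have := wl_gt0 n x; have := wr_gt0 n x; have := wn_gt0 n x => w0 r0 l0.
rewrite /E1 hr_lch hr_rch sqrrN !expr_div_n !sqr_sqrtr ?(ltW (mI_gt0 _ _))// /mI.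
by move: w0; rewrite wnE => w0; field; rewrite !gt_eqF.
Qed.

Lemma E1_hr_abs n x : E1 n (fun y => `|hr n y|) x = 2 * Num.sqrt (mI n x) / wn n x.
Proof.
have := wl_gt0 n x; have := wr_gt0 n x; have := wn_gt0 n x => w0 r0 l0.
rewrite /E1 hr_lch hr_rch normrN !ger0_norm ?divr_ge0 ?sqrtr_ge0 ?ltW//.
by field; rewrite !gt_eqF.
Qed.

Let del n X x : R := X (lch n x) - X (rch n x).

Let del_ad n X : ad n (del n X).
Proof. by move=> x y e; rewrite /del /lch /rch e. Qed.

Lemma hq_sqr n X x : hq n X x ^+ 2 = mI n x * del n X x ^+ 2.
Proof.
rewrite /hq !exprMn sqr_sqrtr ?(ltW (mI_gt0 _ _))//.
by rewrite /sgn; case: ifP => _; rewrite ?sqrrN expr1n mul1r.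
Qed.

Lemma hq_abs n X x : `|hq n X x| = Num.sqrt (mI n x) * `|del n X x|.
Proof.
rewrite /hq !normrM (ger0_norm (sqrtr_ge0 _)).
by rewrite /sgn; case: ifP => _; rewrite ?normrN normr1 mul1r.
Qed.

(** Bessel's inequality on one cell; the missing term is the square of the mean, since wl wr (p -
    q)^2 + (wl p + wr q)^2 = (wl + wr)(wl p^2 + wr q^2). *)
Lemma del_sqr n X x : mI n x * del n X x ^+ 2 / wn n x <= E1 n (fun y => X y ^+ 2) x.
Proof.
have := wl_gt0 n x; have := wr_gt0 n x; have := wn_gt0 n x => w0 r0 l0.
rewrite ler_pM2r ?invr_gt0// /del /mI mulrAC ler_pdivrMr// wnE.
set p := X _; set q := X _.
by have := sqr_ge0 (wl n x * p + wr n x * q); lra.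
Qed.

Lemma del_abs n X x : mI n x * `|del n X x| / wn n x <= E1 n (fun y => `|X y|) x.
Proof.
have := wl_gt0 n x; have := wr_gt0 n x; have := wn_gt0 n x => w0 r0 l0.
rewrite ler_pM2r ?invr_gt0// /del /mI mulrAC ler_pdivrMr// wnE.
have := ler_normB (X (lch n x)) (X (rch n x)).
set d := `|_ - _|; set p := `|_|; set q := `|_| => le.
have p0 : 0 <= p by exact: normr_ge0. have q0 : 0 <= q by exact: normr_ge0.
have := ler_wpM2l (ltW (mulr_gt0 l0 r0)) le; nra.
Qed.

(** The coefficient of a cell is used on both of its children, each time with a normalised Haar
    function: the energy at most doubles. *)
Lemma Ex_hs_sqr n N X c : (n.+1 < N)%N -> ad n c -> (forall x, 0 <= c x) -> ad n.+1 X ->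
  Ex N (fun x => c x * hs n X x ^+ 2) <= 2 * Ex N (fun x => c x * X x ^+ 2).
Proof.
move=> nN ac c0 aX; have nN' := ltnW nN.
rewrite (Ex_cond nN (adW (leqnSn n) ac)); last by move=> x y e; rewrite (hs_ad X e).
have E x : E1 n.+1 (fun y => hs n X y ^+ 2) x = mI n x * del n X x ^+ 2 * (wn n.+1 x)^-1.
  rewrite (E1_ext _ _ (Y := fun y => hq n X y ^+ 2 * hr n.+1 y ^+ 2)); last first.
    by move=> y; rewrite exprMn.
  rewrite E1_pull; last by move=> y z e; rewrite (hq_ad X e).
  by rewrite E1_hr_sqr hq_sqr.
rewrite (Ex_ext N (Y := fun x => (c x * (mI n x * del n X x ^+ 2)) * (wn n.+1 x)^-1)); last first.
  by move=> x; rewrite E mulrA.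
rewrite (Ex_cond nN'); last 2 first.
- by move=> x y e; rewrite (ac _ _ e) (mI_ad e) (del_ad X e).
- by move=> x y e; rewrite (wn_ad e).
rewrite (Ex_cond nN' ac); last by move=> x y e; rewrite (aX _ _ e).
rewrite -ExZ; apply: le_Ex => x; rewrite E1_inv_wn.
have := ler_wpM2l (c0 x) (del_sqr n X x); lra.
Qed.

(** For a child J of I the L^1 norm of h_J is 2 sqrt(m(J)) and its coefficient is sqrt(m(I)) |del|.
    By [mC] the product is at most 2 sqrt(C) m(I) |del|, which [del_abs] controls; the two children
    give 4 sqrt(C). *)
Lemma Ex_hs_abs C n N X c : (forall n x, mI n.+1 x <= C * mI n x) -> 0 < C ->
  (n.+1 < N)%N -> ad n c -> (forall x, 0 <= c x) -> ad n.+1 X ->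
  Ex N (fun x => c x * `|hs n X x|) <= 4 * Num.sqrt C * Ex N (fun x => c x * `|X x|).
Proof.
move=> mC C0 nN ac c0 aX; have nN' := ltnW nN.
rewrite (Ex_cond nN (adW (leqnSn n) ac)); last by move=> x y e; rewrite (hs_ad X e).
have E x : E1 n.+1 (fun y => `|hs n X y|) x <=
    2 * Num.sqrt C * (mI n x * `|del n X x|) * (wn n.+1 x)^-1.
  rewrite (E1_ext _ _ (Y := fun y => `|hq n X y| * `|hr n.+1 y|)); last first.
    by move=> y; rewrite normrM.
  rewrite E1_pull; last by move=> y z e; rewrite (hq_ad X e).
  rewrite E1_hr_abs hq_abs mulrA ler_wpM2r ?invr_ge0 ?(ltW (wn_gt0 _ _))//.
  have : Num.sqrt (mI n.+1 x) <= Num.sqrt C * Num.sqrt (mI n x).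
    by rewrite -sqrtrM ?(ltW C0)// ler_wsqrtr.
  have := sqr_sqrtr (ltW (mI_gt0 n x)); have := normr_ge0 (del n X x).
  have := sqrtr_ge0 (mI n x).
  set s := Num.sqrt (mI n x); set t := Num.sqrt (mI n.+1 x); set d := `|_|.
  move=> s0 d0 <- le; have := ler_wpM2l (mulr_ge0 s0 d0) le; lra.
apply: le_trans (_ : _ <= Ex N (fun x => (c x * (2 * Num.sqrt C * (mI n x * `|del n X x|))) * (wn n.+1 x)^-1)) _.
  apply: le_Ex => x; have := ler_wpM2l (c0 x) (E x); lra.
rewrite (Ex_cond nN'); last 2 first.
- by move=> x y e; rewrite (ac _ _ e) (mI_ad e) (del_ad X e).
- by move=> x y e; rewrite (wn_ad e).
rewrite (Ex_cond nN' ac); last by move=> x y e; rewrite (aX _ _ e).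
rewrite -ExZ; apply: le_Ex => x; rewrite E1_inv_wn.
have := ler_wpM2l (mulr_ge0 (sqrtr_ge0 C) (c0 x)) (del_abs n X x); lra.
Qed.

End Maximal.

(** * Maximal inequalities for differences delayed by one level *)

Section Shift.
Context {R : rcfType} {D : tree R}.
Implicit Types (X Y : D -> R) (n N : nat) (x : D) (a b f g h y : nat -> D -> R).

(* The transform [hs] of a martingale difference is measurable one level later. *)
Definition mdiff2 y :=
  (forall n, ad n.+2 (y n)) /\ (forall n x, E1 n.+1 (y n) x = 0).

(** The shift by one index turns an [mdiff2] into an [mdiff] with zero initial term, to which the
    maximal inequalities apply. *)
Let delay y n x : R := if n is k.+1 then y k x else 0.

Let delay_mdiff y : mdiff2 y -> mdiff (delay y).
Proof.
move=> [ay y0]; split=> [[|n] x z e|[|n] x] //=; first exact: ay.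
exact: E1_cst.
Qed.

Let psum_delay y n x : psum (delay y) n.+1 x = psum y n x.
Proof. by rewrite /psum big_ord_recl add0r. Qed.

Let mx_delay y n x : mx (psum y) n x <= mx (psum (delay y)) n.+1 x.
Proof.
apply: mx_le => k kn; rewrite -psum_delay.
exact: (mx_ge (psum (delay y))).
Qed.

(** The weight of [y k] is [a k.+1] because [y k] is a difference from level [k.+1] to [k.+2]. *)
Lemma mdiff2_max y a N : mdiff2 y -> weight a ->
  Ex N.+1 (mx (psum y) N) <= Ex N.+1 (a N.+1) +
    4 * Ex N.+1 (fun x => \sum_(k < N) y k x ^+ 2 / a k.+1 x).
Proof.
move=> my wa; apply: le_trans (le_Ex N.+1 (mx_delay y N)) _.
apply: le_trans (weighted_max N.+1 (delay_mdiff my) wa) _.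
rewrite lerD2l ler_wpM2l// le_Ex// => x.
by rewrite big_ord_recl expr0n mul0r add0r.
Qed.

Lemma mdiff2_doob y N : mdiff2 y ->
  Ex N.+1 (fun x => mx (psum y) N x ^+ 2) <=
    4 * Ex N.+1 (fun x => \sum_(k < N) y k x ^+ 2).
Proof.
move=> my.
apply: (@le_trans _ _ (Ex N.+1 (fun x => mx (psum (delay y)) N.+1 x ^+ 2))).
  by apply: le_Ex => x; rewrite ler_sqr ?nnegrE ?mx_ge0.
apply: le_trans (doob N.+1 (mdiff_mart (delay_mdiff my))) _.
rewrite orthogonality//; last exact: delay_mdiff.
by rewrite ler_wpM2l// le_Ex// => x; rewrite big_ord_recl expr0n add0r.
Qed.

Lemma le_mx_psum y n x : mx (psum y) n x <= \sum_(k < n) `|y k x|.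
Proof.
apply: mx_le => k kn; apply: le_trans (ler_norm_sum _ _ _) _.
rewrite -(big_mkord xpredT (fun k => `|y k x|)).
rewrite -(big_mkord xpredT (fun k => `|y k x|)) [leRHS](big_cat_nat (n := k))//=.
by rewrite lerDl sumr_ge0.
Qed.

Lemma mxD f g n x : mx (fun k x => f k x + g k x) n x <= mx f n x + mx g n x.
Proof.
apply: mx_le => k kn; apply: le_trans (ler_normD _ _) _.
by rewrite lerD// mx_ge.
Qed.

Lemma mx_ext f g n x : (forall k x, f k x = g k x) -> mx f n x = mx g n x.
Proof. by move=> e; elim: n => [|n ih] /=; rewrite ?ih e. Qed.

Lemma psumD f g n x : psum (fun k x => f k x + g k x) n x = psum f n x + psum g n x.
Proof. exact: big_split. Qed.

Lemma psum_ext f g n x : (forall k x, f k x = g k x) -> psum f n x = psum g n x.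
Proof. by move=> e; apply: eq_bigr => k _. Qed.

End Shift.

(** * Davis inequality, duality and paraproducts *)

Section Davis.
Context {R : rcfType} {D : tree R}.
Implicit Types (X Y : D -> R) (n N : nat) (x : D) (a b f g h y : nat -> D -> R).
Variables (C : R).
Hypotheses (C0 : 0 < C) (mC : forall n (x : D), mI n.+1 x <= C * mI n x).
Let K := 4 * Num.sqrt C.

Let K0 : 0 <= K. Proof. by rewrite mulr_ge0 ?sqrtr_ge0. Qed.

(** The Haar functions involved are those of the children, so [Hs f n], built from [f] up to level
    [n], is measurable at level [n.+1] only. This shift explains the indices [N.+1] below. *)
Definition Hs f := psum (fun k x => hs k (f k.+1) x).

Lemma Hs_ad f n : ad n.+1 (Hs f n).
Proof.
elim: n => [|n ih] x z e; first by rewrite /Hs !psum0.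
rewrite /Hs !psumS (hs_ad _ e); congr (_ + _).
by apply: ih; exact: idxW e.
Qed.

(** The 6 is 1 + 4 from [weighted_max] for g, plus 1 from the variation of h. Combined with
    [davis_Sq] this is Davis's inequality. *)
Lemma davis_max N f A : davis N f A -> Ex N (mx f N) <= 6 * A.
Proof.
move=> [g [h [a [[mg mh wa fE] g0 aA gA hA]]]].
apply: (@le_trans _ _ (Ex N (fun x => mx (psum (incr g)) N x +
    (`|h 0%N x| + \sum_(k < N) `|incr h k x|)))).
  apply: le_Ex => x; apply: mx_le => k kN.
  have -> : f k x = psum (incr g) k x + (h 0%N x + psum (incr h) k x).
    by rewrite !psum_incr g0 fE; ring.
  apply: le_trans (ler_normD _ _) _; rewrite lerD ?mx_ge//.
  apply: le_trans (ler_normD _ _) _; rewrite lerD2l.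
  by apply: le_trans (le_mx_psum _ N x); exact: mx_ge.
rewrite ExD; have := weighted_max N (mart_mdiff mg) wa; lra.
Qed.

(** Duality of H_1 and BMO with absolute values inside. For g, |d b d g| <= d g^2 / a + a d b^2 and
    [bmo2_weight] bounds the second sum; for h, the jumps of b are at most B. *)
Lemma davis_dual N b B f A : bmo2 b B -> davis N f A ->
  Ex N (fun x => \sum_(k < N) `|incr b k x| * `|incr f k x|) <= (1 + 2 * B) * A.
Proof.
move=> bB [g [h [a [[mg mh wa fE] g0 aA gA hA]]]]; have [aa a0 aS] := wa.
have [_ bb _] := bB; have B0 := bmo2_ge0 (rep D 0 0) bB.
have bw := bmo2_weight N bB wa.
apply: (@le_trans _ _ (Ex N (fun x => (\sum_(k < N) incr g k x ^+ 2 / a k x +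
  \sum_(k < N) a k x * incr b k x ^+ 2) +
  B * (`|h 0%N x| + \sum_(k < N) `|incr h k x|)))).
  apply: le_Ex => x; rewrite -big_split/= mulrDr addrA mulr_sumr.
  apply: (@le_trans _ _ (\sum_(k < N) (incr g k x ^+ 2 / a k x + a k x * incr b k x ^+ 2) +
     \sum_(i < N) B * `|incr h i x|)); last first.
    by rewrite lerD2r lerDl mulr_ge0.
  rewrite -big_split; apply: ler_sum => k _ /=.
  have -> : incr f k x = incr g k x + incr h k x by rewrite /incr !fE; ring.
  have ak := a0 k x; have ak0 := lt0r_neq0 ak.
  have := sqr_ge0 (`|incr g k x| - a k x * `|incr b k x|).
  have := bb k x; have := ler_normD (incr g k x) (incr h k x).
  rewrite -[incr g k x ^+ 2]real_normK ?num_real// -[incr b k x ^+ 2]real_normK ?num_real//.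
  have := normr_ge0 (incr b k x); have := normr_ge0 (incr g k x); have := normr_ge0 (incr h k x).
  set s := `|_ + _|; set p := `|incr g k x|; set q := `|incr h k x|; set r := `|incr b k x|.
  move=> q0 p0 r0 le rB sq.
  have h1 : r * p <= p ^+ 2 / a k x + a k x * r ^+ 2.
    rewrite -(ler_pM2l ak) mulrDr [a k x * (_ / _)]mulrC divfK//.
    have := mulr_ge0 (ltW ak) (mulr_ge0 r0 p0); nra.
  have := ler_wpM2l r0 le; have := ler_wpM2r q0 rB; lra.
rewrite 2!ExD ExZ; have := ler_wpM2l B0 aA; have := ler_wpM2l B0 hA; lra.
Qed.

Let hs_mdiff2 f : mdiff2 (fun k x => hs k (f k) x).
Proof. by split=> [n|n x]; [exact: hs_ad|exact: E1_hs]. Qed.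

Let sum_hs_sqr N g a : mart g -> weight a ->
  Ex N.+1 (fun x => \sum_(k < N) hs k (incr g k) x ^+ 2 / a k x) <=
  2 * Ex N.+1 (fun x => \sum_(k < N.+1) incr g k x ^+ 2 / a k x).
Proof.
move=> mg [aa a0 aS]; have [ag _] := mart_mdiff mg.
rewrite (Ex_sum N.+1 N (fun k x => hs k (incr g k) x ^+ 2 / a k x)).
rewrite (Ex_sum N.+1 N.+1 (fun k x => incr g k x ^+ 2 / a k x)) big_ord_recr/=.
rewrite mulrDr -[leLHS]addr0 lerD//; last first.
  rewrite mulr_ge0// Ex_ge0// => x; rewrite mulr_ge0 ?sqr_ge0 ?invr_ge0//; exact/ltW.
rewrite mulr_sumr; apply: ler_sum => k _.
rewrite (Ex_ext N.+1 (Y := fun x => (a k x)^-1 * hs k (incr g k) x ^+ 2)); last first.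
  by move=> x; rewrite mulrC.
rewrite [in leRHS](Ex_ext N.+1 (Y := fun x => (a k x)^-1 * incr g k x ^+ 2)); last first.
  by move=> x; rewrite mulrC.
apply: Ex_hs_sqr => //; first by rewrite ltnS.
  by move=> x z e; rewrite (aa _ _ _ e).
by move=> x; rewrite invr_ge0 ltW.
Qed.

Let sum_hs_abs N h : mart h ->
  Ex N.+1 (fun x => \sum_(k < N) `|hs k (incr h k) x|) <=
  K * Ex N.+1 (fun x => `|h 0%N x| + \sum_(k < N.+1) `|incr h k x|).
Proof.
move=> mh; have [ah _] := mart_mdiff mh.
apply: (@le_trans _ _ (K * Ex N.+1 (fun x => \sum_(k < N) `|incr h k x|))); last first.
  rewrite ler_wpM2l// le_Ex// => x; rewrite big_ord_recr addrCA lerDl/=.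
  by rewrite addr_ge0.
rewrite (Ex_sum N.+1 N (fun k x => `|hs k (incr h k) x|)).
rewrite (Ex_sum N.+1 N (fun k x => `|incr h k x|)) mulr_sumr.
apply: ler_sum => k _.
rewrite -[leLHS]mul1r -ExZ -[X in K * X]mul1r -ExZ.
by apply: (Ex_hs_abs (c := fun=> 1) mC C0) => //; rewrite ltnS.
Qed.

(** The transform of g keeps the weight and doubles the square sum, so 9 = 1 + 4 * 2; that of h has
    its variation multiplied by K, by [Ex_hs_abs]. *)
Lemma davis_Hs N f A : davis N.+1 f A -> mart f ->
  Ex N.+1 (mx (Hs f) N) <= (9 + K) * A.
Proof.
move=> [g [h [a [[mg mh wa fE] g0 aA gA hA]]]] [af _].
have [aa a0 aS] := wa.
have ifE k x : hs k (f k.+1) x = hs k (incr g k) x + hs k (incr h k) x.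
  rewrite -hs_incr// -hsD; apply: hs_ext => y; rewrite /incr !fE; ring.
apply: (@le_trans _ _ (Ex N.+1 (fun x =>
    mx (psum (fun k x => hs k (incr g k) x)) N x + \sum_(k < N) `|hs k (incr h k) x|))).
  apply: le_Ex => x; rewrite (mx_ext (g := fun n x =>
    psum (fun k x => hs k (incr g k) x) n x + psum (fun k x => hs k (incr h k) x) n x)).
    by apply: le_trans (mxD _ _ _ _) _; rewrite lerD2l le_mx_psum.
  by move=> k z; rewrite -psumD; exact: psum_ext.
rewrite ExD; have h1 := mdiff2_max N (hs_mdiff2 (incr g)) wa.
have h2 := sum_hs_abs N mh; have h3 := sum_hs_sqr N mg wa.
have h4 : Ex N.+1 (fun x => \sum_(k < N) hs k (incr g k) x ^+ 2 / a k.+1 x) <=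
  Ex N.+1 (fun x => \sum_(k < N) hs k (incr g k) x ^+ 2 / a k x).
  apply: le_Ex => x; apply: ler_sum => k _.
  by rewrite ler_wpM2l ?sqr_ge0// lef_pV2 ?posrE.
have := ler_wpM2l K0 hA; lra.
Qed.

(** The argument of [davis_dual] with the transforms of g and h. Two increments of b occur because
    the transform reaches level [k.+2] from data at level [k]. *)
Lemma davis_dual_Hs N b B f A : bmo2 b B -> davis N.+1 f A -> mart f ->
  Ex N.+1 (fun x => \sum_(k < N) (`|incr b k x| + `|incr b k.+1 x|) * `|hs k (f k.+1) x|)
  <= (4 + 2 * B + 2 * B * K) * A.
Proof.
move=> bB [g [h [a [[mg mh wa fE] g0 aA gA hA]]]] [af _]; have [aa a0 aS] := wa.
have [_ bb _] := bB; have B0 := bmo2_ge0 (rep D 0 0) bB.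
have bw := bmo2_weight N.+1 bB wa.
have ifE k x : hs k (f k.+1) x = hs k (incr g k) x + hs k (incr h k) x.
  rewrite -hs_incr// -hsD; apply: hs_ext => y; rewrite /incr !fE; ring.
apply: (@le_trans _ _ (Ex N.+1 (fun x => (2 * \sum_(k < N) hs k (incr g k) x ^+ 2 / a k x +
  2 * \sum_(k < N.+1) a k x * incr b k x ^+ 2) +
  2 * B * \sum_(k < N) `|hs k (incr h k) x|))); last first.
  rewrite 2!ExD 3!ExZ; have := sum_hs_abs N mh; have := sum_hs_sqr N mg wa.
  move=> h1 h2; have := ler_wpM2l B0 h2; have := ler_wpM2l (mulr_ge0 B0 K0) hA.
  by have := ler_wpM2l B0 aA; lra.
apply: le_Ex => x.
have S1 : \sum_(k < N) a k x * incr b k x ^+ 2 <= \sum_(k < N.+1) a k x * incr b k x ^+ 2.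
  by rewrite big_ord_recr/= lerDl mulr_ge0 ?sqr_ge0// ltW.
have S2 : \sum_(k < N) a k x * incr b k.+1 x ^+ 2 <= \sum_(k < N.+1) a k x * incr b k x ^+ 2.
  rewrite [leRHS]big_ord_recl -[leLHS]add0r lerD//.
    by rewrite mulr_ge0 ?sqr_ge0// ltW.
  by apply: ler_sum => k _; rewrite ler_wpM2r ?sqr_ge0.
apply: (@le_trans _ _ (\sum_(k < N) ((2 * (hs k (incr g k) x ^+ 2 / a k x) +
   (a k x * incr b k x ^+ 2 + a k x * incr b k.+1 x ^+ 2)) + 2 * B * `|hs k (incr h k) x|))).
  apply: ler_sum => k _; rewrite ifE.
  have ak := a0 k x; have ak0 := lt0r_neq0 ak.
  have := ler_normD (hs k (incr g k) x) (hs k (incr h k) x).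
  have := bb k x; have := bb k.+1 x.
  rewrite -[hs k (incr g k) x ^+ 2]real_normK ?num_real// -[incr b k x ^+ 2]real_normK ?num_real//.
  rewrite -[incr b k.+1 x ^+ 2]real_normK ?num_real//.
  have := normr_ge0 (incr b k x); have := normr_ge0 (incr b k.+1 x).
  have := normr_ge0 (hs k (incr g k) x); have := normr_ge0 (hs k (incr h k) x).
  set s := `|_ + _|; set p := `|hs k (incr g k) x|; set q := `|hs k (incr h k) x|.
  set r := `|incr b k x|; set t := `|incr b k.+1 x|.
  move=> q0 p0 t0 r0 tB rB le.
  have h1 u : 0 <= u -> u * p <= p ^+ 2 / a k x + a k x * u ^+ 2.
    move=> u0; rewrite -(ler_pM2l ak) mulrDr [a k x * (_ / _)]mulrC divfK//.
    have := sqr_ge0 (p - a k x * u).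
    have := mulr_ge0 (ltW ak) (mulr_ge0 u0 p0); nra.
  have := h1 r r0; have := h1 t t0.
  have := ler_wpM2l (addr_ge0 r0 t0) le; have := ler_wpM2r q0 rB; have := ler_wpM2r q0 tB; lra.
by rewrite 3!big_split/= -!mulr_sumr; lra.
Qed.

Lemma Ex_weight_hs b B N a : bmo2 b B -> weight a ->
  Ex N.+1 (fun x => \sum_(k < N) a k x * hs k (b k.+1) x ^+ 2) <= 2 * B * Ex N.+1 (a N.+1).
Proof.
move=> bB wa; have [mb _ _] := bB; have [ib _] := mart_mdiff mb; have [ab _] := mb.
have [aa a0 aS] := wa.
have := bmo2_weight N.+1 bB wa.
rewrite (Ex_sum N.+1 N (fun k x => a k x * hs k (b k.+1) x ^+ 2)).
rewrite (Ex_sum N.+1 N.+1 (fun k x => a k x * incr b k x ^+ 2)) big_ord_recr/=.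
have : 0 <= Ex N.+1 (fun x => a N x * incr b N x ^+ 2).
  by apply: Ex_ge0 => x; rewrite mulr_ge0 ?sqr_ge0// ltW.
suff : \sum_(k < N) Ex N.+1 (fun x => a k x * hs k (b k.+1) x ^+ 2) <=
    2 * \sum_(k < N) Ex N.+1 (fun x => a k x * incr b k x ^+ 2) by lra.
rewrite mulr_sumr; apply: ler_sum => k _.
rewrite (Ex_ext N.+1 (Y := fun x => a k x * hs k (incr b k) x ^+ 2)); last first.
  by move=> x; rewrite hs_incr.
apply: Ex_hs_sqr => //; first by rewrite ltnS.
by move=> x; rewrite ltW.
Qed.

(** By the Leibniz rule these are the increments of Hs(b f)_n - b_{n+1} (Hs f)_n, without the
    transform of the diagonal part. The first two terms are delayed martingale differences; the
    third, with b_{k+2} - b_k, is absolutely summable by duality. *)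
Definition Pc b f := psum (fun k x => f k x * hs k (b k.+1) x -
  incr b k.+1 x * Hs f k x - (incr b k x + incr b k.+1 x) * hs k (f k.+1) x).

Definition KP B := (4 + 2 * B + 2 * B * K) + (1 + 8 * B) * 7 + (1 + 4 * B) * (10 + K).

Lemma Pc_max b B f N A : bmo2 b B -> mart f -> 0 < A -> davis N.+1 f A ->
  Ex N.+1 (mx (Pc b f) N) <= KP B * A.
Proof.
move=> bB mf A0 dA; have [mb _ _] := bB; have [af _] := mf.
have [ib0 ib] := mart_mdiff mb.
have B0 := bmo2_ge0 (rep D 0 0) bB.
pose y k (x : D) := f k x * hs k (b k.+1) x.
pose z k (x : D) := incr b k.+1 x * Hs f k x.
have my : mdiff2 y.
  split=> [n x t e|n x]; first by rewrite /y (af n x t (idxW _ e)) ?(hs_ad _ e)// ltnW.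
  by rewrite E1_pull ?E1_hs ?mulr0//; apply: adW (af n).
have mz : mdiff2 z.
  split=> [n x t e|n x]; first by rewrite /z (ib0 _ _ _ e) (@Hs_ad _ n x t) // (idxW _ e).
  rewrite (E1_ext _ _ (Y := fun x => Hs f n x * incr b n.+1 x)).
    by rewrite E1_pull ?ib ?mulr0//; exact: Hs_ad.
  by move=> t; rewrite /z mulrC.
pose a1 k x := mx f k x + A.
have w1 : weight a1.
  split=> [n|n x|n x]; first by move=> x t e; rewrite /a1 (mx_ad af e).
    by rewrite ltr_wpDl ?mx_ge0.
  by rewrite lerD2r mx_mono.
have [aa1 a10 aS1] := w1.
(* [Hs f k] is known only at level [k.+1], so this weight lags by one index. Adding [A] makes both
   weights positive. *)
pose a2 k x : R := if k is k'.+1 then mx (Hs f) k' x + A else A.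
have w2 : weight a2.
  split=> [[//|n]|[|n] x|[|n] x] //=.
  - move=> x t e; rewrite /a2; congr (_ + _).
    elim: n e => [|n ih] e /=; first by rewrite (Hs_ad _ e).
    by rewrite (Hs_ad _ e) ih// (idxW _ e).
  - by rewrite ltr_wpDl ?mx_ge0.
  - by rewrite lerDr normr_ge0.
  - by rewrite lerD2r (mx_mono (Hs f)).
have [aa2 a20 aS2] := w2.
apply: (@le_trans _ _ (Ex N.+1 (fun x => (mx (psum y) N x + mx (psum z) N x) +
   \sum_(k < N) (`|incr b k x| + `|incr b k.+1 x|) * `|hs k (f k.+1) x|))).
  apply: le_Ex => x; apply: mx_le => n nN.
  have -> : Pc b f n x = psum y n x - psum z n x -
      psum (fun k x => (incr b k x + incr b k.+1 x) * hs k (f k.+1) x) n x.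
    by rewrite /psum -!sumrB.
  apply: le_trans (ler_normB _ _) _; apply: lerD.
    by apply: le_trans (ler_normB _ _) _; rewrite lerD// mx_ge.
  set w := fun k x => _; apply: le_trans (mx_ge (psum w) x nN) _.
  apply: le_trans (le_mx_psum _ _ _) _; apply: ler_sum => k _.
  by rewrite normrM ler_wpM2r// ler_normD.
rewrite 2!ExD; have h3 := davis_dual_Hs bB dA mf.
have fA := davis_max dA; have HA := davis_Hs dA mf.
have h1 : Ex N.+1 (mx (psum y) N) <= (1 + 8 * B) * Ex N.+1 (a1 N.+1).
  have := mdiff2_max N my w1; have := Ex_weight_hs N bB w1.
  suff : Ex N.+1 (fun x => \sum_(k < N) y k x ^+ 2 / a1 k.+1 x) <=
    Ex N.+1 (fun x => \sum_(k < N) a1 k x * hs k (b k.+1) x ^+ 2) by lra.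
  apply: le_Ex => x; apply: ler_sum => k _.
  rewrite ler_pdivrMr// /y exprMn [leRHS]mulrAC ler_wpM2r ?sqr_ge0//.
  rewrite -real_normK ?num_real// expr2.
  have fa : `|f k x| <= a1 k x.
    by have := mx_ge f x (leqnn k); rewrite /a1; lra.
  by rewrite ler_pM//; exact: le_trans fa (aS1 _ _).
have h2 : Ex N.+1 (mx (psum z) N) <= (1 + 4 * B) * Ex N.+1 (a2 N.+1).
  have := mdiff2_max N mz w2; have := bmo2_weight N.+1 bB w2.
  suff : Ex N.+1 (fun x => \sum_(k < N) z k x ^+ 2 / a2 k.+1 x) <=
    Ex N.+1 (fun x => \sum_(k < N.+1) a2 k x * incr b k x ^+ 2) by lra.
  apply: le_Ex => x; rewrite [leRHS]big_ord_recl -[leLHS]add0r lerD//.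
    by rewrite mulr_ge0 ?sqr_ge0// ltW.
  apply: ler_sum => k _; rewrite lift0.
  rewrite ler_pdivrMr// /z exprMn [leLHS]mulrC [leRHS]mulrAC ler_wpM2r ?sqr_ge0//.
  rewrite -real_normK ?num_real// expr2.
  have fa : `|Hs f k x| <= a2 k.+1 x.
    by have := mx_ge (Hs f) x (leqnn k); rewrite /a2; lra.
  by rewrite ler_pM.
have e1 : Ex N.+1 (a1 N.+1) = Ex N.+1 (mx f N.+1) + A by rewrite /a1 ExD Ex_cst.
have e2 : Ex N.+1 (a2 N.+1) = Ex N.+1 (mx (Hs f) N) + A by rewrite /a2 ExD Ex_cst.
(* The weights have mean at most 6 A + A and (9 + K) A + A, from [davis_max] and [davis_Hs]. *)
have i1 : (1 + 8 * B) * Ex N.+1 (a1 N.+1) <= (1 + 8 * B) * (7 * A).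
  by rewrite ler_wpM2l ?e1; lra.
have i2 : (1 + 4 * B) * Ex N.+1 (a2 N.+1) <= (1 + 4 * B) * ((10 + K) * A).
  by rewrite ler_wpM2l ?e2; lra.
rewrite /KP; lra.
Qed.

End Davis.

(** * Weak type and John-Nirenberg inequalities *)

Section CExp.
Context {R : rcfType} {D : tree R}.
Implicit Types (X Y : D -> R) (n N d : nat) (x : D) (a b f g h : nat -> D -> R).

Fixpoint down d n X : D -> R := if d is d'.+1 then E1 n (down d' n.+1 X) else X.

(** For n >= N the result is [X] itself, which is E_n X when [X] is measurable at level [N]; so
    [cexp_mart] is a martingale indexed by all n. *)
Definition cexp N n X := down (N - n) n X.

Lemma cexpS N n X x : (n < N)%N -> cexp N n X x = E1 n (cexp N n.+1 X) x.
Proof. by move=> nN; rewrite /cexp -[(N - n)%N]subnSK. Qed.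

Lemma cexp_id N n X : (N <= n)%N -> cexp N n X = X.
Proof. by rewrite /cexp -subn_eq0 => /eqP ->. Qed.

Lemma cexp_ind N (P : nat -> Prop) : (forall n, (N <= n)%N -> P n) ->
  (forall n, (n < N)%N -> P n.+1 -> P n) -> forall n, P n.
Proof.
move=> P0 PS n; have [/P0//|nN] := leqP N n.
rewrite -(subKn (ltnW nN)); elim: (N - n)%N (leq_subr n N) => [_|d ih dN].
  by rewrite subn0; exact: P0.
apply: PS; first by rewrite ltn_subrL (leq_trans _ dN).
by rewrite subnSK//; exact/ih/ltnW.
Qed.

Lemma cexp_mart N X : ad N X -> mart (fun n => cexp N n X).
Proof.
move=> aX.
have ac n : ad n (cexp N n X).
  elim/(@cexp_ind N): n => [n Nn|n nN _]; first by rewrite cexp_id//; exact: adW aX.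
  by move=> x y e; rewrite !cexpS//; exact: E1_ad.
split=> // n x; have [Nn|nN] := leqP N n; last by rewrite cexpS.
by rewrite !cexp_id//; last (exact: leqW); rewrite E1_id//; exact: adW aX.
Qed.

Lemma cexp_ext N n X Y x : (forall y, X y = Y y) -> cexp N n X x = cexp N n Y x.
Proof.
move=> e; elim/(@cexp_ind N): n x => [n Nn x|n nN ih x]; first by rewrite !cexp_id.
by rewrite !cexpS//; exact: E1_ext.
Qed.

Lemma cexpD N n X Y x :
  cexp N n (fun y => X y + Y y) x = cexp N n X x + cexp N n Y x.
Proof.
elim/(@cexp_ind N): n x => [n Nn x|n nN ih x]; first by rewrite !cexp_id.
by rewrite !cexpS// -E1D; exact: E1_ext.
Qed.

Lemma cexpB N n X Y x :
  cexp N n (fun y => X y - Y y) x = cexp N n X x - cexp N n Y x.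
Proof.
elim/(@cexp_ind N): n x => [n Nn x|n nN ih x]; first by rewrite !cexp_id.
by rewrite !cexpS// -E1B; exact: E1_ext.
Qed.

Lemma le_cexp N n X Y x : (forall y, X y <= Y y) -> cexp N n X x <= cexp N n Y x.
Proof.
move=> e; elim/(@cexp_ind N): n x => [n Nn x|n nN ih x]; first by rewrite !cexp_id.
by rewrite !cexpS//; exact: le_E1.
Qed.

Lemma cexp_ad N n X x : ad n X -> cexp N n X x = X x.
Proof.
elim/(@cexp_ind N): n x => [n Nn x aX|n nN ih x aX]; first by rewrite !cexp_id.
rewrite cexpS// (E1_ext _ _ (Y := X)) ?E1_id// => y.
by apply: ih; exact: adW aX.
Qed.

Lemma cexp0 N n x : cexp N n (fun=> 0) x = 0.
Proof. by rewrite cexp_ad. Qed.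

Lemma abs_cexp N n X x : `|cexp N n X x| <= cexp N n (fun y => `|X y|) x.
Proof.
elim/(@cexp_ind N): n x => [n Nn x|n nN ih x]; first by rewrite !cexp_id.
by rewrite !cexpS//; apply: le_trans (abs_E1 _ _ _) _; exact: le_E1.
Qed.

Lemma cexp_closed f N n x : mart f -> (n <= N)%N -> cexp N n (f N) x = f n x.
Proof.
move=> [af fE]; elim/(@cexp_ind N): n x => [n Nn x|n nN ih x] nN'.
  by rewrite cexp_id//; have -> : n = N by apply/eqP; rewrite eqn_leq nN'.
rewrite cexpS// (E1_ext _ _ (Y := f n.+1)) ?fE// => y.
exact: ih.
Qed.

Lemma cexpW N n X x : (n <= N)%N -> ad N X -> cexp N.+1 n X x = cexp N n X x.
Proof.
move=> nN aX; have h k y : (k <= N)%N -> cexp N.+1 k X y = cexp N k X y.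
  elim/(@cexp_ind N): k y => [k Nk y kN|k kN ih y _].
    have -> : k = N by apply/eqP; rewrite eqn_leq kN.
    by rewrite cexpS// !cexp_id// E1_id.
  by rewrite !cexpS//; [apply: E1_ext => z; exact: ih|exact: ltnW].
exact: h.
Qed.

Lemma Ex_cexp N n X : (n <= N)%N -> ad N X -> Ex N (cexp N n X) = Ex N X.
Proof.
move=> nN aX; have [ac _] := cexp_mart aX.
have h k : (k <= N)%N -> Ex N (cexp N k X) = Ex N X.
  elim/(@cexp_ind N): k => [k Nk _|k kN ih _]; first by rewrite cexp_id.
  by rewrite -[RHS]ih// (Ex_tower kN (ac _)); apply: Ex_ext => x; rewrite cexpS.
exact: h.
Qed.

End CExp.

Section WeakType.
Context {R : rcfType} {D : tree R}.
Implicit Types (n N : nat) (x : D) (G : nat -> D -> R).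
Variables (C : R).
Hypotheses (C0 : 0 < C) (mC : forall n (x : D), mI n.+1 x <= C * mI n x).
Let K := 4 * Num.sqrt C.

Let K0 : 0 <= K. Proof. by rewrite mulr_ge0 ?sqrtr_ge0. Qed.

Section Nonneg.
Variables (G : nat -> D -> R) (lam : R).
Hypotheses (mG : mart G) (G0 : forall n x, 0 <= G n x) (lam0 : 0 < lam).

(** The indicator of n < tau, where tau is the first time at which G exceeds [lam]. *)
Let al n x : R := (mx G n x <= lam)%R%:R.

Let al01 n x : al n x = 0 \/ al n x = 1.
Proof. by rewrite /al; case: (_ <= _); [right|left]. Qed.

Let al_ge0 n x : 0 <= al n x. Proof. exact: ler0n. Qed.

Let al_ad n : ad n (al n).
Proof. by have [aG _] := mG; move=> x y e; rewrite /al (mx_ad aG e). Qed.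

Let alS n x : al n.+1 x = al n x * (G n.+1 x <= lam)%R%:R.
Proof. by rewrite /al /= ge_max ger0_norm// -natrM mulnb. Qed.

Let al_le n x : al n x = 1 -> G n x <= lam.
Proof.
rewrite /al; case: (leP _ lam) => [h _|_ /eqP]; last by rewrite eq_sym oner_eq0.
apply: le_trans h; apply: le_trans (mx_ge G x (leqnn n)); exact: ler_norm.
Qed.

Let aG n : ad n (G n). Proof. by case: mG. Qed.

Let aIG n : ad n.+1 (incr G n). Proof. by case: (mart_mdiff mG). Qed.

(** Optional stopping as a conservation law: what has left plus what is still inside is constant. *)
Let exit_sum m N : (m <= N)%N ->
  \sum_(k < m) Ex N (fun x => G k.+1 x * (al k x - al k.+1 x)) +
  Ex N (fun x => G m x * al m x) = Ex N (fun x => G 0 x * al 0 x).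
Proof.
elim: m => [|m ih] mN; first by rewrite big_ord0 add0r.
rewrite -(ih (ltnW mN)) big_ord_recr/= -addrA; congr (_ + _).
rewrite -ExD (Ex_ext N (Y := fun x => al m x * G m.+1 x)); last by move=> x; ring.
rewrite (Ex_cond mN)//; apply: Ex_ext => x.
by case: mG => _ ->; rewrite mulrC.
Qed.

Let al_mono n x : al n.+1 x <= al n x.
Proof. by rewrite alS; have [->|->] := al01 n x; case: (leP (G n.+1 x) lam) => _ /=; lra. Qed.

Let Gal n x : lam * (al n x - al n.+1 x) <= G n.+1 x * (al n x - al n.+1 x).
Proof. by rewrite alS; have [->|->] := al01 n x; case: (leP (G n.+1 x) lam) => /=; lra. Qed.

Let G0al x : lam * (1 - al 0 x) <= G 0 x * (1 - al 0 x).
Proof. by rewrite /al/= ger0_norm//; case: (leP (G 0 x) lam) => /=; lra. Qed.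

Let exit_pos m N : (m <= N)%N ->
  \sum_(k < m) Ex N (fun x => G k.+1 x * (al k x - al k.+1 x)) <= Ex N (G 0).
Proof.
move=> mN; have := exit_sum mN.
have : 0 <= Ex N (fun x => G m x * al m x) by apply: Ex_ge0 => x; apply: mulr_ge0 => //; exact: al_ge0.
have : Ex N (fun x => G 0 x * al 0 x) <= Ex N (G 0).
  by apply: le_Ex => x; rewrite ler_piMr//; have [->|->] := al01 0 x.
lra.
Qed.

Let exit_prob N : lam * Ex N (fun x => 1 - al N x) <= Ex N (G 0).
Proof.
have := exit_sum (leqnn N).
have : 0 <= Ex N (fun x => G N x * al N x) by apply: Ex_ge0 => x; apply: mulr_ge0 => //; exact: al_ge0.
have : lam * Ex N (fun x => 1 - al 0 x) <= Ex N (fun x => G 0 x - G 0 x * al 0 x).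
  by rewrite -ExZ; apply: le_Ex => x; have := G0al x; lra.
rewrite ExB.
have : lam * Ex N (fun x => al 0 x - al N x) <=
    \sum_(k < N) Ex N (fun x => G k.+1 x * (al k x - al k.+1 x)).
  rewrite -(Ex_sum N N (fun k x => G k.+1 x * (al k x - al k.+1 x))) -ExZ.
  apply: le_Ex => x.
  have -> : al 0 x - al N x = \sum_(k < N) (al k x - al k.+1 x).
    have := psum_incr al N x; rewrite /psum /incr !sumrB; lra.
  rewrite mulr_sumr; apply: ler_sum => k _; exact: Gal.
rewrite !ExB; lra.
Qed.

(** The concave potential psi(G) = (2 lam - G) G loses d G^2 in conditional mean at each step. On
    paths that exit, the linearisation of psi at G_m stays nonnegative because G_m <= lam <
    G_{m+1}. *)
Let good_sqr N : \sum_(k < N) Ex N (fun x => incr G k x ^+ 2 * al k.+1 x) <=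
  2 * lam * Ex N (G 0).
Proof.
pose psi n x := (2 * lam - G n x) * G n x.
have key m : (m <= N)%N -> \sum_(k < m) Ex N (fun x => incr G k x ^+ 2 * al k.+1 x) +
    Ex N (fun x => al m x * psi m x) <= 2 * lam * Ex N (G 0).
  elim: m => [_|m ih mN].
    rewrite big_ord0 add0r -ExZ; apply: le_Ex => x; rewrite /psi.
    have := mulr_ge0 (ltW lam0) (G0 0 x); have := sqr_ge0 (G 0 x).
    by have [->|->] := al01 0 x; lra.
  apply: le_trans (ih (ltnW mN)); rewrite big_ord_recr/= -addrA lerD2l -ExD.
  have -> : Ex N (fun x => al m x * psi m x) =
      Ex N (fun x => al m x * (psi m x + 2 * (lam - G m x) * incr G m x)).
    rewrite -[LHS]addr0.
    rewrite -[X in _ + X](@Ex_cond0 _ _ m N (fun x => al m x * (2 * (lam - G m x))) (incr G m))//.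
    + by rewrite -ExD; apply: Ex_ext => x; ring.
    + by move=> x y e; rewrite (al_ad e) (aG e).
    + by case: (mart_mdiff mG).
  apply: le_Ex => x; rewrite alS /psi /incr.
  have := G0 m x; have := G0 m.+1 x.
  have [->|/[dup] /al_le le ->] := al01 m x; first by rewrite !mul0r mulr0; lra.
  case: (leP (G m.+1 x) lam) => lt /= g1 g0; first by lra.
  have : 0 <= (2 * lam - G m x) * G m x by rewrite mulr_ge0//; lra.
  have : 0 <= (lam - G m x) * (G m.+1 x - G m x) by rewrite mulr_ge0//; lra.
  by lra.
have := key N (leqnn N).
have : 0 <= Ex N (fun x => al N x * psi N x).
  apply: Ex_ge0 => x; rewrite /psi.
  have [->|/[dup] /al_le le ->] := al01 N x; first by rewrite mul0r.
  by rewrite mul1r mulr_ge0 ?G0//; have := lam0; lra.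
lra.
Qed.

(** A Gundy splitting at the exit time: [y] keeps the increments that stay below [lam] and is
    treated in L^2, [e] is the jump across [lam] and is treated in L^1. Neither is centred, but [hs]
    makes martingale differences from any input, so no compensator appears. The constant is 1 for
    the exit, 64 for Chebyshev on [M1] and 4 K for Markov on [M2]. *)
Lemma weak_Hs_ge0 N : lam * Ex N.+1 (fun x => (lam < mx (Hs G) N x)%R%:R) <=
  (65 + 4 * K) * Ex N.+1 (G 0).
Proof.
pose y n x := incr G n x * al n.+1 x.
pose e n x := incr G n x * (al n x - al n.+1 x).
have ay n : ad n.+1 (y n) by move=> x z xz; rewrite /y (aIG xz) (al_ad xz).
have ae n : ad n.+1 (e n).
  by move=> x z xz; rewrite /e (aIG xz) (al_ad xz) (al_ad (idxW (leqnSn n) xz)).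
pose M1 := mx (psum (fun k x => hs k (y k) x)) N.
pose M2 (x : D) := \sum_(k < N) `|hs k (e k) x|.
have pw x : (lam < mx (Hs G) N x)%R%:R <=
   (1 - al N.+1 x) + (4 / lam ^+ 2 * M1 x ^+ 2 + 2 / lam * M2 x).
  have M20 : 0 <= M2 x by apply: sumr_ge0.
  have M10 : 0 <= M1 x by exact: mx_ge0.
  have p1 : 0 <= 4 / lam ^+ 2 * M1 x ^+ 2 by rewrite mulr_ge0 ?sqr_ge0// divr_ge0// sqr_ge0.
  have p2 : 0 <= 2 / lam * M2 x by rewrite mulr_ge0// divr_ge0// ltW.
  have [a0|a1] := al01 N.+1 x; first by rewrite a0; case: (_ < _) => /=; lra.
  rewrite a1; case: (ltP lam) => [lt|_] /=; last lra.
  have ak k : (k <= N)%N -> al k x = 1.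
    move=> kN; have [k0|//] := al01 k x; suff : al N.+1 x <= al k x by rewrite k0 a1; lra.
    have -> : N.+1 = (k + (N.+1 - k))%N by rewrite subnKC// ltnW.
    elim: (_ - k)%N => [|d ih]; first by rewrite addn0.
    by rewrite addnS; exact: le_trans (al_mono _ _) ih.
  have le : mx (Hs G) N x <= M1 x + M2 x.
    apply: mx_le => k kN.
    have -> : Hs G k x = psum (fun k x => hs k (y k) x) k x + psum (fun k x => hs k (e k) x) k x.
      rewrite -psumD; apply: eq_bigr => i _ /=; rewrite -hs_incr// -hsD.
      rewrite [RHS](hs_ext _ _ (Y := fun z => al i z * incr G i z)); last by move=> z; rewrite /y /e; ring.
      by rewrite hs_pull// ak ?mul1r// ltnW// (leq_trans (ltn_ord i)).
    apply: le_trans (ler_normD _ _) _; rewrite lerD ?mx_ge//.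
    by apply: le_trans (le_mx_psum (fun k x => hs k (e k) x) N x); exact: mx_ge.
  have [h|h] := leP (2 * M2 x) lam.
    have h1 : lam <= 2 * M1 x by lra.
    have : 1 <= 4 / lam ^+ 2 * M1 x ^+ 2; last lra.
    rewrite mulrAC ler_pdivlMr ?exprn_gt0// mul1r (_ : 4 * _ = (2 * M1 x) ^+ 2); last by ring.
    by rewrite ler_sqr ?nnegrE ?mulr_ge0// ltW.
  have : 1 <= 2 / lam * M2 x; last lra.
  by rewrite mulrAC ler_pdivlMr// mul1r ltW.
(* The 16 lam is 4 from Doob, 2 from [Ex_hs_sqr] and 2 lam from [good_sqr]. *)
have b1 : Ex N.+1 (fun x => M1 x ^+ 2) <= 16 * lam * Ex N.+1 (G 0).
  have my : mdiff2 (fun k x => hs k (y k) x).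
    by split=> [n|n x]; [exact: hs_ad|exact: E1_hs].
  apply: le_trans (mdiff2_doob N my) _.
  have := good_sqr N.+1; rewrite big_ord_recr/=.
  have : 0 <= Ex N.+1 (fun x => incr G N x ^+ 2 * al N.+1 x).
    by apply: Ex_ge0 => x; apply: mulr_ge0; [exact: sqr_ge0|exact: al_ge0].
  suff : Ex N.+1 (fun x => \sum_(k < N) hs k (y k) x ^+ 2) <=
      2 * \sum_(k < N) Ex N.+1 (fun x => incr G k x ^+ 2 * al k.+1 x) by lra.
  rewrite (Ex_sum N.+1 N (fun k x => hs k (y k) x ^+ 2)) mulr_sumr.
  apply: ler_sum => k _.
  have -> : Ex N.+1 (fun x => incr G k x ^+ 2 * al k.+1 x) =
      Ex N.+1 (fun x => 1 * y k x ^+ 2).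
    apply: Ex_ext => x; rewrite /y exprMn.
    by case: (al01 k.+1 x) => ->; rewrite ?expr1n ?expr0n /=; ring.
  rewrite -[leLHS]mul1r -ExZ.
  by apply: (Ex_hs_sqr (c := fun=> 1)) => //; rewrite ltnS.
have b2 : Ex N.+1 M2 <= 2 * K * Ex N.+1 (G 0).
  have := exit_pos (leqnSn N).
  suff : Ex N.+1 M2 <= 2 * K * \sum_(k < N) Ex N.+1 (fun x => G k.+1 x * (al k x - al k.+1 x)).
    by move=> h1 h2; have := ler_wpM2l K0 h2; lra.
  rewrite (Ex_sum N.+1 N (fun k x => `|hs k (e k) x|)) mulr_sumr.
  apply: ler_sum => k _; rewrite -[leLHS]mul1r -ExZ.
  apply: le_trans (Ex_hs_abs (c := fun=> 1) mC C0 _ _ _ _) _ => //; first by rewrite ltnS.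
  rewrite -/K -mulrA mulrCA ler_wpM2l// -ExZ; apply: le_Ex => x.
  (* At the exit step 0 <= G_k <= lam < G_{k+1}, so the jump is at most G_{k+1}. *)
  rewrite mul1r /e normrM [`|al k x - _|]ger0_norm ?subr_ge0//.
  have := G0 k x; have := G0 k.+1 x; rewrite alS /incr.
  have [->|/[dup] /al_le ? ->] := al01 k x; first by rewrite mul0r subrr !mulr0.
  case: (leP (G k.+1 x) lam) => ? ? ? /=; first by rewrite mulr1 subrr !mulr0.
  by rewrite mulr0 subr0 !mulr1 ger0_norm; lra.
apply: le_trans (ler_wpM2l (ltW lam0) (le_Ex N.+1 pw)) _.
rewrite (ExD N.+1 (fun x => 1 - al N.+1 x)).
rewrite (ExD N.+1 (fun x => 4 / lam ^+ 2 * M1 x ^+ 2)) !ExZ !mulrDr.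
have b3 := exit_prob N.+1.
have e1 : lam * (4 / lam ^+ 2 * Ex N.+1 (fun x => M1 x ^+ 2)) <= 64 * Ex N.+1 (G 0).
  have -> : lam * (4 / lam ^+ 2 * Ex N.+1 (fun x => M1 x ^+ 2)) =
      4 * Ex N.+1 (fun x => M1 x ^+ 2) / lam by field; rewrite gt_eqF.
  by rewrite ler_pdivrMr//; lra.
have e2 : lam * (2 / lam * Ex N.+1 M2) <= 4 * K * Ex N.+1 (G 0).
  by rewrite mulrA mulrCA divff ?gt_eqF// mulr1; lra.
lra.
Qed.

End Nonneg.

Lemma weak_Hs G lam N : mart G -> 0 < lam ->
  lam * Ex N.+1 (fun x => (lam < mx (Hs G) N x)%R%:R) <=
  2 * (65 + 4 * K) * Ex N.+1 (fun x => `|G N.+1 x|).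
Proof.
move=> mG lam0; have [aG _] := mG.
pose P (x : D) := (`|G N.+1 x| + G N.+1 x) / 2.
pose Q (x : D) := (`|G N.+1 x| - G N.+1 x) / 2.
have aP : ad N.+1 P by move=> x y e; rewrite /P (aG _ _ _ e).
have aQ : ad N.+1 Q by move=> x y e; rewrite /Q (aG _ _ _ e).
(* The positive part of a martingale is not a martingale, so the final value is split and then
   conditioned. Each half is tested at lam / 2, which doubles the constant. *)
pose GP n := cexp N.+1 n P; pose GQ n := cexp N.+1 n Q.
have cge0 X : (forall x : D, 0 <= X x) -> forall n x, 0 <= cexp N.+1 n X x.
  by move=> X0 n x; rewrite -(cexp0 N.+1 n x); exact: le_cexp.
have P0 n x : 0 <= GP n x.
  by apply: cge0 => z; rewrite /P; have := ler_norm (- G N.+1 z); rewrite normrN; lra.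
have Q0 n x : 0 <= GQ n x by apply: cge0 => z; rewrite /Q; have := ler_norm (G N.+1 z); lra.
have GE n x : (n <= N.+1)%N -> G n x = GP n x - GQ n x.
  move=> nN; rewrite -(cexp_closed x mG nN) -cexpB; apply: cexp_ext => y.
  by rewrite /P /Q; lra.
have l20 : 0 < lam / 2 by lra.
have hP := weak_Hs_ge0 (cexp_mart aP) P0 l20 N.
have hQ := weak_Hs_ge0 (cexp_mart aQ) Q0 l20 N.
rewrite (Ex_cexp (leq0n _) aP) in hP; rewrite (Ex_cexp (leq0n _) aQ) in hQ.
have -> : Ex N.+1 (fun x => `|G N.+1 x|) = Ex N.+1 P + Ex N.+1 Q.
  rewrite -ExD; apply: Ex_ext => x; rewrite /P /Q.
  by lra.
have : Ex N.+1 (fun x => (lam < mx (Hs G) N x)%R%:R) <=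
    Ex N.+1 (fun x => (lam / 2 < mx (Hs GP) N x)%R%:R + (lam / 2 < mx (Hs GQ) N x)%R%:R).
  apply: le_Ex => x.
  have le : mx (Hs G) N x <= mx (Hs GP) N x + mx (Hs GQ) N x.
    apply: mx_le => k kN.
    have -> : Hs G k x = Hs GP k x - Hs GQ k x.
      rewrite /Hs /psum -sumrB; apply: eq_bigr => i _.
      have iN : (i.+1 <= N.+1)%N by rewrite ltnS (leq_trans (ltnW (ltn_ord i))).
      by rewrite /hs /hq (GE _ _ iN) (GE _ _ iN); ring.
    by apply: le_trans (ler_normB _ _) _; rewrite lerD ?mx_ge.
  case: (ltP lam) => lt /=; last by rewrite addr_ge0 ?ler0n.
  by case: (ltP (lam / 2) (mx (Hs GP) N x)); case: (ltP (lam / 2) (mx (Hs GQ) N x)) => /=; lra.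
rewrite (ExD N.+1 (fun x => (lam / 2 < mx (Hs GP) N x)%R%:R)) => h.
by have := ler_wpM2l (ltW lam0) h; lra.
Qed.

End WeakType.

Section JohnNirenberg.
Context {R : rcfType} {D : tree R}.
Implicit Types (n N : nat) (x : D) (b : nat -> D -> R).

Section Level.
Variables (b : nat -> D -> R) (N : nat).
Hypothesis mb : mart b.

Let ab n : ad n (b n). Proof. by case: mb. Qed.

(** The conditional variance E_n (b_N - b_n)^2. *)
Definition cvar n x := cexp N n (fun y => b N y ^+ 2) x - b n x ^+ 2.

Let ab2 : ad N (fun y => b N y ^+ 2).
Proof. by move=> x y e; rewrite (ab e). Qed.

Lemma cvar_ad n : ad n (cvar n).
Proof.
have [ac _] := cexp_mart ab2.
by move=> x y e; rewrite /cvar (ac _ _ _ e) (ab e).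
Qed.

Lemma cvar_top x : cvar N x = 0.
Proof. by rewrite /cvar cexp_id// subrr. Qed.

Lemma cvarS n x : (n < N)%N ->
  E1 n (fun y => incr b n y ^+ 2) x + E1 n (cvar n.+1) x = cvar n x.
Proof.
move=> nN; have e1 : E1 n (cvar n.+1) x =
    E1 n (cexp N n.+1 (fun y => b N y ^+ 2)) x - E1 n (fun y => b n.+1 y ^+ 2) x.
  by rewrite -E1B.
suff e2 : E1 n (fun y => b n.+1 y ^+ 2) x = b n x ^+ 2 + E1 n (fun y => incr b n y ^+ 2) x.
  by rewrite e1 e2 /cvar cexpS//; lra.
rewrite (E1_ext _ _ (Y := fun y => b n y ^+ 2 + 2 * (b n y * incr b n y) + incr b n y ^+ 2)); last first.
  by move=> y; rewrite /incr; ring.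
rewrite !E1D E1Z (E1_pull _ _ (ab (n := n))) (proj2 (mart_mdiff mb)).
by rewrite E1_id ?mulr0 ?addr0// => y z e; rewrite (ab e).
Qed.

Lemma cvar_ge0 n x : (n <= N)%N -> 0 <= cvar n x.
Proof.
elim/(@cexp_ind N): n x => [n Nn x nN|n nN ih x _].
  by have -> : n = N by [apply/eqP; rewrite eqn_leq nN]; rewrite cvar_top.
rewrite -cvarS// addr_ge0// E1_ge0// => y; first exact: sqr_ge0.
exact: ih.
Qed.

Variables (kappa : R) (L : R -> nat -> D -> R).
Hypotheses (k0 : 0 < kappa) (bk : forall n x, `|incr b n x| <= kappa).
Hypotheses (mL : forall c, mart (L c)) (bL : forall c n x, `|b n x - c| <= L c n x).
Hypothesis Lk : forall n x, L (b n x) n x <= 2 * kappa.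

(* Stopping [b] when it has moved by [4 kappa] from [c]: the stopped part has
   probability at most [L / 4 kappa], and costs at most [V] after stopping. *)
Let stop V c n x : (forall n x, (n <= N)%N -> cvar n x <= V) -> 0 <= V -> (n <= N)%N ->
  `|b n x - c| <= 4 * kappa ->
  (b n x - c) ^+ 2 + cvar n x <= 25 * kappa ^+ 2 + V / (4 * kappa) * L c n x.
Proof.
move=> cV V0; have VL n' x' : 0 <= V / (4 * kappa) * L c n' x'.
  by rewrite mulr_ge0 ?divr_ge0 ?mulr_ge0 ?(ltW k0)//; exact: le_trans (bL _ _ _).
elim/(@cexp_ind N): n x => [n Nn x nN|n nN ih x _] le.
  have -> : n = N by [apply/eqP; rewrite eqn_leq nN].
  move: le; rewrite (_ : n = N) ?cvar_top ?addr0; last by apply/eqP; rewrite eqn_leq nN.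
  move=> le; have := VL N x; rewrite -[_ ^+ 2]real_normK ?num_real//.
  by have := normr_ge0 (b N x - c); have := k0; nra.
have [aL LE] := mL c; have [_ bE] := mb.
have ac : ad n (fun y => b n y - c) by move=> y z e; rewrite (ab e).
have -> : (b n x - c) ^+ 2 + cvar n x =
    E1 n (fun y => (b n.+1 y - c) ^+ 2 + cvar n.+1 y) x.
  rewrite (E1_ext _ _ (Y := fun y => (((b n y - c) * (b n y - c) +
    2 * ((b n y - c) * incr b n y)) + incr b n y ^+ 2) + cvar n.+1 y)); last first.
    by move=> y; rewrite /incr; ring.
  rewrite 3!E1D E1Z !(E1_pull _ _ ac) (proj2 (mart_mdiff mb)) (E1_id _ ac).
  by rewrite -addrA cvarS//; ring.
have -> : 25 * kappa ^+ 2 + V / (4 * kappa) * L c n x =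
    E1 n (fun y => 25 * kappa ^+ 2 + V / (4 * kappa) * L c n.+1 y) x.
  by rewrite E1D E1_cst E1Z LE.
apply: le_E1_cell => y e.
have [h|h] := leP `|b n.+1 y - c| (4 * kappa); first exact: ih.
have h1 : V <= V / (4 * kappa) * L c n.+1 y.
  rewrite mulrAC ler_pdivlMr ?mulr_gt0// ler_wpM2l//.
  exact: le_trans (ltW h) (bL _ _ _).
have h2 : `|b n.+1 y - c| <= 5 * kappa.
  have -> : b n.+1 y - c = incr b n y + (b n y - c) by rewrite /incr; ring.
  apply: le_trans (ler_normD _ _) _; rewrite (ab e).
  by have := bk n y; lra.
have := cV _ y nN; rewrite -[(_ - c) ^+ 2]real_normK ?num_real//.
have := normr_ge0 (b n.+1 y - c); nra.
Qed.

(** Self-improvement: [stop] with c = b_n x gives cvar <= 25 kappa^2 + (V / (4 kappa)) (2 kappa),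
    hence V <= 25 kappa^2 + V / 2. Absorbing V / 2 is legitimate because V is a maximum over
    finitely many cells. *)
Lemma cvar_le n x : (n <= N)%N -> cvar n x <= 50 * kappa ^+ 2.
Proof.
move=> nN.
pose V := \big[Num.max/0]_(m < N.+1) \big[Num.max/0]_(k < 2 ^ m) cvar m (rep D m k).
have V0 : 0 <= V by exact: bigmax_ge_id.
have cV m z : (m <= N)%N -> cvar m z <= V.
  move=> mN; have -> : cvar m z = cvar m (rep D m (idx m z)).
    by apply: cvar_ad; rewrite idx_rep// idx_lt.
  rewrite -ltnS in mN; apply: le_trans (le_bigmax _ _ (Ordinal mN)) => /=.
  exact: (le_bigmax _ (fun k : 'I_(2 ^ m) => cvar m (rep D m k)) (Ordinal (idx_lt m z))).
have half m z : (m <= N)%N -> cvar m z <= 25 * kappa ^+ 2 + V / 2.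
  move=> mN; have := stop cV V0 mN (x := z) (c := b m z).
  rewrite subrr normr0 expr0n add0r => h.
  apply: le_trans (h _) _; first by rewrite mulr_ge0// ltW.
  rewrite lerD2l.
  have -> : V / 2 = V / (4 * kappa) * (2 * kappa) by field; rewrite gt_eqF.
  by rewrite ler_wpM2l ?Lk// divr_ge0// mulr_ge0// ltW.
have : V <= 25 * kappa ^+ 2 + V / 2.
  have p0 : 0 <= 25 * kappa ^+ 2 + V / 2.
    by rewrite addr_ge0 ?divr_ge0// mulr_ge0// sqr_ge0.
  apply: bigmax_le => // m _; apply: bigmax_le => // k _.
  by apply: half; rewrite -ltnS.
by have := cV n x nN; lra.
Qed.

End Level.

(** [L c n] stands for E_n |b - c|, so only L^1 oscillation is assumed. The constant adds the bounds
    for jumps and variance because [bmo2] uses one number for both. *)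
Lemma john_nirenberg b kappa (L : R -> nat -> D -> R) : mart b -> 0 < kappa ->
  (forall n x, `|incr b n x| <= kappa) -> (forall c, mart (L c)) ->
  (forall c n x, `|b n x - c| <= L c n x) ->
  (forall n x, L (b n x) n x <= 2 * kappa) ->
  bmo2 b (kappa + 50 * kappa ^+ 2).
Proof.
move=> mb k0 bk mL bL Lk; split=> // [n x|N].
  by rewrite (le_trans (bk n x))// lerDl mulr_ge0// sqr_ge0.
exists (cvar b N); split=> [n _|n x nN|n x nN].
- exact: cvar_ad.
- rewrite cvar_ge0//= (le_trans (cvar_le _ k0 bk mL bL Lk x nN))//.
  by rewrite lerDr ltW.
- by rewrite cvarS.
Qed.

End JohnNirenberg.

(** * The commutator at a finite level *)

Section RealSeq.
Context {R : realType}.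
Implicit Types (p u : nat -> R).

Lemma bounded_series_cvg p A : (forall k, 0 <= p k) ->
  (forall N, \sum_(k < N) p k <= A) -> cvgn (series p).
Proof.
move=> p0 pA; apply: nondecreasing_is_cvgn; first exact: nondecreasing_series.
by exists A => _ [N _ <-]; rewrite /series/= big_mkord.
Qed.

Lemma bounded_series_tail p A e : (forall k, 0 <= p k) ->
  (forall N, \sum_(k < N) p k <= A) -> 0 < e ->
  exists M, forall N, \sum_(M <= k < N) p k <= e.
Proof.
move=> p0 pA e0.
have /cauchy_cvgP/cauchy_seriesP/(_ e e0) := bounded_series_cvg p0 pA.
move=> [[P Q] /= [[M _ PM] [M' _ QM]]] PQ.
exists (maxn M M') => N.
have [NM|MN] := leqP N (maxn M M'); first by rewrite big_geq// ltW.
apply/ltW; apply: le_lt_trans (ler_norm _) _.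
apply: (PQ (maxn M M', N)); split => /=.
  by apply: PM; rewrite /= leq_maxl.
by apply: QM; rewrite /= (leq_trans _ (ltnW MN))// leq_maxr.
Qed.

End RealSeq.

Section Product.
Context {R : realType} {D : tree R}.
Implicit Types (X Y : D -> R) (n N M : nat) (x : D) (b f g : nat -> D -> R).

Definition PiN b f N x : R :=
  b 0%N x * f 0%N x + \sum_(k < N) incr f k x * incr b k x.

(* With [PiN] the diagonal part of the product [b f], the paper's
   [[E_n, b] f] is [Gf b f n - PiN b f n - (b - b_n) f_n]. *)
Definition Gf b f n x : R := limn (fun N => cexp N n (PiN b f N) x).

Definition dual_le b f (A : R) :=
  forall N, Ex N (fun x => \sum_(k < N) `|incr b k x| * `|incr f k x|) <= A.

Lemma PiN_ad b f N : mart b -> mart f -> ad N (PiN b f N).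
Proof.
move=> mb mf; have [ab _] := mb; have [af _] := mf.
have [ib _] := mart_mdiff mb; have [if_ _] := mart_mdiff mf.
move=> x y e; rewrite /PiN (ab 0%N x y) ?(af 0%N x y) ?(idxW _ e)//.
congr (_ + _); apply: eq_bigr => k _.
by rewrite (ib k x y) ?(if_ k x y) ?(idxW _ e).
Qed.

(** A cell of positive mass carries at most the whole expectation. This turns summability in mean
    into convergence at every point, with no exceptional set. *)
Lemma cexp_cell N n X x : (n <= N)%N -> ad N X -> (forall y, 0 <= X y) ->
  wn n x * cexp N n X x <= Ex N X.
Proof.
move=> nN aX X0; have [ac _] := cexp_mart aX.
rewrite -(Ex_cexp nN aX) (Ex_ad nN (ac n)) /Ex.
have -> : wn n x * cexp N n X x =
    wt D n (idx n x) * cexp N n X (rep D n (idx n x)).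
  by congr (_ * _); apply: ac; rewrite idx_rep// idx_lt.
rewrite (bigD1 (Ordinal (idx_lt n x)))//= lerDl sumr_ge0// => k _.
apply: mulr_ge0; first by rewrite ltW// wt_gt0.
by rewrite -[leLHS](cexp0 N n (rep D n k)); exact: le_cexp.
Qed.

Section Limit.
Variables (b f : nat -> D -> R) (A : R).
Hypotheses (mb : mart b) (mf : mart f) (bfA : dual_le b f A).

Let z k x : R := incr f k x * incr b k x.

Let az k : ad k.+1 (z k).
Proof.
have [ib _] := mart_mdiff mb; have [if_ _] := mart_mdiff mf.
by move=> x y e; rewrite /z (ib _ _ _ e) (if_ _ _ _ e).
Qed.

Lemma cexp_PiNS n N x : (n <= N)%N -> cexp N.+1 n (PiN b f N.+1) x =
  cexp N n (PiN b f N) x + cexp N.+1 n (z N) x.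
Proof.
move=> nN; rewrite -(cexpW x nN (PiN_ad mb mf)) -cexpD; apply: cexp_ext => y.
by rewrite /PiN big_ord_recr addrA.
Qed.

Lemma is_cvg_Gf n x : cvgn (fun N => cexp N n (PiN b f N) x).
Proof.
(* The conditional expectations of the successive diagonal terms; at x their absolute series is at
   most A / wn n x. *)
pose c k := cexp (n + k).+1 n (z (n + k)%N) x.
have E M : cexp (n + M) n (PiN b f (n + M)) x = PiN b f n x + \sum_(k < M) c k.
  elim: M => [|M ih]; first by rewrite addn0 cexp_id// big_ord0 addr0.
  by rewrite addnS cexp_PiNS ?leq_addr// ih big_ord_recr addrA.
have : cvgn (series (fun k => `|c k|)).
  apply: (@bounded_series_cvg _ _ ((wn n x)^-1 * A)) => // M.
  rewrite ler_pdivlMl ?wn_gt0// mulr_sumr.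
  apply: le_trans (bfA (n + M)).
  rewrite (Ex_sum (n + M) (n + M) (fun k x => `|incr b k x| * `|incr f k x|)).
  rewrite big_split_ord/= -[leLHS]add0r lerD//.
    by apply: sumr_ge0 => k _; apply: Ex_ge0 => y; rewrite mulr_ge0.
  apply: ler_sum => k _.
  have aX : ad (n + k).+1 (fun y => `|z (n + k)%N y|).
    by move=> y t e; rewrite (az e).
  have kM : ((n + k).+1 <= n + M)%N by rewrite -addnS leq_add2l.
  rewrite (Ex_ext _ (Y := fun y => `|z (n + k)%N y|)); last first.
    by move=> y; rewrite /z normrM mulrC.
  rewrite (Ex_ad kM aX).
  have nk : (n <= (n + k).+1)%N by rewrite leqW// leq_addr.
  apply: le_trans (cexp_cell x nk aX (fun y => normr_ge0 _)).
  by rewrite ler_pM2l ?wn_gt0//; exact: abs_cexp.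
move=> /normed_cvg /cvg_ex[l cl]; apply/cvg_ex; exists (PiN b f n x + l).
rewrite -(cvg_shiftn n).
rewrite (_ : [sequence _]_m = (fun M => PiN b f n x + series c M)).
  by apply: cvgD => //; exact: cvg_cst.
by apply/funext => M /=; rewrite addnC E /series/= big_mkord.
Qed.

Lemma cvg_Gf n x : (fun N => cexp N n (PiN b f N) x) @ \oo --> Gf b f n x.
Proof. exact: is_cvg_Gf. Qed.

Lemma mart_Gf : mart (Gf b f).
Proof.
split=> [n x y e|n x].
  rewrite /Gf (_ : (fun N => _) = (fun N => cexp N n (PiN b f N) y))//.
  apply/funext => N.
  by have [ac _] := cexp_mart (PiN_ad mb mf : ad N (PiN b f N)); exact: ac.
have h : (fun N => cexp N n (PiN b f N) x) @ \oo --> E1 n (Gf b f n.+1) x.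
  rewrite (_ : (fun N => _) = (fun N => E1 n (cexp N n.+1 (PiN b f N)) x)).
    by apply: cvgMr_tmp; apply: cvgD; apply: cvgMl_tmp; exact: cvg_Gf.
  by apply/funext => N; have [_ ->] := cexp_mart (PiN_ad mb mf : ad N (PiN b f N)).
exact: (cvg_unique _ h (@cvg_Gf n x)).
Qed.

Lemma cvg_Ex N (u : nat -> D -> R) v : (forall x, u ^~ x @ \oo --> v x) ->
  (fun M => Ex N (u M)) @ \oo --> Ex N v.
Proof.
move=> uv; rewrite /Ex; apply: cvg_big => [|i _]; first exact: add_continuous.
by apply: cvgMl_tmp; exact: uv.
Qed.

(** Conditioning contracts L^1, and at a fixed level the expectation is a finite sum, so the bound
    survives the limit. *)
Lemma Ex_Gf_le N Q : (forall M, Ex M (fun x => `|PiN b f M x|) <= Q) ->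
  Ex N (fun x => `|Gf b f N x|) <= Q.
Proof.
move=> PQ.
have h : (fun M => Ex N (fun x => `|cexp M N (PiN b f M) x|)) @ \oo -->
    Ex N (fun x => `|Gf b f N x|).
  by apply: cvg_Ex => x; apply: cvg_norm; exact: cvg_Gf.
apply: (ler_cvg_to h (cvg_cst Q)); exists N => // M /= NM.
have aP : ad M (PiN b f M) by exact: PiN_ad.
have aX : ad M (fun x => `|PiN b f M x|) by move=> x y e; rewrite (aP _ _ e).
have [ac _] := cexp_mart aX.
apply: le_trans (PQ M); rewrite -(Ex_cexp NM aX) (Ex_ad NM (ac N)).
by apply: le_Ex => x; exact: abs_cexp.
Qed.

End Limit.

Lemma GfB b f g A B n x : mart b -> mart f -> mart g -> dual_le b f A ->
  dual_le b g B -> Gf b (fun n x => f n x - g n x) n x = Gf b f n x - Gf b g n x.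
Proof.
move=> mb mf mg fA gB; apply: cvg_lim => //.
rewrite (_ : (fun N => _) = (fun N => cexp N n (PiN b f N) x - cexp N n (PiN b g N) x)).
  by apply: cvgB; [exact: (cvg_Gf mb mf fA)|exact: (cvg_Gf mb mg gB)].
apply/funext => N; rewrite -cexpB; apply: cexp_ext => y.
rewrite /PiN mulrBr opprD addrACA -sumrB; congr (_ + _).
by apply: eq_bigr => k _; rewrite /incr; ring.
Qed.

(* What [[H_D, b] f] becomes at level [n]: by [cN_commutator] below it is
   [Hs (b f)_n - b_{n+1} Hs f_n] when [b f] makes sense, but it only involves
   products that are controlled by the H_1 norm of [f]. *)
Definition cN b f n x : R := Pc b f n x + Hs (Gf b f) n x.

Lemma cNS b f n x : cN b f n.+1 x = cN b f n x + (f n x * hs n (b n.+1) x -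
  incr b n.+1 x * Hs f n x - (incr b n x + incr b n.+1 x) * hs n (f n.+1) x +
  hs n (Gf b f n.+1) x).
Proof. by rewrite addrACA; congr (_ + _); exact: psumS. Qed.

Lemma HsB f g n x : Hs (fun n x => f n x - g n x) n x = Hs f n x - Hs g n x.
Proof. by rewrite /Hs /psum -sumrB; apply: eq_bigr => k _; rewrite hsB. Qed.

Lemma cNB b f g A B n x : mart b -> mart f -> mart g -> dual_le b f A ->
  dual_le b g B -> cN b (fun n x => f n x - g n x) n x = cN b f n x - cN b g n x.
Proof.
move=> mb mf mg fA gB; rewrite /cN opprD addrACA -HsB; congr (_ + _).
  rewrite /Pc /psum -sumrB; apply: eq_bigr => k _; rewrite hsB HsB; ring.
apply: eq_bigr => k _; apply: hs_ext => y; exact: (GfB k.+1 y mb mf mg fA gB).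
Qed.

End Product.

(** * Uniform estimates in terms of the H_1 norm *)

Section Bounds.
Context {R : realType} {D : tree R}.
Implicit Types (n N M : nat) (x : D) (f g : nat -> D -> R).
Variables (C B : R) (b : nat -> D -> R).
Hypotheses (C0 : 0 < C) (mC : forall n (x : D), mI n.+1 x <= C * mI n x).
Hypothesis bB : bmo2 b B.

(** [A] need not be the norm itself: its positivity allows it to be added to weights, and
    [lee_mulr_approx] returns to the norm. *)
Definition H1le f (A : R) := [/\ mart f, 0 < A & forall N, Ex N (Sq f N) <= A].

Let K := 4 * Num.sqrt C.
Let K0 : 0 <= K. Proof. by rewrite mulr_ge0 ?sqrtr_ge0. Qed.
Let B0 : 0 <= B. Proof. exact: bmo2_ge0 (rep D 0 0) bB. Qed.
Let mb : mart b. Proof. by case: bB. Qed.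

Lemma davisW N f A A' : A <= A' -> davis N f A -> davis N f A'.
Proof.
move=> le [g [h [a [? ? ? ? ?]]]]; exists g, h, a.
by split=> //; exact: le_trans le.
Qed.

Lemma H1le_davis N f A : H1le f A -> davis N f (5 * A).
Proof.
move=> [mf A0 fA]; apply: davisW (davis_Sq N mf A0).
by have := fA N; lra.
Qed.

Lemma H1le_dual f A : H1le f A -> dual_le b f ((1 + 2 * B) * (5 * A)).
Proof. by move=> fA N; exact: davis_dual bB (H1le_davis N fA). Qed.

Lemma H1le_max f A N : H1le f A -> Ex N (mx f N) <= 30 * A.
Proof. by move=> fA; have := davis_max (H1le_davis N fA); lra. Qed.

Lemma H1le_Hs f A N : H1le f A -> Ex N.+1 (mx (Hs f) N) <= (9 + K) * 5 * A.
Proof.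
move=> fA; have [mf _ _] := fA.
by have := davis_Hs C0 mC (H1le_davis N.+1 fA) mf; rewrite mulrA.
Qed.

Let KG := `|b 0%N (rep D 0 0)| + (1 + 2 * B) * 5.

Lemma KG_ge0 : 0 <= KG.
Proof. by rewrite addr_ge0// mulr_ge0// addr_ge0// mulr_ge0. Qed.

Lemma H1le_PiN f A N : H1le f A -> Ex N (fun x => `|b 0%N x * f 0%N x| +
    \sum_(k < N) `|incr b k x| * `|incr f k x|) <= KG * A.
Proof.
move=> fA; have [mf A0 fS] := fA; rewrite ExD /KG mulrDl -mulrA lerD//; last exact: H1le_dual.
apply: le_trans (_ : `|b 0%N (rep D 0 0)| * Ex N (Sq f N) <= _); last by rewrite ler_wpM2l.
rewrite -ExZ; apply: le_Ex => x; rewrite normrM; have [ab _] := mb.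
have e0 y : idx 0 y = 0%N by have := idx_lt 0 y; rewrite expn0 ltnS leqn0 => /eqP.
rewrite (ab 0%N x (rep D 0 0)) ?e0// ler_wpM2l//.
rewrite -sqrtr_sqr ler_wsqrtr// lerDl sumr_ge0// => k _; exact: sqr_ge0.
Qed.

Lemma H1le_Gf f A N : H1le f A -> Ex N (fun x => `|Gf b f N x|) <= KG * A.
Proof.
move=> fA; have [mf _ _] := fA.
apply: (Ex_Gf_le mb mf (H1le_dual fA)) => M; apply: le_trans (H1le_PiN M fA).
apply: le_Ex => x; apply: le_trans (ler_normD _ _) _; rewrite lerD2l.
by apply: le_trans (ler_norm_sum _ _ _) _; apply: ler_sum => k _; rewrite normrM mulrC.
Qed.

(** The weight is the maximal function of f plus A, of mean at most 30 A + A; at time n it dominates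
    |f_n|. *)
Lemma H1le_gap f A N : H1le f A ->
  Ex N (mx (fun n x => f n x * (b N x - b n x)) N) <= (1 + 4 * B) * 31 * A.
Proof.
move=> fA; have [mf A0 _] := fA; have [af _] := mf.
pose a n x := mx f n x + A.
have wa : weight a.
  split=> [n|n x|n x]; first by move=> x t e; rewrite /a (mx_ad af e).
    by rewrite ltr_wpDl ?mx_ge0.
  by rewrite lerD2r mx_mono.
have aN : Ex N (a N) <= 31 * A.
  by rewrite /a ExD Ex_cst; have := H1le_max N fA; lra.
have h1 := weighted_gap N mb wa; have h2 := bmo2_weight N bB wa.
apply: le_trans (_ : _ <= Ex N (mx (fun n x => a n x * (b N x - b n x)) N)) _.
  apply: le_Ex => x; apply: mx_le => n nN.
  apply: le_trans (mx_ge (fun n x => a n x * (b N x - b n x)) x nN).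
  rewrite !normrM ler_wpM2r// [leRHS]gtr0_norm; last by have [_ ->] := wa.
  by rewrite /a; have := mx_ge f x (leqnn n); lra.
have := ler_wpM2l B0 aN; lra.
Qed.

Definition KW := 2 * (KP C B * 5) + 2 * (2 * (65 + 4 * K) * KG).

Let KP0 : 0 <= KP C B.
Proof.
rewrite /KP -/K; have := mulr_ge0 B0 K0; have := B0; have := K0; lra.
Qed.

Lemma KW_ge0 : 0 <= KW.
Proof.
rewrite /KW; have := KP0; have := KG_ge0; have := mulr_ge0 K0 KG_ge0; lra.
Qed.

(** Half of the level goes to [Pc], by Markov, and half to the transform of [Gf], by [weak_Hs],
    which asks only for the L^1 bound of [Gf]. *)
Lemma H1le_weak f A N lam : H1le f A -> 0 < lam ->
  lam * Ex N.+1 (fun x => (lam < mx (cN b f) N x)%R%:R) <= KW * A.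
Proof.
move=> fA l0; have [mf A0 _] := fA.
have l20 : 0 < lam / 2 by lra.
have A50 : 0 < 5 * A by lra.
have h1 := Pc_max C0 mC bB mf A50 (H1le_davis N.+1 fA).
have h2 := weak_Hs C0 mC N (mart_Gf mb mf (H1le_dual fA)) l20.
have h3 := H1le_Gf N.+1 fA.
have : lam * Ex N.+1 (fun x => (lam < mx (cN b f) N x)%R%:R) <=
   Ex N.+1 (fun x => 2 * mx (Pc b f) N x + lam * (lam / 2 < mx (Hs (Gf b f)) N x)%R%:R).
  rewrite -ExZ; apply: le_Ex => x.
  have le : mx (cN b f) N x <= mx (Pc b f) N x + mx (Hs (Gf b f)) N x by exact: mxD.
  have := mx_ge0 (Pc b f) N x.
  case: (ltP lam) => [lt|_] p0 /=; last first.
    by rewrite mulr0 addr_ge0 ?mulr_ge0 ?(ltW l0)// ler0n.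
  by case: (ltP (lam / 2) (mx (Hs (Gf b f)) N x)) => h5 /=; move: le lt p0 h5; rewrite ?mulr1 ?mulr0; lra.
rewrite ExD !ExZ => h4; rewrite -/K in h2.
have p0 : 0 <= 2 * (2 * (65 + 4 * K)) by have := K0; lra.
have := ler_wpM2l p0 h3; rewrite /KW; move: h1 h2 h4; lra.
Qed.

(** An integrable maximal function gives [Gf] a Davis decomposition of size (64 + 8) A2, so that
    [davis_Hs] replaces the weak type bound. *)
Lemma H1le_strong f A A2 N : H1le f A -> 0 < A2 ->
  Ex N.+1 (mx (Gf b f) N.+1) <= A2 ->
  Ex N.+1 (mx (cN b f) N) <= KP C B * 5 * A + (9 + K) * 72 * A2.
Proof.
move=> fA A20 GA; have [mf A0 _] := fA; have A50 : 0 < 5 * A by lra.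
have mG := mart_Gf mb mf (H1le_dual fA).
have h1 := Pc_max C0 mC bB mf A50 (H1le_davis N.+1 fA).
have dG : davis N.+1 (Gf b f) (72 * A2).
  by apply: davisW (davis_mx N.+1 mG A20); lra.
have h2 := davis_Hs C0 mC dG mG.
apply: le_trans (_ : _ <= Ex N.+1 (fun x => mx (Pc b f) N x + mx (Hs (Gf b f)) N x)) _.
  by apply: le_Ex => x; exact: mxD.
by rewrite ExD; move: h2; rewrite -/K; lra.
Qed.

Lemma mdiff2_tail (y : nat -> D -> R) c e : mdiff2 y ->
  (forall N, Ex N.+1 (fun x => \sum_(k < N) y k x ^+ 2) <= c) -> 0 < e ->
  exists M, forall N, Ex N.+1 (fun x =>
    mx (psum (fun k x => if (M <= k)%N then y k x else 0)) N x ^+ 2) <= e.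
Proof.
move=> my yc e0; have [ay yE] := my.
pose p k := Ex k.+2 (fun x => y k x ^+ 2).
have p0 k : 0 <= p k by apply: Ex_ge0 => x; exact: sqr_ge0.
have pE k N : (k < N)%N -> Ex N.+1 (fun x => y k x ^+ 2) = p k.
  by move=> kN; rewrite (@Ex_ad _ _ k.+2)// => x z xz; rewrite (ay _ _ _ xz).
have pc N : \sum_(k < N) p k <= c.
  apply: le_trans (yc N); rewrite (Ex_sum N.+1 N (fun k x => y k x ^+ 2)).
  by apply: ler_sum => k _; rewrite pE.
have e40 : 0 < e / 4 by lra.
have [M MN] := bounded_series_tail p0 pc e40; exists M => N.
pose y' k x := if (M <= k)%N then y k x else 0.
have my' : mdiff2 y'.
  rewrite /y'; split=> [n x z xz|n x].
    by case: (M <= n)%N => //; exact: ay.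
  by case: (M <= n)%N => //; exact: E1_cst.
apply: le_trans (mdiff2_doob N my') _.
rewrite (Ex_sum N.+1 N (fun k x => y' k x ^+ 2)).
suff : \sum_(k < N) Ex N.+1 (fun x => y' k x ^+ 2) <= e / 4 by lra.
apply: le_trans (MN N); rewrite big_mkcond/=.
rewrite -(big_mkord xpredT (fun k => Ex N.+1 (fun x => y' k x ^+ 2))) big_mkcond/=.
have [NM|MN'] := leqP N M.
  rewrite [leRHS]big_geq//; rewrite big_nat_cond big1// => k /andP[/andP[_ kN] _].
  rewrite (Ex_ext _ (Y := fun=> 0)) ?Ex_cst// => x.
  by rewrite /y' leqNgt (leq_trans kN NM) expr0n.
rewrite (big_cat_nat (n := M)) ?(ltnW MN')//= -[leRHS]add0r lerD//.
  rewrite big_nat_cond big1// => k /andP[/andP[_ kN] _].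
  rewrite (Ex_ext _ (Y := fun=> 0)) ?Ex_cst// => x.
  by rewrite /y' leqNgt kN expr0n.
rewrite big_nat_cond [leRHS]big_nat_cond; apply: ler_sum => k /andP[/andP[Mk kN] _].
by rewrite (Ex_ext _ (Y := fun x => y k x ^+ 2)) ?pE// => x; rewrite /y' Mk.
Qed.

Let weight1 : weight (fun (_ : nat) (_ : D) => 1 : R).
Proof. by split. Qed.

Lemma bmo2_incr_L2 N : Ex N.+1 (fun x => \sum_(k < N) incr b k.+1 x ^+ 2) <= B.
Proof.
have := bmo2_weight N.+1 bB weight1; rewrite Ex_cst mulr1; apply: le_trans.
apply: le_Ex => x; rewrite [leRHS]big_ord_recl/= mul1r -[leLHS]add0r lerD ?sqr_ge0//.
by apply: ler_sum => k _; rewrite mul1r.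
Qed.

Lemma bmo2_hs_L2 N : Ex N.+1 (fun x => \sum_(k < N) hs k (b k.+1) x ^+ 2) <= 2 * B.
Proof.
have := Ex_weight_hs N bB weight1; rewrite Ex_cst mulr1; apply: le_trans.
by apply: le_Ex => x; apply: ler_sum => k _; rewrite mul1r.
Qed.

(** Freezing at a deterministic level gives finitely valued martingales, hence L^2 ones; they
    approximate f in H_1 by [H1le_tail]. *)
Definition stopped f M n : D -> R := f (minn n M).

Lemma incr_stopped f M n x :
  incr (stopped f M) n x = if (n < M)%N then incr f n x else 0.
Proof.
case: ltnP => nM; rewrite /incr /stopped.
  by rewrite (minn_idPl nM) (minn_idPl (ltnW nM)).
by rewrite (minn_idPr nM) (minn_idPr (leqW nM)) subrr.
Qed.

Lemma mart_stopped f M : mart f -> mart (stopped f M).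
Proof.
move=> [af fE]; split=> [n|n x].
  by apply: adW (af _); rewrite geq_minl.
case: (ltnP n M) => nM; rewrite /stopped.
  by rewrite (minn_idPl nM) (minn_idPl (ltnW nM)) fE.
by rewrite (minn_idPr nM) (minn_idPr (leqW nM)) E1_id//; exact: adW (af _).
Qed.

Lemma Hs_stopped f M n x : mart f -> (M <= n)%N ->
  Hs (stopped f M) n x = Hs (stopped f M) M x.
Proof.
move=> mf /subnK <-; have [as_ _] := mart_stopped M mf.
elim: (n - M)%N => [//|d ih]; rewrite addSn /Hs psumS -/(Hs _) ih.
rewrite -hs_incr// (hs_ext _ _ (Y := fun=> 0)) ?hs0 ?addr0// => y.
by rewrite incr_stopped ltnNge leq_addl.
Qed.

Lemma Gf_stopped f M n x : mart f -> (M <= n)%N ->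
  Gf b (stopped f M) n x = PiN b (stopped f M) M x.
Proof.
move=> mf Mn; have aP : ad M (PiN b (stopped f M) M) by exact: (PiN_ad mb (mart_stopped M mf)).
apply: cvg_lim => //; apply: cvg_near_cst; exists M => // N /= MN.
rewrite (cexp_ext _ _ _ (Y := PiN b (stopped f M) M)) ?cexp_ad//; first exact: adW aP.
move=> y; rewrite /PiN; congr (_ + _); rewrite -(subnKC MN) big_split_ord/=.
rewrite [X in _ + X]big1 ?addr0// => k _.
by rewrite incr_stopped ltnNge leq_addr mul0r.
Qed.

(** After [M] the increments of f and of the diagonal part vanish. There remain the coefficients f_M
    and Hs f_M, now frozen, times partial sums of L^2-bounded martingales built from b, which
    converge almost everywhere. *)
Lemma cN_stopped f M n x : mart f -> (M <= n)%N ->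
  cN b (stopped f M) n x - cN b (stopped f M) M x =
  f M x * (psum (fun k x => hs k (b k.+1) x) n x - psum (fun k x => hs k (b k.+1) x) M x) -
  Hs (stopped f M) M x *
    (psum (fun k x => incr b k.+1 x) n x - psum (fun k x => incr b k.+1 x) M x).
Proof.
move=> mf /subnK <-; have [as_ _] := mart_stopped M mf.
elim: (n - M)%N => [|d ih]; first by rewrite !subrr !mulr0 subrr.
rewrite addSn; have Md : (M <= d + M)%N by rewrite leq_addl.
have e1 : hs (d + M) (stopped f M (d + M).+1) x = 0.
  rewrite -hs_incr// (hs_ext _ _ (Y := fun=> 0)) ?hs0// => y.
  by rewrite incr_stopped ltnNge Md.
have e2 : hs (d + M) (Gf b (stopped f M) (d + M).+1) x = 0.
  rewrite (hs_ext _ _ (Y := PiN b (stopped f M) M)); last first.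
    by move=> y; rewrite Gf_stopped// leqW.
  by rewrite hs0//; exact: adW (PiN_ad mb (mart_stopped M mf)).
have e3 : stopped f M (d + M) x = f M x by rewrite /stopped (minn_idPr Md).
have e4 := Hs_stopped x mf Md.
by rewrite cNS e1 e2 e3 e4 !psumS; move: ih; lra.
Qed.

End Bounds.

(** * The dyadic tree of a probability measure *)

Section DyadicCells.
Context {R : realType}.
Implicit Types (x y : R) (n k : nat).

(** A cell index is needed at every real. The points outside [0, 1[, a null set, are put in the cell
    of 0 at each level. *)
Definition clip x : R := if 0 <= x < 1 then x else 0.

Lemma clip01 x : 0 <= clip x < 1.
Proof. by rewrite /clip; case: ifP => //; rewrite lexx ltr01. Qed.

Lemma clip_id x : 0 <= x < 1 -> clip x = x.
Proof. by rewrite /clip => ->. Qed.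

Lemma clipK x : clip (clip x) = clip x.
Proof. exact/clip_id/clip01. Qed.

Definition cidx n x : nat := Num.truncn (clip x * 2 ^+ n).
Definition crep n k : R := k%:R / 2 ^+ n.

Let p2 n : 0 < 2 ^+ n :> R. Proof. by rewrite exprn_gt0. Qed.

Lemma dyadicE n k x : (dyadic n k : set R) x = (k%:R <= x * 2 ^+ n < k.+1%:R) :> Prop.
Proof. by rewrite /dyadic /= in_itv /= ler_pdivrMr// ltr_pdivlMr. Qed.

Lemma dyadic01 n k x : (k < 2 ^ n)%N -> (dyadic n k : set R) x -> 0 <= x < 1.
Proof.
rewrite dyadicE => kn /andP[a b]; apply/andP; split.
  by rewrite -(pmulr_lge0 _ (p2 n)) (le_trans _ a).
rewrite -(ltr_pM2r (p2 n)) mul1r (lt_le_trans b)// -natrX ler_nat.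
exact: kn.
Qed.

Lemma dyadic_cidx n x : 0 <= x < 1 -> (dyadic n (cidx n x) : set R) x.
Proof.
move=> x01; rewrite dyadicE /cidx clip_id//; apply: Num.Theory.truncn_itv.
by case/andP: x01 => x0 _; rewrite mulr_ge0 ?exprn_ge0.
Qed.

Lemma cidx_clip n x : cidx n (clip x) = cidx n x.
Proof. by rewrite /cidx clipK. Qed.

Lemma cidx_lt n x : (cidx n x < 2 ^ n)%N.
Proof.
have /andP[c0 c1] := clip01 x.
have h0 : 0 <= clip x * 2 ^+ n by rewrite mulr_ge0// ltW.
have /andP[a _] := Num.Theory.truncn_itv h0.
rewrite -(ltr_nat R) natrX; apply: le_lt_trans a _.
by rewrite gtr_pMl.
Qed.

Lemma dyadic_idx n k x : (k < 2 ^ n)%N -> (dyadic n k : set R) x -> cidx n x = k.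
Proof.
move=> kn Dx; have x01 := dyadic01 kn Dx.
exact: dyadic_inj (dyadic_cidx n x01) Dx.
Qed.

Lemma dyadic_split n k : dyadic n k = dyadic n.+1 k.*2 `|` dyadic n.+1 k.*2.+1 :> set R.
Proof.
have e x : x * 2 ^+ n.+1 = 2 * (x * 2 ^+ n) by rewrite exprS; ring.
have d m : (m.*2)%:R = 2 * m%:R :> R by rewrite -mul2n natrM.
have d1 m : (m.*2.+1)%:R = 2 * m%:R + 1 :> R by rewrite -addn1 natrD d.
have d2 m : (m.*2.+2)%:R = 2 * m%:R + 2 :> R by rewrite -addn2 natrD d.
have s m : m.+1%:R = m%:R + 1 :> R by rewrite -addn1 natrD.
apply/seteqP; split=> x.
  rewrite dyadicE => /andP[a b].
  have [h|h] := ltP (x * 2 ^+ n.+1) (k.*2.+1)%:R; [left|right]; rewrite dyadicE; apply/andP; split => //.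
    by rewrite d e; move: a; lra.
  by rewrite d2 e; move: b; rewrite s; lra.
by case; rewrite !dyadicE !(d, d1, d2) s e => /andP[a b]; apply/andP; split; lra.
Qed.

Lemma cidx_half n x : (cidx n.+1 x)./2 = cidx n x.
Proof.
rewrite -(cidx_clip n) -(cidx_clip n.+1).
have Dx := dyadic_cidx n.+1 (clip01 x).
have kn := cidx_lt n.+1 (clip x).
apply/esym/dyadic_idx; first by rewrite ltn_half_double -mul2n -expnS.
rewrite dyadic_split; move: Dx; rewrite -{1}(odd_double_half (cidx n.+1 (clip x))).
by case: (odd _); rewrite ?add0n ?add1n => Dx; [right|left].
Qed.

Lemma dyadic_crep n k : (dyadic n k : set R) (crep n k).
Proof. by rewrite dyadicE /crep divfK ?gt_eqF// lexx ltr_nat ltnSn. Qed.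

Lemma cidx_crep n k : (k < 2 ^ n)%N -> cidx n (crep n k) = k.
Proof. by move=> kn; apply: dyadic_idx => //; exact: dyadic_crep. Qed.

End DyadicCells.

Section Instance.
Context {R : realType} (mu : probability (measurableTypeR R) R).
Hypothesis mu01 : mu `[0%R, 1%R[%classic = 1%E.
Hypothesis mu_pos : forall n k : nat, (k < 2 ^ n)%N -> (0 < mu (dyadic n k))%E.
Implicit Types (x y : R) (n k N : nat).

Lemma mass_fin n k : (mass mu n k)%:E = mu (dyadic n k).
Proof.
rewrite /mass fineK//; apply: fin_num_measure; exact: measurable_dyadic.
Qed.

Lemma mass_gt0 n k : (k < 2 ^ n)%N -> 0 < mass mu n k.
Proof. by move=> kn; rewrite -lte_fin mass_fin mu_pos. Qed.

Lemma mass_split n k : mass mu n k = mass mu n.+1 k.*2 + mass mu n.+1 k.*2.+1.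
Proof.
apply: EFin_inj; rewrite EFinD !mass_fin dyadic_split measureU//.
- exact: measurable_dyadic.
- exact: measurable_dyadic.
- apply/seteqP; split=> // x [/dyadic_inj h1 /h1 /eqP].
  by rewrite eq_sym gtn_eqF.
Qed.

Lemma dyadic00 : dyadic 0 0 = `[0%R, 1%R[%classic :> set R.
Proof. by rewrite /dyadic expr0 !divr1. Qed.

Lemma mass_root : mass mu 0 0 = 1.
Proof. by rewrite /mass dyadic00 mu01. Qed.

Definition dtree : tree R := @Tree R R cidx crep (mass mu)
  (@cidx_lt R) (@cidx_half R) (@cidx_crep R) mass_gt0
  (fun n k _ => mass_split n k) mass_root.

Let mI01 : measurable (`[0%R, 1%R[%classic : set (measurableTypeR R)).
Proof. exact: measurable_itv. Qed.

Lemma out01 : mu (~` `[0%R, 1%R[%classic) = 0%E.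
Proof. by rewrite (probability_setC mu mI01) mu01 subee. Qed.

Lemma ae01 (P : R -> Prop) : (forall x, 0 <= x < 1 -> P x) -> {ae mu, forall x, P x}.
Proof.
move=> P01; exists (~` `[0%R, 1%R[%classic); split.
- exact: measurableC.
- exact: out01.
- by move=> x /= nP; rewrite in_itv/= => x01; apply: nP; exact: P01.
Qed.

Implicit Types X : R -> R.

Lemma adE n X x : @ad R dtree n X ->
  X x = \sum_(k < 2 ^ n) X (crep n k) * \1_(dyadic n k) x +
        X 0 * \1_(~` `[0%R, 1%R[%classic) x.
Proof.
move=> aX; have [x01|x01] := boolP (0 <= x < 1).
  rewrite [\1_(~` _) x]indicE memNset; last by move=> /=; rewrite in_itv.
  rewrite mulr0 addr0 (bigD1 (Ordinal (cidx_lt n x)))//= big1 ?addr0.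
    rewrite indicE mem_set ?mulr1; last exact: dyadic_cidx.
    by apply: aX; rewrite /= cidx_crep ?cidx_lt.
  move=> k kx; rewrite indicE memNset ?mulr0//= => Dk.
  by move/eqP: kx; apply; apply/val_inj; rewrite /= (dyadic_idx _ Dk).
rewrite [\1_(~` _) x]indicE mem_set; last by move=> /=; rewrite in_itv; apply/negP.
rewrite big1 ?add0r ?mulr1; last first.
  by move=> k _; rewrite indicE memNset ?mulr0// => /dyadic01 h; move: x01; rewrite h.
apply: aX; rewrite /= /cidx /clip (negbTE x01).
by rewrite lexx ltr01.
Qed.

Lemma ad_measurable n X : @ad R dtree n X ->
  measurable_fun [set: measurableTypeR R] (X : measurableTypeR R -> R).
Proof.
move=> aX; rewrite (_ : X = fun x => \sum_(k < 2 ^ n) X (crep n k) * \1_(dyadic n k) x +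
        X 0 * \1_(~` `[0%R, 1%R[%classic) x); last by apply/funext => x; exact: adE.
apply: measurable_funD; last first.
  by apply: measurable_funM => //; apply: measurable_indic; exact: measurableC.
apply: measurable_sum => k; apply: measurable_funM => //.
by apply: measurable_indic; exact: measurable_dyadic.
Qed.

Lemma ad_integrable n X : @ad R dtree n X -> mu.-integrable setT (EFin \o X).
Proof.
move=> aX; apply: measurable_bounded_integrable => //.
- by rewrite (_ : _ setT = 1%E) ?ltry//; exact: probability_setT.
- exact: (ad_measurable aX).
- exists (\sum_(k < 2 ^ n) `|X (crep n k)|); split; first exact: num_real.
  move=> M /ltW sM x _ /=; apply: le_trans sM.
  have -> : X x = X (crep n (cidx n x)).
    by apply: aX; rewrite /= cidx_crep ?cidx_lt.
  by rewrite (bigD1 (Ordinal (cidx_lt n x)))//= lerDl sumr_ge0.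
Qed.

Lemma integral_cell (g h : R -> \bar R) n k : (forall x, dyadic n k x -> g x = h x) ->
  (\int[mu]_(x in dyadic n k) g x = \int[mu]_(x in dyadic n k) h x)%E.
Proof. by move=> e; apply: eq_integral => x; rewrite inE => /e. Qed.

Lemma integral_ad n X : @ad R dtree n X ->
  (\int[mu]_x (X x)%:E = (@Ex R dtree n X)%:E)%E.
Proof.
move=> aX; rewrite (integral_dyadic n mu01 measurableT (ad_integrable aX)).
rewrite /Ex -sumEFin; apply: eq_bigr => k _; rewrite setTI.
rewrite (integral_cell (h := fun=> (X (crep n k))%:E)); last first.
  move=> x Dx; congr EFin; apply: aX; rewrite /= (dyadic_idx _ Dx)//.
  by rewrite cidx_crep.
rewrite integral_cst//; last exact: measurable_dyadic.
by rewrite EFinM muleC mass_fin.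
Qed.

End Instance.

Section Averages.
Context {R : realType} (mu : probability (measurableTypeR R) R).
Hypothesis mu01 : mu `[0%R, 1%R[%classic = 1%E.
Hypothesis mu_pos : forall n k : nat, (k < 2 ^ n)%N -> (0 < mu (dyadic n k))%E.
Let T := dtree mu01 mu_pos.
Implicit Types (x y : R) (n k N : nat) (g h : R -> R).

(** A version of the conditional expectation that is adapted to the tree also outside [0, 1[, where
    [cond_exp] vanishes. *)
Definition avg g n x : R :=
  (mass mu n (cidx n x))^-1 * \int[mu]_(y in dyadic n (cidx n x)) g y.

Let mD n k : measurable (dyadic n k : set (measurableTypeR R)).
Proof. exact: measurable_dyadic. Qed.

Lemma cidx_lch n x : cidx n.+1 (@lch R T n x) = (cidx n x).*2.
Proof. exact: (idxS_lch (D := T)). Qed.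

Lemma cidx_rch n x : cidx n.+1 (@rch R T n x) = (cidx n x).*2.+1.
Proof. exact: (idxS_rch (D := T)). Qed.

Lemma integrable_cell g n k : mu.-integrable setT (EFin \o g) ->
  mu.-integrable (dyadic n k) (EFin \o g).
Proof. by move=> ig; apply: (integrableS measurableT). Qed.

Lemma mass_cidx_gt0 n x : 0 < mass mu n (cidx n x).
Proof. by apply: (mass_gt0 mu_pos); exact: cidx_lt. Qed.

Lemma cond_exp_avg g n x : mu.-integrable setT (EFin \o g) -> 0 <= x < 1 ->
  cond_exp mu n g x = avg g n x.
Proof.
move=> ig x01; rewrite cond_expE// (bigD1 (Ordinal (cidx_lt n x)))//= big1 ?addr0.
  by rewrite indicE mem_set ?mul1r//; exact: dyadic_cidx.
move=> k kx; rewrite indicE memNset ?mul0r//= => Dk.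
by move/eqP: kx; apply; apply/val_inj; rewrite /= (dyadic_idx _ Dk).
Qed.

Lemma avg_ad g n : @ad R T n (avg g n).
Proof. by move=> x y /= e; rewrite /avg e. Qed.

Lemma integral_cell_split g n k : mu.-integrable setT (EFin \o g) ->
  \int[mu]_(x in dyadic n k) g x = \int[mu]_(x in dyadic n.+1 k.*2) g x +
    \int[mu]_(x in dyadic n.+1 k.*2.+1) g x.
Proof.
move=> ig; rewrite dyadic_split Rintegral_setU//.
  by rewrite -dyadic_split; exact: integrable_cell.
apply/disj_setPS => x [/dyadic_inj h1 /h1 /eqP].
by rewrite eq_sym gtn_eqF.
Qed.

Lemma avg_mart g : mu.-integrable setT (EFin \o g) -> @mart R T (avg g).
Proof.
move=> ig; split=> [n|n x]; first exact: avg_ad.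
have := wl_gt0 (D := T) n x; have := wr_gt0 (D := T) n x; have := wn_gt0 (D := T) n x.
rewrite /E1 /avg cidx_lch cidx_rch /wl /wr /wn /=.
rewrite (integral_cell_split n _ ig) => n0 r0 l0.
by rewrite !mulVKf ?gt_eqF// mulrC.
Qed.

Lemma eq_avg g h n x : (forall y, 0 <= y < 1 -> g y = h y) -> avg g n x = avg h n x.
Proof.
move=> e; congr (_ * _); apply: eq_Rintegral => y; rewrite inE => /dyadic01 y01.
by apply: e; apply: y01; exact: cidx_lt.
Qed.

Lemma avg_cell_cst g c n x : (forall y, 0 <= y < 1 -> cidx n y = cidx n x -> g y = c) ->
  avg g n x = c.
Proof.
move=> gc; rewrite /avg (@eq_Rintegral _ _ _ mu _ (fun=> c)); last first.
  move=> y; rewrite inE => Dy; apply: gc; first by apply: dyadic01 Dy; exact: cidx_lt.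
  by rewrite (dyadic_idx _ Dy)//; exact: cidx_lt.
rewrite Rintegral_cst// -[fine _]/(mass mu n (cidx n x)) mulrCA mulVf ?mulr1//.
by rewrite gt_eqF// mass_cidx_gt0.
Qed.

Lemma avg_of_ad g n N x : (n <= N)%N -> @ad R T n g -> avg g N x = g x.
Proof.
move=> nN ag; apply: avg_cell_cst => y _ e; apply: ag.
exact: (idxW (D := T) nN e).
Qed.

Lemma Fn_measurable_cell n g x y : Fn_measurable n g -> 0 <= x < 1 -> 0 <= y < 1 ->
  cidx n x = cidx n y -> g x = g y.
Proof.
move=> mg x01 y01 xy.
have : <<s dyadics n >> (g @^-1` [set g y]).
  have := mg measurableT [set g y] (measurable_set1 _).
  by rewrite setTI.
move=> /(@dyadic_atom _ _ _ (cidx n x))[sub|sub].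
  exact: (sub x (dyadic_cidx n x01)).
by exfalso; apply: (sub y) => //; rewrite xy; exact: dyadic_cidx.
Qed.

Lemma clip_ad n g : Fn_measurable n g -> @ad R T n (g \o clip).
Proof.
move=> mg x y /= e; apply: Fn_measurable_cell mg _ _ _; try exact: clip01.
by rewrite !cidx_clip.
Qed.

(** A function measurable for F_n is constant on cells but may take another value outside [0, 1[;
    [clip] removes this ambiguity. *)
Definition tr (f : nat -> R -> R) n x : R := f n (clip x).

Lemma mart_tr f : is_martingale mu f -> @mart R T (tr f).
Proof.
move=> [mf fE]; have af n : @ad R T n (tr f n) by exact: clip_ad.
split=> // n x.
rewrite /tr -fE ?clip01//.
have e : cond_exp mu n (f n.+1) = cond_exp mu n (tr f n.+1).
  apply/funext => y; rewrite /cond_exp /econd_exp; congr fine.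
  apply: eq_bigr => k _; congr (_ * _)%E; apply: integral_cell => z Dz /=.
  by rewrite /tr clip_id//; exact: dyadic01 Dz.
have itr : mu.-integrable setT (EFin \o tr f n.+1) by exact: (ad_integrable (af _)).
rewrite e cond_exp_avg ?clip01//.
have -> : avg (tr f n.+1) n (clip x) = avg (tr f n.+1) n x.
  by apply: avg_ad; rewrite /= cidx_clip.
have [_ <-] := avg_mart itr; apply: (E1_ext (D := T)) => y.
by rewrite (avg_of_ad _ (leqnn n.+1)).
Qed.

Lemma avg_stopped f M n x : is_martingale mu f ->
  avg (f M) n x = @stopped R T (tr f) M n x.
Proof.
move=> mf; have [af fE] := mart_tr mf.
have -> : avg (f M) n x = avg (tr f M) n x.
  by apply: eq_avg => y y01; rewrite /tr clip_id.
have mA := avg_mart (ad_integrable (af M)).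
have [Mn|nM] := leqP M n.
  by rewrite (avg_of_ad x Mn (af M)) /stopped (minn_idPr Mn).
rewrite -(cexp_closed (D := T) x mA (ltnW nM)) /stopped (minn_idPl (ltnW nM)).
rewrite -(cexp_closed (D := T) x (mart_tr mf) (ltnW nM)).
by apply: (cexp_ext (D := T)) => y; rewrite (avg_of_ad y (leqnn M) (af M)).
Qed.

Lemma integral_indic_mul g (A : set R) : measurable (A : set (measurableTypeR R)) ->
  \int[mu]_x (g x * \1_A x) = \int[mu]_(x in A) g x.
Proof.
move=> mA; rewrite [RHS]Rintegral_mkcond; apply: eq_Rintegral => x _.
by rewrite patchE indicE; case: ifP; rewrite ?mulr1 ?mulr0.
Qed.

Lemma integrable_indic_mul g (A : set R) : measurable (A : set (measurableTypeR R)) ->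
  mu.-integrable setT (EFin \o g) -> mu.-integrable setT (EFin \o (fun x => g x * \1_A x)).
Proof.
move=> mA ig.
rewrite (_ : EFin \o _ = (EFin \o g) \_ A); first by apply: (integrable_mkcond _ mA).1; exact: integrableS ig.
apply/funext => x /=; rewrite patchE indicE.
by case: ifP; rewrite ?mulr1 ?mulr0.
Qed.

Lemma haar_coefE g n x : mu.-integrable setT (EFin \o g) ->
  haar_coef mu g n (cidx n x) = Num.sqrt (@mI R T n x) *
    (avg g n.+1 (@lch R T n x) - avg g n.+1 (@rch R T n x)).
Proof.
move=> ig; rewrite /haar_coef /avg cidx_lch cidx_rch.
set k := cidx n x; set s := Num.sqrt (@mI R T n x).
set p := mass mu n.+1 k.*2; set q := mass mu n.+1 k.*2.+1.
have iZ c A : measurable (A : set (measurableTypeR R)) ->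
    mu.-integrable setT (EFin \o (fun x => c * (g x * \1_A x))).
  move=> mA; rewrite (_ : EFin \o _ = (fun x => (c%:E * (g x * \1_A x)%R%:E)%E)).
    by apply: integrableZl => //; exact: (integrable_indic_mul mA ig).
  by apply/funext => y /=; rewrite EFinM.
transitivity (\int[mu]_y ((s / p) * (g y * \1_(dyadic n.+1 k.*2) y) -
   (s / q) * (g y * \1_(dyadic n.+1 k.*2.+1) y))).
  by apply: eq_Rintegral => y _; rewrite /haar -/p -/q -[Num.sqrt (m_ _ _ _)]/s; ring.
rewrite RintegralB//; [|exact: iZ|exact: iZ].
rewrite !RintegralZl//; try exact: integrable_indic_mul.
by rewrite !integral_indic_mul//; ring.
Qed.

Lemma haarE n x : 0 <= x < 1 -> haar mu n (cidx n x) x = @hr R T n x.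
Proof.
move=> x01; rewrite /haar /hr; congr (_ * _).
have Dx := dyadic_cidx n.+1 x01.
have h := odd_double_half (cidx n.+1 x); rewrite cidx_half in h.
rewrite /= /wl /wr /= !indicE.
case: (boolP (odd (cidx n.+1 x))) h => _ /=; rewrite ?add1n ?add0n => h.
  rewrite -h in Dx; rewrite (mem_set Dx) memNset ?mul0r ?sub0r ?mul1r// => /dyadic_inj /(_ Dx) /eqP.
  by rewrite ltn_eqF.
rewrite -h in Dx; rewrite (mem_set Dx) memNset ?mul0r ?subr0 ?mul1r// => /dyadic_inj /(_ Dx) /eqP.
by rewrite gtn_eqF.
Qed.

Lemma haar_out n k x : (k < 2 ^ n)%N -> 0 <= x < 1 -> k != cidx n x -> haar mu n k x = 0.
Proof.
move=> kn x01 kx; rewrite /haar !indicE !memNset ?mul0r ?subr0 ?mulr0//.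
all: move=> Dx; have /dyadic_idx e : dyadic n k x by rewrite dyadic_split; (by left) || (by right).
all: by rewrite e ?eqxx in kx.
Qed.

Definition hilbert_term (v : R -> R) i x : R :=
  \sum_(j < 2 ^ i.+1) (if odd j then -1 else 1) * haar_coef mu v i j./2 * haar mu i.+1 j x.

Lemma hilbert_termE v i x : mu.-integrable setT (EFin \o v) -> 0 <= x < 1 ->
  hilbert_term v i x = @hs R T i (avg v i.+1) x.
Proof.
move=> iv x01; rewrite /hilbert_term (bigD1 (Ordinal (cidx_lt i.+1 x)))//= big1 ?addr0.
  by rewrite haarE// cidx_half haar_coefE// /hs /hq /sgn /=.
by move=> k kx; rewrite haar_out ?mulr0.
Qed.

Lemma hilbert_series v N x : mu.-integrable setT (EFin \o v) -> 0 <= x < 1 ->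
  series (hilbert_term v ^~ x) N = @Hs R T (avg v) N x.
Proof.
move=> iv x01; rewrite /series/= big_mkord; apply: eq_bigr => i _.
exact: hilbert_termE.
Qed.

End Averages.

(** * From the BMO norm to conditional variances on the tree *)

Section BmoTree.
Context {R : realType} (mu : probability (measurableTypeR R) R).
Hypothesis mu01 : mu `[0%R, 1%R[%classic = 1%E.
Hypothesis mu_pos : forall n k : nat, (k < 2 ^ n)%N -> (0 < mu (dyadic n k))%E.
Let T := dtree mu01 mu_pos.
Implicit Types (x y : R) (n k N : nat) (g h : R -> R).

Let mD n k : measurable (dyadic n k : set (measurableTypeR R)).
Proof. exact: measurable_dyadic. Qed.

Lemma m_increasing_tree : m_increasing mu ->
  exists2 C : R, 0 < C & forall n x, @mI R T n.+1 x <= C * @mI R T n x.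
Proof.
move=> [C C0 mC]; exists C => // n x.
have := mC n (cidx n.+1 x) (cidx_lt n.+1 x).
by rewrite cidx_half.
Qed.

Local Notation integ g := (mu.-integrable setT (EFin \o g)).

Lemma integ_cst c : integ (fun _ : R => c).
Proof.
exact: (@ad_integrable R mu mu01 mu_pos 0 (fun=> c)).
Qed.

Lemma integD g h : integ g -> integ h -> integ (fun x => g x + h x).
Proof.
move=> ig ih; rewrite (_ : EFin \o _ = ((EFin \o g) \+ (EFin \o h))%E).
  exact: integrableD.
by apply/funext.
Qed.

Lemma integB g h : integ g -> integ h -> integ (fun x => g x - h x).
Proof.
move=> ig ih; rewrite (_ : EFin \o _ = ((EFin \o g) \- (EFin \o h))%E).
  exact: integrableB.
by apply/funext.
Qed.

Lemma integ_norm g : integ g -> integ (fun x => `|g x|).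
Proof. exact: integrable_norm. Qed.

Lemma avgD g h n x : integ g -> integ h ->
  avg mu (fun z => g z + h z) n x = avg mu g n x + avg mu h n x.
Proof.
move=> ig ih; rewrite /avg RintegralD ?mulrDr//; exact: integrable_cell.
Qed.

Lemma avgB g h n x : integ g -> integ h ->
  avg mu (fun z => g z - h z) n x = avg mu g n x - avg mu h n x.
Proof.
move=> ig ih; rewrite /avg RintegralB ?mulrBr//; exact: integrable_cell.
Qed.

Lemma avg_cst c n x : avg mu (fun=> c) n x = c.
Proof. exact: (avg_cell_cst mu_pos). Qed.

Lemma le_avg g h n x : integ g -> integ h ->
  (forall z, 0 <= z < 1 -> cidx n z = cidx n x -> g z <= h z) ->
  avg mu g n x <= avg mu h n x.
Proof.
move=> ig ih gh; apply: ler_wpM2l; first by rewrite invr_ge0 ltW// (mass_cidx_gt0 mu_pos).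
apply: le_Rintegral => //; [exact: integrable_cell|exact: integrable_cell|].
move=> z Dz; apply: gh; first by apply: dyadic01 Dz; exact: cidx_lt.
by rewrite (dyadic_idx _ Dz)//; exact: cidx_lt.
Qed.

Lemma abs_avg g n x : integ g -> `|avg mu g n x| <= avg mu (fun z => `|g z|) n x.
Proof.
have m0 : 0 <= (mass mu n (cidx n x))^-1 by rewrite invr_ge0 ltW// (mass_cidx_gt0 mu_pos).
move=> ig; rewrite /avg normrM (ger0_norm m0); apply: ler_wpM2l => //.
by apply: le_normr_Rintegral => //; exact: integrable_cell.
Qed.

Definition pv (b : R -> R) n x : R := if n is n'.+1 then avg mu b n' x else 0.

Lemma prevE b n x : integ b -> 0 <= x < 1 -> Defs.prev (martingale_of mu b) n x = pv b n x.
Proof. by move=> ib x01; case: n => [//|n]; exact: cond_exp_avg. Qed.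

Lemma pv_cell b n x y : cidx n x = cidx n y -> pv b n x = pv b n y.
Proof.
case: n => [//|n] e; apply: (avg_ad (mu01 := mu01) (mu_pos := mu_pos)).
by rewrite /= -[LHS]cidx_half e cidx_half.
Qed.

(** An elementary substitute for Hoelder's inequality, turning L^p oscillation into L^1 oscillation
    at the price of an additive 1. *)
Lemma powR_ge_id (p t : R) : 1 <= p -> 0 <= t -> t <= 1 + t `^ p.
Proof.
move=> p1 t0; have [t1|t1] := leP t 1.
  by rewrite (le_trans t1)// lerDl powR_ge0.
rewrite (@le_trans _ _ (t `^ p))//; last by rewrite lerDr.
by rewrite -{1}(powRr1 t0) ler_powR// ltW.
Qed.

(** The conditional expectation in the norm is constant on a cell of positive mass, so a bound on
    its essential supremum holds at some point of the cell, hence on all of it. *)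
Lemma bmo_cell (p : R) (b : R -> R) n x : 1 <= p -> BMO mu p b ->
  (\int[mu]_(z in dyadic n (cidx n x)) (`|b z - pv b n x| `^ p)%:E <=
   (fine (BMO_norm mu p b `^ p) * mass mu n (cidx n x))%:E)%E.
Proof.
move=> p1 [/Lfun1_integrable ib bfin].
have p0 : 0 < p by exact: lt_le_trans p1.
pose F m := econd_exp mu m (fun x => (`|b x - Defs.prev (martingale_of mu b) m x| `^ p)%:E).
pose Q := (BMO_norm mu p b `^ p)%E.
have Q0 : (0 <= Q)%E by exact: poweR_ge0.
have Qfin : (Q < +oo)%E by exact: poweR_lty.
have FQ m : ('N[mu]_+oo[F m] <= Q)%E.
  have N0 : (0 <= 'N[mu]_+oo[F m])%E by exact: Lnorm_ge0.
  rewrite -[leLHS](poweRe1 N0) -(mulVf (lt0r_neq0 p0)) poweRrM.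
  apply: gt0_ler_poweR; first exact: ltW.
  - by rewrite in_itv/= leey poweR_ge0.
  - rewrite in_itv/= leey andbT; apply: le_trans (poweR_ge0 ('N[mu]_+oo[F m]) p^-1) _.
    by apply: ereal_sup_ubound; exists m.
  - by apply: ereal_sup_ubound; exists m.
pose q := fine Q.
have q0 : 0 <= q by exact: fine_ge0.
have qE : Q = q%:E by rewrite fineK// ge0_fin_numE.
pose k := cidx n x; have kn : (k < 2 ^ n)%N by exact: cidx_lt.
pose c := pv b n x.
have Fae : (\forall y \ae mu, (`|F n y| <= Q)%E).
  apply/ess_supP; move: (FQ n); rewrite unlock /Lnorm.
  have mu0 : (0 < mu setT)%E by rewrite probability_setT lte01.
  by rewrite ifT//; exact: mu0.
have [y [Dy Fy]] : exists y, dyadic n k y /\ (`|F n y| <= Q)%E.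
  apply: contrapT => nex; move: Fae => [N [mN N0 FN]].
  have : (mu (dyadic n k) <= mu N)%E.
    apply: le_measure; rewrite ?inE//.
    by move=> y Dy; apply: (FN y) => Fy; case: nex; exists y.
  by rewrite N0 leNgt mu_pos.
have y01 := dyadic01 kn Dy.
have FE : F n y = ((mass mu n k)^-1%:E *
    \int[mu]_(z in dyadic n k) (`|b z - c| `^ p)%:E)%E.
  rewrite /F /econd_exp (bigD1 (Ordinal kn))//= big1 ?adde0.
    rewrite indicE (mem_set Dy) mul1r.
    rewrite (integral_cell _ (h := fun z => (`|b z - c| `^ p)%:E))// => z Dz.
    rewrite (prevE n ib (dyadic01 kn Dz)) (@pv_cell b n z x)//.
    exact: (dyadic_idx kn Dz).
  move=> j jk; rewrite indicE memNset ?mul0r ?mul0e//= => Dj.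
  by move/eqP: jk; apply; apply/val_inj; exact: dyadic_inj Dj Dy.
have m0 : 0 < mass mu n k by exact: (mass_gt0 mu_pos).
have I0 : (0 <= \int[mu]_(z in dyadic n k) (`|b z - c| `^ p)%:E)%E.
  by apply: integral_ge0 => z _; rewrite lee_fin powR_ge0.
rewrite -/k -/c -/Q -/q; move: Fy.
rewrite qE FE gee0_abs; last by rewrite mule_ge0// lee_fin invr_ge0 ltW.
by rewrite muleC -lee_pdivlMr ?invr_gt0// invrK -EFinM.
Qed.

Lemma bmo_avg (p : R) (b : R -> R) : 1 <= p -> BMO mu p b ->
  exists2 kappa : R, 0 < kappa & forall n x, avg mu (fun z => `|b z - pv b n x|) n x <= kappa.
Proof.
move=> p1 bB; have [/Lfun1_integrable ib bfin] := bB.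
pose q := fine (BMO_norm mu p b `^ p).
have q0 : 0 <= q by apply: fine_ge0; exact: poweR_ge0.
exists (1 + q) => [|n x]; first by rewrite ltr_pwDl.
have Ip := bmo_cell n x p1 bB; rewrite -/q in Ip.
pose k := cidx n x; have kn : (k < 2 ^ n)%N by exact: cidx_lt.
pose c := pv b n x; rewrite -/k -/c in Ip.
have mb : measurable_fun [set: measurableTypeR R] (b : measurableTypeR R -> R).
  by apply/measurable_EFinP; exact: (measurable_int mu ib).
have mbc : measurable_fun [set: measurableTypeR R] (fun z : measurableTypeR R => `|b z - c|).
  by apply: measurableT_comp => //; exact: measurable_funB.
have mbp : measurable_fun [set: measurableTypeR R] (fun z : measurableTypeR R => `|b z - c| `^ p).
  exact: (measurableT_comp (measurable_powR _)).
have m0 : 0 < mass mu n k by exact: (mass_gt0 mu_pos).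
have ibc : integ (fun z => `|b z - c|) by apply: integ_norm; apply: integB => //; exact: integ_cst.
rewrite /avg -/k ler_pdivrMl//.
have icell := integrable_cell n k ibc.
rewrite -lee_fin /Rintegral fineK; last exact: integrable_fin_num.
apply: (@le_trans _ _ (\int[mu]_(z in dyadic n k) (1 + (`|b z - c| `^ p)%:E)))%E.
  apply: ge0_le_integral => //.
  - by apply: measurable_funTS; apply/measurable_EFinP.
  - apply: measurable_funTS; apply: emeasurable_funD => //.
    by apply/measurable_EFinP.
  - by move=> z _; rewrite -EFinD lee_fin powR_ge_id.
rewrite ge0_integralD//.
- rewrite integral_cst// mul1e.
  rewrite mulrDr mulr1 EFinD mass_fin (mulrC (mass _ _ _)); exact: leeD.
by apply: measurable_funTS; apply/measurable_EFinP.
Qed.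

(** John-Nirenberg with L c = E_n |b - c|. The 2 kappa comes from passing through [pv]: both |b -
    pv| and |pv - b_n| have mean at most kappa. Jumps are bounded by the oscillation one level
    further down. *)
Lemma bmo_bmo2 (p : R) (b : R -> R) : 1 <= p -> BMO mu p b ->
  exists B : R, @bmo2 R T (avg mu b) B.
Proof.
move=> p1 bB; have [kappa k0 bk] := bmo_avg p1 bB.
have ib : integ b by apply/Lfun1_integrable; case: bB.
have ibc c : integ (fun z => b z - c) by apply: integB => //; exact: integ_cst.
have dev c n x : `|avg mu b n x - c| <= avg mu (fun z => `|b z - c|) n x.
  rewrite -[X in _ - X](avg_cst c n x) -avgB//; last exact: integ_cst.
  exact: abs_avg.
exists (kappa + 50 * kappa ^+ 2).
apply: (@john_nirenberg R T _ _ (fun c => avg mu (fun z => `|b z - c|))).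
- exact: avg_mart.
- exact: k0.
- by move=> n x; apply: le_trans (dev _ _ _) _; exact: bk n.+1 x.
- by move=> c; apply: avg_mart; exact: integ_norm.
- exact: dev.
- move=> n x; set c := pv b n x.
  apply: (@le_trans _ _ (avg mu (fun z => `|b z - c| + `|c - avg mu b n x|) n x)).
    apply: le_avg; first exact: integ_norm.
      by apply: integD; [exact: integ_norm|exact: integ_cst].
    by move=> z _ _; have := ler_normD (b z - c) (c - avg mu b n x); rewrite addrA subrK.
  rewrite avgD ?avg_cst; [|exact: integ_norm|exact: integ_cst].
  have := bk n x; have := dev c n x; rewrite -/c distrC; lra.
Qed.

End BmoTree.

Section Commutator.
Context {R : realType} {D : tree R}.
Implicit Types (n N : nat) (x : D) (b f w : nat -> D -> R).

(** Off the diagonal, the increment of b f is b_n d f + f_n d b, whose conditional mean is 0. *)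
Lemma mart_mul_PiN b f : mart b -> mart f ->
  mart (fun n x => b n x * f n x - PiN b f n x).
Proof.
move=> mb mf; have [ab bE] := mb; have [af fE] := mf.
split=> [n x y e|n x].
  by rewrite (ab _ _ _ e) (af _ _ _ e) (PiN_ad mb mf e).
rewrite (E1_ext _ _ (Y := fun x => (b n x * f n x - PiN b f n x) +
    (b n x * incr f n x + f n x * incr b n x))); last first.
  by move=> y; rewrite /PiN big_ord_recr /incr /=; ring.
rewrite (E1D n (fun x => b n x * f n x - PiN b f n x)) (E1D n (fun x => b n x * incr f n x)).
rewrite (E1_pull _ _ (ab n)) (E1_pull _ _ (af n)).
rewrite (proj2 (mart_mdiff mf)) (proj2 (mart_mdiff mb)) !mulr0 !addr0.
by rewrite (E1_id (X := fun x => b n x * f n x - PiN b f n x))// => y z e;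
  rewrite (ab _ _ _ e) (af _ _ _ e) (PiN_ad mb mf e).
Qed.

Lemma cexp_mul b f n N x : mart b -> mart f -> (n <= N)%N ->
  cexp N n (fun y => b N y * f N y) x =
  b n x * f n x - PiN b f n x + cexp N n (PiN b f N) x.
Proof.
move=> mb mf nN; rewrite -(cexp_closed x (mart_mul_PiN mb mf) nN) -cexpD.
by apply: cexp_ext => y; rewrite subrK.
Qed.

(** Here [w] is the martingale of b f, with increment b_N d f + f_N d b + d Gf; [hs] is applied to
    it by [hs_pull], and the increment of b_{N+1} Hs f_N is subtracted. *)
Lemma cN_commutator b f w N x : mart b -> mart f ->
  (forall n y, Gf b f n y = PiN b f n y - b n y * f n y + w n y) ->
  cN b f N x = Hs w N x - b N.+1 x * Hs f N x.
Proof.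
move=> mb mf GE; have [ab _] := mb; have [af _] := mf.
elim: N => [|N ih].
  by rewrite /cN /Pc /Hs !psum0 mulr0 subr0 addr0.
have hE : hs N (w N.+1) x = b N x * hs N (f N.+1) x + f N x * hs N (b N.+1) x +
    hs N (Gf b f N.+1) x.
  have -> : hs N (Gf b f N.+1) x = hs N (fun y => w N.+1 y -
      ((b N y * f N y - PiN b f N y) + (b N y * incr f N y + f N y * incr b N y))) x.
    by apply: hs_ext => y; rewrite GE /PiN big_ord_recr /incr /=; ring.
  rewrite hsB hsD (hs0 (X := fun y => b N y * f N y - PiN b f N y)); last first.
    by move=> y z e; rewrite (ab _ _ _ e) (af _ _ _ e) (PiN_ad mb mf e).
  rewrite hsD (hs_pull _ _ (ab N)) (hs_pull _ _ (af N)) !hs_incr//; ring.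
rewrite cNS ih /Hs !psumS -/(Hs _) -/(Hs _) hE /incr; ring.
Qed.

Lemma mx_adS f n : (forall k, ad k.+1 (f k)) -> ad n.+1 (mx f n).
Proof.
move=> af; elim: n => [|n ih] x y e /=; first by rewrite (af 0%N _ _ e).
by rewrite (af n.+1 _ _ e) (ih x y)//; exact: idxW e.
Qed.

Lemma psum_adS (y : nat -> D -> R) n : (forall k, ad k.+2 (y k)) -> ad n.+1 (psum y n).
Proof.
move=> ay; elim: n => [|n ih] x z e; first by rewrite !psum0.
by rewrite !psumS (ay n _ _ e) (ih x z)//; exact: idxW e.
Qed.

Lemma cN_ad b f n : mart b -> mart f -> ad n.+1 (cN b f n).
Proof.
move=> mb mf; have [ab _] := mb; have [af _] := mf.
have [ib _] := mart_mdiff mb.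
move=> x y e; rewrite /cN (Hs_ad _ e); congr (_ + _).
apply: (psum_adS (n := n)) e => k z t e.
rewrite (hs_ad _ e) (hs_ad _ e) (ib _ _ _ e).
rewrite (ib k z t) ?(idxW _ e)// (af k z t) ?(idxW _ e)//; last exact: ltnW.
by rewrite (@Hs_ad _ _ f k z t)// (idxW _ e).
Qed.

Lemma markov_Ex (Y : D -> R) N lam : (forall x, 0 <= Y x) -> 0 < lam ->
  lam * Ex N (fun x => (lam < Y x)%R%:R) <= Ex N Y.
Proof.
move=> Y0 l0; rewrite -ExZ; apply: le_Ex => x.
by case: ltP => [/ltW|_]; rewrite ?mulr1 ?mulr0.
Qed.

Lemma stopped_dual b f M A : dual_le b f A -> dual_le b (stopped f M) A.
Proof.
move=> fA N; apply: le_trans (fA N); apply: le_Ex => x; apply: ler_sum => k _.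
rewrite incr_stopped ler_wpM2l//.
by case: ifP => _; rewrite ?normr0.
Qed.

End Commutator.

(** * Almost everywhere convergence *)

Section AlmostEverywhere.
Context {R : realType} (mu : probability (measurableTypeR R) R).
Hypothesis mu01 : mu `[0%R, 1%R[%classic = 1%E.
Hypothesis mu_pos : forall n k : nat, (k < 2 ^ n)%N -> (0 < mu (dyadic n k))%E.
Let T := dtree mu01 mu_pos.
Implicit Types (n N : nat).

Lemma mu_event n (P : R -> bool) : @ad R T n (fun x => (P x)%:R) ->
  measurable ([set x | P x] : set (measurableTypeR R)) /\
  mu [set x | P x] = (@Ex R T n (fun x => (P x)%:R))%:E.
Proof.
move=> aP; have mP := ad_measurable aP.
have mS : measurable ([set x | P x] : set (measurableTypeR R)).
  rewrite (_ : [set x | P x] = setT `&` ((fun x => (P x)%:R : R) @^-1` [set 1])).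
    exact: mP.
  rewrite setTI; apply/seteqP; split=> x /=; first by move=> ->.
  by case: (P x) => // /eqP; rewrite eq_sym oner_eq0.
split=> //; rewrite -(integral_ad aP).
have := @integral_indic _ _ _ mu setT measurableT _ mS; rewrite setIT => <-.
apply: eq_integral => x _; rewrite indicE; case: (boolP (P x)) => h.
  by rewrite mem_set.
by rewrite memNset//; apply/negP.
Qed.

Lemma mu_bigcup_le (A : (set R)^nat) (K : \bar R) :
  (forall N, measurable (A N : set (measurableTypeR R))) ->
  (forall N, A N `<=` A N.+1) ->
  (forall N, (mu (A N) <= K)%E) -> (mu (\bigcup_N A N) <= K)%E.
Proof.
move=> mA AS AK.
have mU : measurable (\bigcup_N A N : set (measurableTypeR R)) by exact: bigcup_measurable.
have nA : nondecreasing_seq A.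
  by apply/nondecreasing_seqP => n; apply/subsetPset; exact: AS.
have h := nondecreasing_cvg_mu (mu := mu) mA mU nA.
rewrite -(cvg_lim _ h)//; apply: lime_le; first by apply/cvg_ex; eexists; exact: h.
by apply: nearW => n; exact: AK.
Qed.

(** The events grow with N, so continuity from below carries a bound uniform in the level to the
    supremum. *)
Lemma mu_exceeds (Y : nat -> R -> R) lam K :
  (forall k, @ad R T k.+1 (Y k)) ->
  (forall N, @Ex R T N.+1 (fun x => (lam < @mx R T Y N x)%R%:R) <= K) ->
  measurable ([set x : R | exists N, lam < @mx R T Y N x] : set (measurableTypeR R)) /\
  (mu [set x | exists N, (lam < @mx R T Y N x)%R] <= K%:E)%E.
Proof.
move=> aY YK.
have aM N : @ad R T N.+1 (fun x => (lam < @mx R T Y N x)%R%:R).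
  by move=> x y e; rewrite (mx_adS aY e).
rewrite (_ : [set x | _] = \bigcup_N [set x | lam < @mx R T Y N x]); last first.
  by apply/seteqP; split=> x /= [N] => [h|_ h]; exists N.
split; first by apply: bigcup_measurable => N _; have [] := mu_event (aM N).
apply: mu_bigcup_le => [N|N x /= h|N]; first by have [] := mu_event (aM N).
  exact: lt_le_trans h (mx_mono (D := T) _ _ _).
by have [_ ->] := mu_event (aM N); rewrite lee_fin.
Qed.

Lemma negligible_small (A : set R) :
  (forall e : R, 0 < e -> exists B : set (measurableTypeR R),
    [/\ measurable B, (mu B <= e%:E)%E & A `<=` B]) -> mu.-negligible A.
Proof.
move=> h.
have /choice[B BP] : forall i : nat, exists B : set (measurableTypeR R),
    [/\ measurable B, (mu B <= (i.+1%:R^-1)%:E)%E & A `<=` B].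
  by move=> i; apply: h; rewrite invr_gt0.
exists (\bigcap_i B i); split.
- by apply: bigcapT_measurable => i; have [] := BP i.
- apply/eqP; rewrite eq_le measure_ge0 andbT; apply/lee_addgt0Pr => e e0.
  rewrite add0e; pose i := Num.truncn e^-1.
  apply: (@le_trans _ _ (mu (B i))).
    apply: le_measure; rewrite ?inE; last by apply: bigcap_inf.
      by apply: bigcapT_measurable => j; have [] := BP j.
    by have [] := BP i.
  have [_ Bi _] := BP i; apply: le_trans Bi _; rewrite lee_fin.
  rewrite -[leRHS]invrK lef_pV2 ?posrE ?invr_gt0//.
  exact/ltW/Num.Theory.truncnS_gt.
- by move=> x Ax i _; have [_ _] := BP i; apply.
Qed.

(* If [X] splits as [Y + Z] with [Z] convergent and the maximal function of [Y]
   small in probability, then the oscillation of [X] vanishes. *)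
Lemma ae_cvg_approx (X : nat -> R -> R) :
  (forall e lam : R, 0 < e -> 0 < lam -> exists Y Z : nat -> R -> R,
    [/\ forall n x, X n x = Y n x + Z n x,
        forall k, @ad R T k.+1 (Y k),
        {ae mu, forall x, cvgn (Z ^~ x)} &
        forall N, @Ex R T N.+1 (fun x => (lam < @mx R T Y N x)%R%:R) <= e]) ->
  {ae mu, forall x, cvgn (X ^~ x)}.
Proof.
move=> h.
pose bad (j : nat) := [set x : R | ~ exists M, forall n, (M <= n)%N ->
  `|X n x - X M x| <= j.+1%:R^-1].
have nb j : mu.-negligible (bad j).
  apply: negligible_small => e e0.
  have l0 : 0 < (4 * j.+1%:R)^-1 :> R by rewrite invr_gt0 mulr_gt0.
  have [Y [Z [XE aY [N0 [mN0 N00 cN0]] YN]]] := h e _ e0 l0.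
  have [mE muE] := mu_exceeds aY YN.
  exists (N0 `|` [set x | exists N, (4 * j.+1%:R)^-1 < @mx R T Y N x]); split.
  - exact: measurableU.
  - apply: le_trans (measureU2 _ mN0 mE) _.
    by rewrite [X in (X + _)%E](_ : _ = 0%E) ?add0e//; exact: N00.
  - move=> x badx; apply: contrapT => /not_orP[nN nE]; apply: badx.
    have : cvgn (Z ^~ x) by apply: contrapT => nZ; apply: nN; exact: cN0.
    move=> /cvg_ex[l /cvgrPdist_le/(_ (4 * j.+1%:R)^-1 l0)[M _ ZM]].
    exists M => n Mn.
    have YM k : `|Y k x| <= (4 * j.+1%:R)^-1.
      rewrite leNgt; apply/negP => lt; apply: nE; exists k.
      exact: lt_le_trans lt (mx_ge (D := T) Y x (leqnn k)).
    have Zn := ZM n Mn; have Zm := ZM M (leqnn M); rewrite /= in Zn Zm.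
    have -> : j.+1%:R^-1 = 4 * (4 * j.+1%:R)^-1 :> R by field.
    have -> : X n x - X M x = (Y n x - Y M x) +
      ((l - Z M x) - (l - Z n x)) by rewrite !XE; ring.
    apply: le_trans (ler_normD _ _) _.
    apply: le_trans (lerD (ler_normB _ _) (ler_normB _ _)) _.
    move: (YM n) (YM M) Zn Zm; set c := (4 * _)^-1; lra.
have : mu.-negligible (\bigcup_j bad j) by exact: negligible_bigcup.
apply: negligibleS => x /= ncv; apply: contrapT => nbad; apply: ncv.
apply/cauchy_cvgP/cauchy_exP => e e0.
have {}nbad j : exists M, forall n, (M <= n)%N -> `|X n x - X M x| <= j.+1%:R^-1.
  by apply: contrapT => h'; apply: nbad; exists j.
have [M XM] := nbad (Num.truncn e^-1).
exists (X M x); exists M => // n /= Mn; rewrite /ball/= distrC.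
apply: le_lt_trans (XM n Mn) _; rewrite -[ltRHS]invrK ltf_pV2 ?posrE ?invr_gt0//.
exact: Num.Theory.truncnS_gt.
Qed.

(** Beyond [M] the L^2 tail is small, so by Doob and Markov its maximal function is small in
    probability; the other part is eventually constant. *)
Lemma ae_cvg_mdiff2 (y : nat -> R -> R) c : @mdiff2 R T y ->
  (forall N, @Ex R T N.+1 (fun x => \sum_(k < N) y k x ^+ 2) <= c) ->
  {ae mu, forall x, cvgn (@psum R T y ^~ x)}.
Proof.
move=> my yc; apply: ae_cvg_approx => e lam e0 l0.
have el0 : 0 < e * lam ^+ 2 by rewrite mulr_gt0 ?exprn_gt0.
have [M MN] := mdiff2_tail my yc el0.
pose Y := @psum R T (fun k x => if (M <= k)%N then y k x else 0).
exists Y, (fun n x => @psum R T y n x - Y n x); split.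
- by move=> n x; rewrite addrC subrK.
- move=> k; apply: psum_adS => j x z xz.
  by case: (M <= j)%N => //; have [ay _] := my; rewrite (ay _ _ _ xz).
- apply: (nearW (F := almost_everywhere mu)) => x; apply/cvg_ex; exists (@psum R T y M x).
  apply: cvg_near_cst; exists M => // n /= /subnK <-.
  elim: (n - M)%N => [|d ih].
    rewrite add0n (_ : Y M x = 0) ?subr0//.
    by rewrite /Y /psum big1// => k _; rewrite leqNgt ltn_ord.
  by rewrite addSn /Y !psumS leq_addl -ih /Y; ring.
- move=> N; have l20 : 0 < lam ^+ 2 by rewrite exprn_gt0.
  rewrite -(ler_pM2l l20) [leRHS]mulrC; apply: le_trans (MN N).
  have := @markov_Ex R T (fun x => @mx R T Y N x ^+ 2) N.+1 _ (fun x => sqr_ge0 _) l20.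
  apply: le_trans; rewrite ler_pM2l//; apply: le_Ex => x.
  by rewrite ltr_sqr ?nnegrE ?mx_ge0// ltW.
Qed.

End AlmostEverywhere.

Lemma cvg_EFin_seq {R : realType} (u : nat -> R) (l : R) : u @ \oo --> l ->
  (fun N => (u N)%:E) @ \oo --> l%:E.
Proof. by move=> ul; apply: cvg_EFin => //; exact: nearW. Qed.

Section Limits.
Context {R : realType} (mu : probability (measurableTypeR R) R).
Implicit Types (h : nat -> measurableTypeR R -> R) (g : measurableTypeR R -> R).

Lemma fatou_le h g (K : \bar R) : (forall N, measurable_fun setT (h N)) ->
  (forall N x, 0 <= h N x) -> measurable_fun setT g ->
  {ae mu, forall x, h ^~ x @ \oo --> g x} ->
  (forall N, (\int[mu]_x (h N x)%:E <= K)%E) -> (\int[mu]_x (g x)%:E <= K)%E.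
Proof.
move=> mh h0 mg hg hK.
have mhE N : measurable_fun setT (EFin \o h N) by apply/measurable_EFinP.
have mgE : measurable_fun setT (EFin \o g) by apply/measurable_EFinP.
have -> : (\int[mu]_x (g x)%:E = \int[mu]_x limn_einf (fun N => (h N x)%:E))%E.
  apply: ae_eq_integral => //.
    under eq_fun do rewrite -[limn_einf _]oppeK -limn_esupN.
    apply: measurableT_comp => //; apply: measurable_fun_limn_esup => N.
    by apply: measurableT_comp => //; apply: mhE.
  apply: filterS hg => x /= hx _.
  have c := cvg_EFin_seq hx; rewrite is_cvg_limn_einfE; first exact/esym/cvg_lim.
  by apply/cvg_ex; exists (g x)%:E.
apply: le_trans (fatou _ _ _ _) _ => // [N x _|]; first by rewrite lee_fin.
rewrite limn_einf_lim; apply: lime_le; first exact: is_cvg_einfs.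
apply: nearW => n; apply: le_trans (hK n).
by apply: ereal_inf_lbound; exists n => //=.
Qed.

Lemma ae_lim_fun h : (forall N, measurable_fun setT (h N)) ->
  {ae mu, forall x, cvgn (h ^~ x)} ->
  exists2 g : measurableTypeR R -> R, measurable_fun setT g & {ae mu, forall x, h ^~ x @ \oo --> g x}.
Proof.
move=> mh hc; exists (fun x => fine (limn_esup (fun N => (h N x)%:E))).
  apply: measurableT_comp => //; apply: measurable_fun_limn_esup => N.
  exact/measurable_EFinP.
apply: filterS hc => x /= hx.
have /cvg_EFin_seq c : h ^~ x @ \oo --> limn (h ^~ x) by [].
rewrite is_cvg_limn_esupE; last by apply/cvg_ex; eexists; exact: c.
by rewrite (cvg_lim _ c).
Qed.

End Limits.

(** * Dyadic intervals determine an integrable function *)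

Section DyadicUniqueness.
Context {R : realType} (mu : probability (measurableTypeR R) R).
Hypothesis mu01 : mu `[0%R, 1%R[%classic = 1%E.
Hypothesis mu_pos : forall n k : nat, (k < 2 ^ n)%N -> (0 < mu (dyadic n k))%E.
Variable g : R -> R.
Local Notation integ g := (mu.-integrable setT (EFin \o g)).
Hypotheses (ig : integ g)
  (g0 : forall n k, (k < 2 ^ n)%N -> (\int[mu]_(x in dyadic n k) (g x)%:E = 0)%E).

Let igA (A : set (measurableTypeR R)) : measurable A -> mu.-integrable A (EFin \o g).
Proof. by move=> mA; exact: integrableS ig. Qed.

(** Cells to the left of the one containing [a] lie in the ray and contribute 0; those to the right
    miss it. *)
Let integral_ray_cell (a : R) n : 0 < a < 1 ->
  (\int[mu]_(x in `]-oo, a[) (g x)%:E =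
   \int[mu]_(x in `]-oo, a[ `&` dyadic n (cidx n a)) (g x)%:E)%E.
Proof.
move=> /andP[a0 a1]; have a01 : 0 <= a < 1 by rewrite ltW.
rewrite (integral_dyadic n mu01 (measurable_itv _) ig).
rewrite (bigD1 (Ordinal (cidx_lt n a)))//= big1 ?adde0// => k ka.
have Da := dyadic_cidx n a01; rewrite dyadicE in Da.
have p2 : 0 < 2 ^+ n :> R by rewrite exprn_gt0.
have [lt|gt|e] := ltngtP k (cidx n a); last by move/eqP: ka; case; apply/val_inj.
- rewrite (_ : _ `&` _ = dyadic n k) ?g0//; apply/setIidPr => x.
  rewrite dyadicE => /andP[_ xk] /=; rewrite in_itv/= -(ltr_pM2r p2).
  case/andP: Da => ka' _; apply: lt_le_trans xk (le_trans _ ka').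
  by rewrite ler_nat.
- rewrite (_ : _ `&` _ = set0) ?integral_set0//; apply/seteqP; split=> // x [/=].
  rewrite dyadicE in_itv/= => xa /andP[kx _].
  case/andP: Da => _; rewrite ltNge => /negP; apply.
  apply: (@le_trans _ _ (x * 2 ^+ n)); last by rewrite ler_pM2r// ltW.
  by apply: le_trans kx; rewrite ler_nat.
Qed.

(** Each point below [a] eventually leaves the cells around [a], so dominated convergence sends the
    remaining integral to 0. *)
Let integral_ray (a : R) : (\int[mu]_(x in `]-oo, a[) (g x)%:E = 0)%E.
Proof.
have [a0|a0] := leP a 0.
  rewrite (integral_dyadic 0 mu01 (measurable_itv _) ig) big1// => k _.
  rewrite (_ : _ `&` _ = set0) ?integral_set0//; apply/seteqP; split=> // x [/=].
  move=> + /(dyadic01 (ltn_ord k))/andP[x0 _]; rewrite in_itv/= => xa.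
  by have := lt_le_trans xa (le_trans a0 x0); rewrite ltxx.
have [a1|a1] := leP 1 a.
  rewrite (integral_dyadic 0 mu01 (measurable_itv _) ig) big1// => k _.
  rewrite (_ : _ `&` _ = dyadic 0 k) ?g0//; apply/setIidPr => x.
  by move=> /(dyadic01 (ltn_ord k))/andP[_ x1] /=; rewrite in_itv/= (lt_le_trans x1).
have a01 : 0 < a < 1 by rewrite a0.
pose A n : set (measurableTypeR R) := `]-oo, a[ `&` dyadic n (cidx n a).
have mA n : measurable (A n) by apply: measurableI; [exact: measurable_itv|exact: measurable_dyadic].
have mg : measurable_fun setT (EFin \o g) by exact: measurable_int ig.
pose F n (x : measurableTypeR R) := ((EFin \o g) \_ (A n)) x.
have FE n : (\int[mu]_x F n x = \int[mu]_(x in `]-oo, a[) (g x)%:E)%E.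
  by rewrite (integral_ray_cell n a01) -integral_mkcond.
have [|||||_ _] := @dominated_convergence _ _ _ mu setT measurableT F (cst 0%E) (abse \o (EFin \o g)).
- by move=> n; apply: ((measurable_restrictT (EFin \o g) (mA n)).1); exact: measurable_funTS.
- exact: measurable_cst.
- apply: (nearW (F := almost_everywhere mu)) => x _; apply: cvg_near_cst.
  have [xa|ax] := ltP x a; last first.
    apply: nearW => n; rewrite /F patchE memNset// => -[/=].
    by rewrite in_itv/= ltNge ax.
  have ax0 : 0 < a - x by rewrite subr_gt0.
  exists (Num.truncn (a - x)^-1) => // n /= nM.
  rewrite /F patchE memNset// => -[_]; rewrite dyadicE => /andP[kx _].
  have : (dyadic n (cidx n a) : set R) a by apply: dyadic_cidx; rewrite ltW.
  rewrite dyadicE => /andP[_ ak].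
  have h1 : (a - x)^-1 < n.+1%:R.
    by apply: lt_le_trans (Num.Theory.truncnS_gt _) _; rewrite ler_nat.
  have h2 : n.+1%:R <= 2 ^+ n :> R by rewrite -natrX ler_nat ltn_expl.
  have h3 : 1 < (a - x) * 2 ^+ n.
    by rewrite -ltr_pdivrMl// mulr1 (lt_le_trans h1).
  by move: ak; rewrite -addn1 natrD; lra.
- exact: integrable_abse.
- apply: (nearW (F := almost_everywhere mu)) => x n _; rewrite /F patchE.
  by case: ifP => // _; rewrite (_ : point = 0%E)// abse0 abse_ge0.
under eq_fun do rewrite FE.
rewrite integral0 => h; symmetry; apply: cvg_unique h _ => //.
exact: cvg_cst.
Qed.

(** The rays form a pi-system generating the Borel sets, so all integrals of [g] vanish. *)
Lemma ae_eq0_dyadic : {ae mu, forall x, g x = 0}.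
Proof.
have gA (A : set (measurableTypeR R)) : measurable A -> (\int[mu]_(x in A) (g x)%:E = 0)%E.
  move=> mA; have mE := RGenInftyO.measurableE R.
  apply: (@dynkin_induction _ (measurableTypeR R) (@RGenInftyO.G R)
    (fun A => (\int[mu]_(x in A) (g x)%:E = 0)%E)) => //.
  - move=> _ _ [x ->] [y ->]; exists (Num.min x y).
    by apply/seteqP; split=> z /=; rewrite !in_itv/= lt_min; move/andP.
  - rewrite (integral_dyadic 0 mu01 measurableT ig) big1// => k _.
    by rewrite setTI g0.
  - by move=> _ [x ->]; exact: integral_ray.
  - move=> S mS S0.
    have mT : measurable_fun (S `|` ~` S) (g : measurableTypeR R -> R).
      by apply: measurable_funTS; apply/measurable_EFinP; exact: measurable_int ig.
    have := integral_setU_EFin mu mS (measurableC mS) mT.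
    rewrite S0 add0e => <-; last by apply/disj_setPS; rewrite setICr.
    rewrite setUv (integral_dyadic 0 mu01 measurableT ig) big1// => k _.
    by rewrite setTI g0.
  - move=> F mF tF F0; rewrite integral_bigcup//; last exact/igA/bigcup_measurable.
    by apply: eseries0 => i _ _; rewrite F0.
  - exact: (eq_ind _ (fun F : set (set R) => F A) mA _ mE).
have : ae_eq mu setT (EFin \o g) (cst 0%E).
  apply: integral_ae_eq => // E _ mE; rewrite integral0; exact: gA.
by apply: filterS => x /= /(_ I) [].
Qed.

End DyadicUniqueness.

Section MartTail.
Context {R : realType} {D : tree R}.
Implicit Types (f : nat -> D -> R) (M N : nat).

Definition late M f k (x : D) : R := if (M <= k)%N then incr f k x else 0.

Lemma psum_late f M N x : (M <= N)%N -> psum (late M f) N x = f N x - f M x.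
Proof.
move=> /subnK <-; elim: (N - M)%N => [|d ih].
  by rewrite add0n subrr /psum big1// => k _; rewrite /late leqNgt ltn_ord.
by rewrite addSn psumS ih /late leq_addl /incr; ring.
Qed.

Lemma late_mdiff f M : mart f -> mdiff (late M f).
Proof.
move=> /mart_mdiff[ai iE]; rewrite /late; split=> [n x y e|n x].
  by case: (M <= n)%N => //; exact: ai.
by case: (M <= n)%N => //; exact: E1_cst.
Qed.

Lemma mart_tail f c e : mart f ->
  (forall N, Ex N (fun x => \sum_(k < N) incr f k x ^+ 2) <= c) -> 0 < e ->
  exists M, forall M' N, (M <= M')%N ->
    Ex N (fun x => \sum_(k < N) late M' f k x ^+ 2) <= e.
Proof.
move=> mf fc e0; have [ai _] := mart_mdiff mf.
pose p k := Ex k.+1 (fun x => incr f k x ^+ 2).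
have p0 k : 0 <= p k by apply: Ex_ge0 => x; exact: sqr_ge0.
have pE k N : (k < N)%N -> Ex N (fun x => incr f k x ^+ 2) = p k.
  by move=> kN; rewrite (@Ex_ad _ _ k.+1)// => x z xz; rewrite (ai _ _ _ xz).
have pc N : \sum_(k < N) p k <= c.
  apply: le_trans (fc N); rewrite (Ex_sum N N (fun k x => incr f k x ^+ 2)).
  by apply: ler_sum => k _; rewrite pE.
have [M MN] := bounded_series_tail p0 pc e0; exists M => M' N MM'.
apply: le_trans (MN N); rewrite (Ex_sum N N (fun k x => late M' f k x ^+ 2)).
have h k : (k < N)%N -> Ex N (fun x => late M' f k x ^+ 2) <= if (M <= k)%N then p k else 0.
  move=> kN; rewrite /late; case: (leqP M' k) => [M'k|kM'].
    by rewrite (leq_trans MM' M'k) pE.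
  rewrite (Ex_ext _ (Y := fun=> 0)) ?Ex_cst; first by case: ifP.
  by move=> x; rewrite expr0n.
apply: (@le_trans _ _ (\sum_(k < N) (if (M <= k)%N then p k else 0))).
  by apply: ler_sum => k _; exact: h.
rewrite -(big_mkord xpredT (fun k => if (M <= k)%N then p k else 0)).
have [NM|MN'] := leqP N M.
  rewrite [leRHS]big_geq//; rewrite big_nat_cond big1// => k /andP[/andP[_ kN] _].
  by rewrite leqNgt (leq_trans kN NM).
rewrite (big_cat_nat (n := M)) ?(ltnW MN')//= -[leRHS]add0r lerD//.
  rewrite big_nat_cond big1// => k /andP[/andP[_ kN] _].
  by rewrite leqNgt kN.
by apply: ler_sum_nat => k /andP[Mk _]; rewrite Mk.
Qed.

Lemma mart_tail_sqr f M N : mart f -> (M <= N)%N ->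
  Ex N (fun x => (f N x - f M x) ^+ 2) = Ex N (fun x => \sum_(k < N) late M f k x ^+ 2).
Proof.
move=> mf MN; rewrite -(orthogonality (late_mdiff M mf) (leqnn N)).
by apply: Ex_ext => x; rewrite psum_late.
Qed.

End MartTail.

Section AeImp.
Context {R : realType} (mu : probability (measurableTypeR R) R).
Implicit Types P Q S : R -> Prop.

(* [filterS] does not find the filter instance for predicates typed on [R]
   rather than on [measurableTypeR R]. *)
Lemma ae_imp P Q : (forall x, P x -> Q x) ->
  {ae mu, forall x, P x} -> {ae mu, forall x, Q x}.
Proof. by move=> PQ; apply: (@filterS (measurableTypeR R) _ _ P Q). Qed.

Lemma ae_imp2 P Q S : (forall x, P x -> Q x -> S x) ->
  {ae mu, forall x, P x} -> {ae mu, forall x, Q x} -> {ae mu, forall x, S x}.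
Proof. by move=> PQ; apply: (@filterS2 (measurableTypeR R) _ _ P Q S). Qed.

End AeImp.

(** * Square integrability and convergence of averages *)

Section L2.
Context {R : realType} (mu : probability (measurableTypeR R) R).
Hypothesis mu01 : mu `[0%R, 1%R[%classic = 1%E.
Hypothesis mu_pos : forall n k : nat, (k < 2 ^ n)%N -> (0 < mu (dyadic n k))%E.
Let T := dtree mu01 mu_pos.
Implicit Types (x y : R) (n k N M : nat) (g h u : R -> R).
Local Notation integ g := (mu.-integrable setT (EFin \o g)).

Lemma integZ c g : integ g -> integ (fun x => c * g x).
Proof. exact: (@integrableZl _ _ _ mu setT measurableT c (EFin \o g)). Qed.

Lemma avg_integ g n : integ (avg mu g n).
Proof. exact: (ad_integrable (avg_ad (mu01 := mu01) (mu_pos := mu_pos) g (n := n))). Qed.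

Lemma avg_avg g n M x : integ g -> (n <= M)%N ->
  avg mu (avg mu g M) n x = avg mu g n x.
Proof.
move=> ig nM; have mA := avg_mart mu01 mu_pos (avg_integ g M).
rewrite -(cexp_closed (D := T) x mA nM) -(cexp_closed (D := T) x (avg_mart mu01 mu_pos ig) nM).
apply: (cexp_ext (D := T)) => y.
exact: (avg_of_ad y (leqnn M) (avg_ad (mu01 := mu01) (mu_pos := mu_pos) g (n := M))).
Qed.

Lemma avg_pull c g n x : integ g ->
  (forall y, 0 <= y < 1 -> cidx n y = cidx n x -> c y = c x) ->
  avg mu (fun y => c y * g y) n x = c x * avg mu g n x.
Proof.
move=> ig cc; rewrite /avg mulrCA; congr (_ * _).
rewrite -RintegralZl//; last 2 first.
- exact: measurable_dyadic.
- exact: integrable_cell.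
apply: eq_Rintegral => y; rewrite inE => Dy; congr (_ * _); apply: cc.
  by apply: dyadic01 Dy; exact: cidx_lt.
by rewrite (dyadic_idx _ Dy)//; exact: cidx_lt.
Qed.

Lemma Ex_avg g N : integ g -> @Ex R T N (avg mu g N) = \int[mu]_x g x.
Proof.
move=> ig; rewrite /Rintegral (integral_dyadic N mu01 measurableT ig).
rewrite (eq_bigr (fun k : 'I__ => (\int[mu]_(x in dyadic N k) g x)%:E)); last first.
  move=> k _; rewrite setTI /Rintegral fineK// integrable_fin_num//; first exact: measurable_dyadic.
  exact: integrable_cell.
rewrite sumEFin /=; apply: eq_bigr => k _; rewrite /avg /= cidx_crep// mulVKf//.
by rewrite gt_eqF// (mass_gt0 mu_pos).
Qed.

Lemma avg_le_integral g n x : integ g -> (forall y, 0 <= g y) ->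
  avg mu g n x <= (mass mu n (cidx n x))^-1 * \int[mu]_y g y.
Proof.
move=> ig g0; apply: ler_wpM2l; first by rewrite invr_ge0 ltW// (mass_cidx_gt0 mu_pos).
rewrite /Rintegral; apply: fine_le.
- apply: integrable_fin_num; first exact: measurable_dyadic.
  exact: integrable_cell.
- exact: integrable_fin_num.
- apply: ge0_subset_integral => //; first exact: measurable_dyadic.
    exact: measurable_int ig.
  by move=> y _; rewrite lee_fin.
Qed.

(** Jensen's inequality from (u - c)^2 >= 0, c being the average. *)
Lemma avg_sqr u n x : integ u -> integ (fun y => u y ^+ 2) ->
  avg mu u n x ^+ 2 <= avg mu (fun y => u y ^+ 2) n x.
Proof.
move=> iu iu2; set c := avg mu u n x.
have ic : integ (fun _ : R => c) by exact: integ_cst mu01 mu_pos c.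
have h : 2 * c * c - c ^+ 2 <= avg mu (fun y => u y ^+ 2) n x; last by apply: le_trans h; lra.
have e : avg mu (fun y => 2 * c * u y - c ^+ 2) n x = 2 * c * c - c ^+ 2.
  rewrite avgB ?(avg_cst mu_pos); [|exact: integZ|exact: integ_cst mu01 mu_pos _].
  by rewrite (avg_pull (c := fun=> 2 * c)).
rewrite -e; apply: le_avg => //.
  by apply: integB; [exact: integZ|exact: integ_cst mu01 mu_pos _].
by move=> z _ _; have := sqr_ge0 (u z - c); lra.
Qed.

Lemma avg_L2 u N : integ u -> integ (fun y => u y ^+ 2) ->
  @Ex R T N (fun x => avg mu u N x ^+ 2) <= \int[mu]_x (u x ^+ 2).
Proof.
move=> iu iu2; rewrite -(Ex_avg N iu2); apply: le_Ex => x; exact: avg_sqr.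
Qed.

Lemma incr_avg_L2 u N : integ u -> integ (fun y => u y ^+ 2) ->
  @Ex R T N (fun x => \sum_(k < N) @incr R T (avg mu u) k x ^+ 2) <= 4 * \int[mu]_x (u x ^+ 2).
Proof.
move=> iu iu2; have mu_ := avg_mart mu01 mu_pos iu.
rewrite -(orthogonality (mart_mdiff mu_) (leqnn N)).
apply: (@le_trans _ _ (@Ex R T N (fun x => 2 * avg mu u N x ^+ 2 + 2 * avg mu u 0 x ^+ 2))).
  apply: le_Ex => x; rewrite psum_incr; have := sqr_ge0 (avg mu u N x + avg mu u 0 x); lra.
rewrite ExD !ExZ; have h := avg_L2 N iu iu2.
have : @Ex R T N (fun x => avg mu u 0 x ^+ 2) <= \int[mu]_x (u x ^+ 2).
  have a0 : @ad R T 0 (fun x => avg mu u 0 x ^+ 2).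
    by move=> x y e; rewrite (avg_ad (mu01 := mu01) (mu_pos := mu_pos) u e).
  by rewrite (Ex_ad (leq0n N) a0); exact: avg_L2.
by lra.
Qed.

Lemma integ_le h g : measurable_fun [set: measurableTypeR R] (h : measurableTypeR R -> R) ->
  (forall x, `|h x| <= g x) -> integ g -> integ h.
Proof.
move=> mh hg ig; apply: le_integrable ig => //; first exact/measurable_EFinP.
by move=> x _ /=; rewrite lee_fin (le_trans (hg x))// ler_norm.
Qed.

Lemma integ_sqr h c : measurable_fun [set: measurableTypeR R] (h : measurableTypeR R -> R) ->
  (\int[mu]_x (h x ^+ 2)%:E <= c%:E)%E -> integ (fun x => h x ^+ 2) /\ integ h.
Proof.
move=> mh hc; have i2 : integ (fun x => h x ^+ 2).
  apply/integrableP; split; first by apply/measurable_EFinP; exact: measurable_funX.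
  under eq_integral do rewrite /= ger0_norm ?sqr_ge0//.
  by apply: le_lt_trans hc _; rewrite ltry.
split=> //; apply: (integ_le (g := fun x => 1 + h x ^+ 2)) => //.
  move=> x; rewrite -real_normK ?num_real//; have := sqr_ge0 (`|h x| - 1).
  by have := normr_ge0 (h x); nra.
by apply: integD => //; exact: integ_cst.
Qed.

Section BmoLimit.
Variables (b : R -> R) (B : R).
Hypotheses (ib : integ b) (bB : @bmo2 R T (avg mu b) B).
Let mb : @mart R T (avg mu b). Proof. by case: bB. Qed.
Let mavg N : measurable_fun [set: measurableTypeR R] (avg mu b N : measurableTypeR R -> R).
Proof. exact: (ad_measurable (avg_ad (mu01 := mu01) (mu_pos := mu_pos) b (n := N))). Qed.

Let ae_cvg_avg : {ae mu, forall x, cvgn (avg mu b ^~ x)}.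
Proof.
have [ai iE] := mart_mdiff mb.
have y2 : @mdiff2 R T (fun k x => @incr R T (avg mu b) k.+1 x).
  by split=> [n|n x]; [exact: ai|exact: iE].
have h := ae_cvg_mdiff2 y2 (bmo2_incr_L2 bB).
apply: ae_imp h => x cx.
have e N : avg mu b N.+1 x = @psum R T (fun k x => @incr R T (avg mu b) k.+1 x) N x + avg mu b 1 x.
  elim: N => [|N ih]; first by rewrite psum0 add0r.
  by rewrite psumS addrAC -ih /incr addrC subrK.
have /cvg_ex[l hl] : cvgn (fun N => avg mu b N.+1 x).
  by under eq_fun do rewrite e; apply: is_cvgD => //; exact: is_cvg_cst.
by apply/cvg_ex; exists l; rewrite -(cvg_shiftS (avg mu b ^~ x)).
Qed.

Let tail e : 0 < e -> exists M, forall M' N, (M <= M')%N -> (M' <= N)%N ->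
  @Ex R T N (fun x => (avg mu b N x - avg mu b M' x) ^+ 2) <= e.
Proof.
move=> e0; have w1 : weight (fun (_ : nat) (_ : T) => 1 : R) by [].
have L2 N : @Ex R T N (fun x => \sum_(k < N) @incr R T (avg mu b) k x ^+ 2) <= B.
  have := bmo2_weight N bB w1; rewrite Ex_cst mulr1; apply: le_trans; rewrite le_eqVlt.
  by apply/orP; left; apply/eqP/Ex_ext => x; apply: eq_bigr => k _; rewrite mul1r.
have [M MN] := mart_tail mb L2 e0; exists M => M' N MM' M'N.
by rewrite (mart_tail_sqr mb M'N); exact: MN.
Qed.

Let limit : exists g, [/\ measurable_fun [set: measurableTypeR R] (g : measurableTypeR R -> R),
  {ae mu, forall x, avg mu b ^~ x @ \oo --> g x} &
  forall e, 0 < e -> exists M, forall M', (M <= M')%N ->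
    (\int[mu]_x ((g x - avg mu b M' x) ^+ 2)%:E <= e%:E)%E].
Proof.
have [g mg cg] := ae_lim_fun mavg ae_cvg_avg; exists g; split=> // e e0.
have [M MN] := tail e0; exists M => M' MM'.
apply: (fatou_le (h := fun N x => (avg mu b (N + M') x - avg mu b M' x) ^+ 2)).
- by move=> N; apply: measurable_funX; exact: measurable_funB.
- by move=> N x; exact: sqr_ge0.
- by apply: measurable_funX; exact: measurable_funB.
- apply: ae_imp cg => x cx.
  have c1 : (fun N => avg mu b (N + M') x - avg mu b M' x) @ \oo --> g x - avg mu b M' x.
    by apply: cvgB; [rewrite (cvg_shiftn M' (avg mu b ^~ x))|exact: cvg_cst].
  by under eq_fun do rewrite expr2; rewrite expr2; exact: cvgM.
move=> N; rewrite (integral_ad (mu01 := mu01) (mu_pos := mu_pos) (n := (N + M')%N)); last first.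
  move=> x y xy; rewrite (avg_ad (mu01 := mu01) (mu_pos := mu_pos) b xy).
  by rewrite (avg_ad (mu01 := mu01) (mu_pos := mu_pos) b (idxW (leq_addl N M') xy)).
by rewrite lee_fin; apply: MN => //; exact: leq_addl.
Qed.

Lemma avg_ae_L2 : {ae mu, forall x, avg mu b ^~ x @ \oo --> b x} /\
  integ (fun x => b x ^+ 2) /\
  forall e, 0 < e -> exists M, forall M', (M <= M')%N ->
    (\int[mu]_x ((b x - avg mu b M' x) ^+ 2)%:E <= e%:E)%E.
Proof.
have [g [mg cg g2]] := limit.
have mgM M : measurable_fun [set: measurableTypeR R] ((fun x => g x - avg mu b M x) : measurableTypeR R -> R).
  exact: measurable_funB.
have [M1 /(_ M1 (leqnn _)) h1] := g2 1 ltr01.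
have [iM2 iM] := integ_sqr (mgM M1) h1.
have ig : integ g.
  have := integD iM (avg_integ b M1); apply: eq_integrable => // x _ /=.
  by rewrite subrK.
have e n x : avg mu g n x = avg mu b n x.
  apply/eqP; rewrite -subr_eq0 -normr_le0; apply/ler_addgt0Pr => s s0.
  pose s2 := s / 2; have s20 : 0 < s2 by rewrite divr_gt0.
  pose m := mass mu n (cidx n x); have m0 : 0 < m by exact: (mass_cidx_gt0 mu_pos).
  have [M MM] := g2 (s2 ^+ 2 * m) (mulr_gt0 (exprn_gt0 2 s20) m0).
  pose N := maxn M n; have := MM N (leq_maxl _ _) => hN.
  have [iN2 iN] := integ_sqr (mgM N) hN.
  rewrite -(avg_avg x ib (leq_maxr M n)) -(avgB _ _ ig (avg_integ b _)) add0r.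
  apply: le_trans (abs_avg mu_pos n x iN) _.
  have iR : integ (fun z => s2 + s2^-1 * (g z - avg mu b N z) ^+ 2).
    by apply: integD; [exact: integ_cst|exact: integZ].
  (* |t| <= s2 + t^2 / s2 brings in the L^2 bound; the tolerance s2^2 m was chosen to cancel the
     mass m of the cell. *)
  apply: (@le_trans _ _ (avg mu (fun z => s2 + s2^-1 * (g z - avg mu b N z) ^+ 2) n x)).
    apply: le_avg => // [|z _ _]; first exact: integ_norm.
    set t := g z - _; rewrite -[t ^+ 2]real_normK ?num_real// -(ler_pM2l s20) mulrDr mulVKf ?gt_eqF//.
    by have := sqr_ge0 (s2 - `|t|); have := normr_ge0 t; nra.
  rewrite avgD//; [|exact: integ_cst|exact: integZ].
  rewrite (avg_cst mu_pos) (avg_pull (c := fun=> s2^-1))//.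
  have : avg mu (fun z => (g z - avg mu b N z) ^+ 2) n x <= m^-1 * (s2 ^+ 2 * m).
    apply: le_trans (avg_le_integral n x iN2 (fun y => sqr_ge0 _)) _.
    apply: ler_wpM2l; first by rewrite invr_ge0 ltW.
    rewrite /Rintegral -lee_fin fineK//.
    exact: integrable_fin_num.
  rewrite [m^-1 * _]mulrC mulfK ?gt_eqF// => hv.
  have : s2^-1 * avg mu (fun z => (g z - avg mu b N z) ^+ 2) n x <= s2.
    by rewrite ler_pdivrMl// -expr2.
  by rewrite /s2 => hw; lra.
have eqbg : {ae mu, forall x, b x = g x}.
  have i0 n k : (k < 2 ^ n)%N -> (\int[mu]_(x in dyadic n k) (b x - g x)%:E = 0)%E.
    move=> kn; have : avg mu (fun x => b x - g x) n (crep n k) = 0 by rewrite avgB// e subrr.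
    rewrite /avg cidx_crep// => /eqP; rewrite mulf_eq0 invr_eq0 gt_eqF ?(mass_gt0 mu_pos)//=.
    move=> /eqP h; rewrite -[LHS]fineK; last first.
      apply: integrable_fin_num; first exact: measurable_dyadic.
      exact: (integrable_cell n k (integB ib ig)).
    by congr (_%:E).
  have h := ae_eq0_dyadic mu01 (integB ib ig) i0.
  apply: ae_imp h => x /=.
  by move/eqP; rewrite subr_eq0 => /eqP.
have L2 e1 : 0 < e1 -> exists M, forall M', (M <= M')%N ->
    (\int[mu]_x ((b x - avg mu b M' x) ^+ 2)%:E <= e1%:E)%E.
  move=> /g2[M MM]; exists M => M' /MM; apply: le_trans; rewrite le_eqVlt.
  have mb0 : measurable_fun [set: measurableTypeR R] (b : measurableTypeR R -> R).
    by apply/measurable_EFinP; exact: measurable_int ib.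
  apply/orP; left; apply/eqP; apply: ae_eq_integral => //.
  - by apply/measurable_EFinP; apply: measurable_funX; exact: measurable_funB.
  - by apply/measurable_EFinP; apply: measurable_funX; exact: measurable_funB.
  - by apply: ae_imp eqbg => x -> _.
split; [|split=> //].
  by apply: ae_imp2 eqbg cg => x ->.
have [M /(_ M (leqnn _)) hM] := L2 1 ltr01.
have mb0 : measurable_fun [set: measurableTypeR R] (b : measurableTypeR R -> R).
  by apply/measurable_EFinP; exact: measurable_int ib.
have mbM : measurable_fun [set: measurableTypeR R] ((fun x => b x - avg mu b M x) : measurableTypeR R -> R).
  exact: measurable_funB.
have [i2 _] := integ_sqr mbM hM.
have iA2 : integ (fun x => avg mu b M x ^+ 2).
  apply: (ad_integrable (mu01 := mu01) (mu_pos := mu_pos) (n := M)) => x y xy.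
  by rewrite (avg_ad (mu01 := mu01) (mu_pos := mu_pos) b xy).
apply: (integ_le (g := fun x => 2 * (b x - avg mu b M x) ^+ 2 + 2 * avg mu b M x ^+ 2)).
- exact: measurable_funX.
- by move=> x; rewrite ger0_norm ?sqr_ge0//; have := sqr_ge0 (b x - avg mu b M x *+ 2); lra.
- by apply: integD; exact: integZ.
Qed.

End BmoLimit.

End L2.

(** * Approximation in H_1 by stopped martingales *)

Section HardyTail.
Context {R : realType} {D : tree R}.
Implicit Types (f : nat -> D -> R) (M N : nat).

Lemma mart_sub f g : @mart R D f -> mart g -> mart (fun n x => f n x - g n x).
Proof.
move=> [af Ef] [ag Eg]; split=> [n x y e|n x]; first by rewrite (af _ _ _ e) (ag _ _ _ e).
by rewrite E1B Ef Eg.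
Qed.

(** With m = min(N, M), the square function of the tail is at most the root of S_N^2 - S_m^2, a
    product of a factor small in mean and one bounded in mean. *)
Lemma Sq_tail f M N x : Sq (fun n x => f n x - stopped f M n x) N x <=
  Num.sqrt ((Sq f N x - Sq f (minn N M) x) * (Sq f N x + Sq f (minn N M) x)).
Proof.
rewrite -subr_sqr /Sq !sqr_sqrtr ?Sq_sum_ge0// ler_wsqrtr// /stopped min0n subrr expr0n add0r.
rewrite opprD addrACA subrr add0r.
have [NM|MN] := leqP N M.
  rewrite subrr big1// => k _; rewrite /incr !(minn_idPl _) ?(ltnW (leq_trans (ltn_ord k) NM))//.
    by rewrite !subrr expr0n.
  exact: leq_trans (ltn_ord k) NM.
rewrite -!(big_mkord xpredT (fun k => incr f k x ^+ 2)) -(big_mkord xpredT (fun k =>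
  incr (fun n y => f n y - f (minn n M) y) k x ^+ 2)).
rewrite (big_cat_nat (n := M)) ?(ltnW MN)//= [X in _ <= X - _](big_cat_nat (n := M)) ?(ltnW MN)//=.
rewrite addrAC subrr add0r big_nat_cond big1 ?add0r.
  rewrite le_eqVlt; apply/orP; left; apply/eqP; apply: eq_big_nat => k /andP[Mk _].
  by rewrite /incr !(minn_idPr _) ?(leqW Mk)//; congr (_ ^+ 2); ring.
move=> k /andP[/andP[_ kM] _]; rewrite /incr !(minn_idPl _) ?(ltnW kM)//.
by rewrite !subrr expr0n.
Qed.

Lemma H1le_tail f A e : H1le f A -> 0 < e ->
  exists M, forall M', (M <= M')%N -> H1le (fun n x => f n x - stopped f M' n x) e.
Proof.
move=> [mf A0 fA] e0; pose s N := Ex N (Sq f N).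
have sE M N : (M <= N)%N -> Ex N (Sq f M) = s M.
  by move=> MN; rewrite (Ex_ad MN (Sq_ad (n := M) mf)).
have sS N : s N <= s N.+1 by rewrite -(sE _ _ (leqnSn N)); apply: le_Ex => x; exact: Sq_mono.
have smono M N : (M <= N)%N -> s M <= s N.
  by move=> /subnK <-; elim: (N - M)%N => [//|d ih]; rewrite addSn (le_trans ih).
(* For sqrt(p q) <= (l / 2) q + p / (2 l): with E q <= 2 A and E p <= e l each term contributes e /
   2. *)
pose l := e / (2 * A); have l0 : 0 < l by rewrite divr_gt0// mulr_gt0.
have p0 k : 0 <= s k.+1 - s k by rewrite subr_ge0.
have telN N M : (M <= N)%N -> \sum_(M <= k < N) (s k.+1 - s k) = s N - s M.
  by move=> MN; rewrite telescope_sumr.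
have s0 N : 0 <= s N by apply: Ex_ge0 => x; exact: Sq_ge0.
have pA N : \sum_(k < N) (s k.+1 - s k) <= A.
  rewrite -(big_mkord xpredT (fun k => s k.+1 - s k)) telN//.
  by have := fA N; have := s0 0; rewrite /s; lra.
have [M hM] := bounded_series_tail p0 pA (mulr_gt0 e0 l0).
exists M => M' MM'; split=> // [|N]; first exact: mart_sub (mart_stopped M' mf).
pose m := minn N M'; have mN : (m <= N)%N by exact: geq_minl.
have sm : s N - s m <= e * l.
  have [NM|MN] := leqP N M'.
    by rewrite /m (minn_idPl NM) subrr ltW// mulr_gt0.
  rewrite /m (minn_idPr (ltnW MN)); have := hM N; rewrite telN; last exact: leq_trans MM' (ltnW MN).
  by have := smono _ _ MM'; lra.
have c1 : 0 <= l / 2 by rewrite divr_ge0// ltW.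
have c2 : 0 <= (2 * l)^-1 by rewrite invr_ge0 mulr_ge0// ltW.
apply: (@le_trans _ _ (Ex N (fun x => (l / 2) * (Sq f N x + Sq f m x) + (2 * l)^-1 * (Sq f N x - Sq f m x)))).
  apply: le_Ex => x; apply: le_trans (Sq_tail _ _ _ _) _; rewrite -/m.
  pose q := Sq f N x + Sq f m x; pose p := Sq f N x - Sq f m x; rewrite -/p -/q.
  have q0 : 0 <= q by rewrite addr_ge0 ?Sq_ge0.
  have p1 : 0 <= p.
    rewrite subr_ge0; move: (mN) => /subnK <-; elim: (N - m)%N => [//|d ih].
    by rewrite addSn (le_trans ih)// Sq_mono.
  have h0 : 0 <= l / 2 * q + (2 * l)^-1 * p.
    by apply: addr_ge0; apply: mulr_ge0.
  rewrite -[leRHS]ger0_norm// -sqrtr_sqr ler_wsqrtr//.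
  have := sqr_ge0 (l / 2 * q - (2 * l)^-1 * p).
  have e1 : l / 2 * q * ((2 * l)^-1 * p) = p * q / 4 by field; rewrite gt_eqF.
  by rewrite !expr2; nra.
rewrite ExD !ExZ ExD ExB !sE// -!/(s _).
have h1 := fA N; have h2 := fA m; rewrite -/(s _) in h1; rewrite -/(s _) in h2.
have h3 : l / 2 * (s N + s m) <= l / 2 * (2 * A) by rewrite ler_wpM2l//; lra.
have h4 : (2 * l)^-1 * (s N - s m) <= (2 * l)^-1 * (e * l).
  by rewrite ler_wpM2l.
apply: (le_trans (lerD h3 h4)).
have -> : l / 2 * (2 * A) = e / 2 by rewrite /l; field; rewrite gt_eqF.
have -> : (2 * l)^-1 * (e * l) = e / 2 by field; rewrite gt_eqF.
by rewrite -splitr.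
Qed.

End HardyTail.

Section Convergence.
Context {R : realType} (mu : probability (measurableTypeR R) R).
Hypothesis mu01 : mu `[0%R, 1%R[%classic = 1%E.
Hypothesis mu_pos : forall n k : nat, (k < 2 ^ n)%N -> (0 < mu (dyadic n k))%E.
Let T := dtree mu01 mu_pos.
Local Notation integ g := (mu.-integrable setT (EFin \o g)).
Variables (C : R).
Hypotheses (C0 : 0 < C) (mC : forall n (x : T), mI n.+1 x <= C * mI n x).

Lemma ae_cvg_Hs f A : @H1le R T f A -> {ae mu, forall x, cvgn (@Hs R T f ^~ x)}.
Proof.
move=> fA; have mf : mart f by case: fA.
apply: (ae_cvg_approx (mu01 := mu01) (mu_pos := mu_pos)) => e lam e0 l0.
pose KH := (9 + 4 * Num.sqrt C) * 5; have KH0 : 0 < KH.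
  by rewrite mulr_gt0// ltr_wpDr// mulr_ge0// sqrtr_ge0.
have [M /(_ M (leqnn M)) hM] := H1le_tail fA (divr_gt0 (mulr_gt0 l0 e0) KH0).
exists (@Hs R T (fun n x => f n x - @stopped R T f M n x)), (@Hs R T (stopped f M)); split.
- by move=> n x; rewrite HsB subrK.
- by move=> k; exact: Hs_ad.
- apply: aeW => x; apply/cvg_ex; exists (@Hs R T (stopped f M) M x).
  apply: (cvg_near_cst); near=> n; rewrite Hs_stopped//; near: n; exact: nbhs_infty_ge.
move=> N; rewrite -(ler_pM2l l0); apply: le_trans (markov_Ex _ _ l0) _.
  by move=> x; exact: mx_ge0.
apply: le_trans (H1le_Hs C0 mC N hM) _; rewrite -/KH mulrC divfK// gt_eqF//.
Unshelve. all: by end_near. Qed.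

Variables (b : nat -> R -> R) (B : R).
Hypothesis bB : @bmo2 R T b B.
Let mb : @mart R T b. Proof. by case: bB. Qed.

Let ae_cvg_hs : {ae mu, forall x, cvgn (@psum R T (fun k x => @hs R T k (b k.+1) x) ^~ x)}.
Proof.
apply: (ae_cvg_mdiff2 _ (bmo2_hs_L2 bB)); split=> [n|n x]; first exact: hs_ad.
exact: E1_hs.
Qed.

Let ae_cvg_incr : {ae mu, forall x, cvgn (@psum R T (fun k x => @incr R T b k.+1 x) ^~ x)}.
Proof.
have [ai iE] := mart_mdiff mb.
by apply: (ae_cvg_mdiff2 _ (bmo2_incr_L2 bB)); split=> [n|n x]; [exact: ai|exact: iE].
Qed.

(** The part of f beyond a large stopping level has small H_1 norm, so [H1le_weak] makes its [cN]
    small in probability, while the stopped part converges by [cN_stopped]. *)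
Lemma ae_cvg_cN f A : @H1le R T f A -> {ae mu, forall x, cvgn (@cN R T b f ^~ x)}.
Proof.
move=> fA; have mf : mart f by case: fA.
apply: (ae_cvg_approx (mu01 := mu01) (mu_pos := mu_pos)) => e lam e0 l0.
pose K1 := @KW R T C B b + 1; have K10 : 0 < K1 by rewrite ltr_wpDl// (KW_ge0 C bB).
have [M /(_ M (leqnn M)) hM] := H1le_tail fA (divr_gt0 (mulr_gt0 l0 e0) K10).
exists (@cN R T b (fun n x => f n x - @stopped R T f M n x)), (@cN R T b (stopped f M)); split.
- move=> n x; rewrite (cNB (D := T) n x mb mf (mart_stopped M mf) (H1le_dual bB fA)
    (stopped_dual M (H1le_dual bB fA))) subrK; exact: erefl.
- by move=> k; apply: cN_ad => //; case: hM.
- apply: ae_imp2 ae_cvg_hs ae_cvg_incr => x c1 c2.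
  pose v n := @cN R T b (stopped f M) M x +
    (f M x * (psum (fun k x => @hs R T k (b k.+1) x) n x - psum (fun k x => @hs R T k (b k.+1) x) M x) -
     @Hs R T (stopped f M) M x *
     (psum (fun k x => @incr R T b k.+1 x) n x - psum (fun k x => @incr R T b k.+1 x) M x)).
  have /cvg_ex[l cl] : cvgn v.
    apply: is_cvgD; first exact: is_cvg_cst.
    apply: is_cvgB; (apply: is_cvgM; [exact: is_cvg_cst|apply: is_cvgB => //; exact: is_cvg_cst]).
  apply/cvg_ex; exists l; apply: cvg_trans cl; apply: near_eq_cvg; near=> n.
  rewrite /v -(cN_stopped (D := T) bB x mf) 1?addrC ?subrK//.
  by near: n; exact: nbhs_infty_ge.
move=> N; have [_ q0 _] := hM; rewrite -(ler_pM2l l0); apply: le_trans (H1le_weak C0 mC bB N hM l0) _.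
apply: (@le_trans _ _ (K1 * (lam * e / K1))).
  by apply: ler_wpM2r; [exact: ltW|rewrite /K1 lerDl].
by rewrite mulrC divfK// gt_eqF.
Unshelve. all: by end_near. Qed.

End Convergence.

Section WeakLimit.
Context {R : realType} (mu : probability (measurableTypeR R) R).
Hypothesis mu01 : mu `[0%R, 1%R[%classic = 1%E.
Hypothesis mu_pos : forall n k : nat, (k < 2 ^ n)%N -> (0 < mu (dyadic n k))%E.
Let T := dtree mu01 mu_pos.

Lemma measurable_exceeds (h : R -> R) t :
  measurable_fun [set: measurableTypeR R] (h : measurableTypeR R -> R) ->
  measurable ([set x | t < `|h x|] : set (measurableTypeR R)).
Proof.
move=> mh; rewrite -[X in measurable X]setTI.
have := measurable_fun_ltr (measurable_cst t) (measurableT_comp (@normr_measurable R setT) mh).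
by move=> /(_ measurableT [set true] I); congr (measurable _); apply/seteqP; split.
Qed.

Lemma mu_le_ae (A E : set (measurableTypeR R)) : measurable A -> measurable E ->
  {ae mu, forall x, A x -> E x} -> (mu A <= mu E)%E.
Proof.
move=> mA mE [Z [mZ Z0 AZ]]; apply: (@le_trans _ _ (mu (E `|` Z))).
  apply: le_measure; rewrite ?inE//; first exact: measurableU.
  move=> x Ax; have [Ex|nEx] := pselect (E x); [by left|right].
  by apply: AZ => /= h; exact/nEx/h.
by apply: le_trans (measureU2 _ _ _) _ => //; rewrite [X in (_ + X)%E]Z0 adde0.
Qed.

(** Where the limit exceeds t in absolute value, some [Y N] does too, so the maximal bound transfers
    with the same constant. *)
Lemma weak_limit (Y : nat -> R -> R) (h : R -> R) K :
  (forall k, @ad R T k.+1 (Y k)) ->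
  measurable_fun [set: measurableTypeR R] (h : measurableTypeR R -> R) ->
  {ae mu, forall x, Y ^~ x @ \oo --> h x} ->
  (forall t N, 0 < t -> t * @Ex R T N.+1 (fun x => (t < @mx R T Y N x)%R%:R) <= K) ->
  (weakL1_norm mu h <= K%:E)%E.
Proof.
move=> aY mh Yh YK; apply: ge_ereal_sup => _ [t /= t0 <-].
have YK' N : @Ex R T N.+1 (fun x => (t < @mx R T Y N x)%R%:R) <= K / t.
  by rewrite ler_pdivlMr// mulrC YK.
have [mE muE] := mu_exceeds aY YK'.
have h1 : (mu [set x | (t < `|h x|)%R] <= (K / t)%:E)%E.
  apply: le_trans muE; apply: mu_le_ae => //; first exact: measurable_exceeds.
  apply: ae_imp Yh => x Yx tx; rewrite /= in tx; change (exists N, t < @mx R T Y N x).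
  have := Yx; move/cvgrPdist_lt => /(_ (`|h x| - t)); rewrite subr_gt0 => /(_ tx)[N _ /(_ N (leqnn _))] /= hN.
  exists N; apply: lt_le_trans (mx_ge (D := T) Y x (leqnn N)).
  by have := ler_dist_dist (h x) (Y N x); rewrite ler_norml => /andP[_]; lra.
have -> : K%:E = (t%:E * (K / t)%:E)%E by rewrite -EFinM mulrC divfK// gt_eqF.
by rewrite lee_wpmul2l// lee_fin ltW.
Qed.

End WeakLimit.

Section GfL2.
Context {R : realType} (mu : probability (measurableTypeR R) R).
Hypothesis mu01 : mu `[0%R, 1%R[%classic = 1%E.
Hypothesis mu_pos : forall n k : nat, (k < 2 ^ n)%N -> (0 < mu (dyadic n k))%E.
Let T := dtree mu01 mu_pos.
Local Notation integ g := (mu.-integrable setT (EFin \o g)).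

Lemma integ_meas g : integ g ->
  measurable_fun [set: measurableTypeR R] (g : measurableTypeR R -> R).
Proof. by move=> ig; apply/measurable_EFinP; exact: measurable_int ig. Qed.

Lemma integ_mul g h : integ g -> integ h -> integ (fun x => g x ^+ 2) ->
  integ (fun x => h x ^+ 2) -> integ (fun x => g x * h x).
Proof.
move=> ig ih ig2 ih2; apply: (integ_le (g := fun x => g x ^+ 2 + h x ^+ 2)).
- by apply: measurable_funM; exact: integ_meas.
- move=> x; rewrite normrM -(real_normK (num_real (g x))) -(real_normK (num_real (h x))).
  have := sqr_ge0 (`|g x| - `|h x|); have := normr_ge0 (g x); have := normr_ge0 (h x); nra.
- exact: integD.
Qed.

Lemma integ_avg_sqr g n : integ (fun x => avg mu g n x ^+ 2).
Proof.
apply: (ad_integrable (mu01 := mu01) (mu_pos := mu_pos) (n := n)) => x y xy.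
by rewrite (avg_ad (mu01 := mu01) (mu_pos := mu_pos) g xy).
Qed.

Lemma H1le_avg u : integ u -> integ (fun x => u x ^+ 2) ->
  @H1le R T (avg mu u) (1 + 5 * \int[mu]_x (u x ^+ 2)).
Proof.
move=> iu iu2; have V0 : 0 <= \int[mu]_x (u x ^+ 2) by apply: Rintegral_ge0 => x _; exact: sqr_ge0.
split=> [||N]; [exact: avg_mart| by rewrite ltr_pwDl// mulr_ge0|].
apply: (@le_trans _ _ (@Ex R T N (fun x => 1 + (avg mu u 0 x ^+ 2 + \sum_(k < N) @incr R T (avg mu u) k x ^+ 2)))).
  apply: le_Ex => x; rewrite -[X in _ <= 1 + X]sqr_sqrtr ?Sq_sum_ge0// -/(@Sq R T (avg mu u) N x).
  by have := sqr_ge0 (@Sq R T (avg mu u) N x - 1); have := @Sq_ge0 R T (avg mu u) N x; nra.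
rewrite !ExD Ex_cst lerD2l.
have a0 : @ad R T 0 (fun x => avg mu u 0 x ^+ 2).
  by move=> x y e; rewrite (avg_ad (mu01 := mu01) (mu_pos := mu_pos) u e).
rewrite (Ex_ad (leq0n N) a0).
have := avg_L2 mu01 mu_pos 0 iu iu2; have := incr_avg_L2 mu01 mu_pos N iu iu2.
by move: (Ex _ _) (Ex _ _) => p q; lra.
Qed.

(** At a finite level [cexp_mul] relates [PiN] to E_n(b_N u_N) = E_n(b_N u); then b_N tends to b in
    L^2, which suffices against u in L^2. *)
Lemma Gf_avg b u n x : integ b -> integ u -> integ (fun x => b x ^+ 2) ->
  integ (fun x => u x ^+ 2) ->
  (forall e, 0 < e -> exists M, forall M', (M <= M')%N ->
    (\int[mu]_x ((b x - avg mu b M' x) ^+ 2)%:E <= e%:E)%E) ->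
  @Gf R T (avg mu b) (avg mu u) n x =
  @PiN R T (avg mu b) (avg mu u) n x - avg mu b n x * avg mu u n x +
  avg mu (fun y => b y * u y) n x.
Proof.
move=> ib iu ib2 iu2 bL2.
have mb := avg_mart mu01 mu_pos ib; have mu_ := avg_mart mu01 mu_pos iu.
have ibu := integ_mul ib iu ib2 iu2.
have ibN N := integ_mul (avg_integ mu01 mu_pos b N) iu (integ_avg_sqr b N) iu2.
have E N : (n <= N)%N -> @cexp R T N n (@PiN R T (avg mu b) (avg mu u) N) x =
  @PiN R T (avg mu b) (avg mu u) n x - avg mu b n x * avg mu u n x +
  avg mu (fun y => avg mu b N y * u y) n x.
  move=> nN; rewrite -(cexp_closed (D := T) x (avg_mart mu01 mu_pos (ibN N)) nN).
  have -> : @cexp R T N n (avg mu (fun y => avg mu b N y * u y) N) x =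
     @cexp R T N n (fun y => avg mu b N y * avg mu u N y) x.
    apply: (cexp_ext (D := T)) => y; apply: (avg_pull (c := avg mu b N)); first exact: iu.
    move=> z _ yz; exact: (avg_ad (mu01 := mu01) (mu_pos := mu_pos) b yz).
  by rewrite (cexp_mul (D := T) x mb mu_ nN); ring.
apply: cvg_lim => //.
set c := _ - _; suff h : (fun N => avg mu (fun y => avg mu b N y * u y) n x) @ \oo -->
    avg mu (fun y => b y * u y) n x.
  pose w N := c + avg mu (fun y => avg mu b N y * u y) n x.
  have cl : w @ \oo --> c + avg mu (fun y => b y * u y) n x by apply: cvgD => //; exact: cvg_cst.
  apply: cvg_trans cl; apply: near_eq_cvg; near=> N.
  by rewrite E//; near: N; exact: nbhs_infty_ge.
apply/cvgrPdist_le => e e0.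
pose V := avg mu (fun y => u y ^+ 2) n x.
have V0 : 0 <= V.
  have := abs_avg mu_pos n x iu2; rewrite /V; under [X in _ <= X -> _]eq_avg do rewrite ger0_norm ?sqr_ge0//.
  by apply: le_trans; exact: normr_ge0.
pose m := mass mu n (cidx n x); have m0 : 0 < m by exact: (mass_cidx_gt0 mu_pos).
(* In |t u| <= t^2 / s + s u^2 this [s] makes the average of the last term at most e / 2; [N] is
   then taken large enough for the first one. *)
pose s := e / (2 * (V + 1)); have V1 : 0 < V + 1 by rewrite ltr_wpDl.
have s0 : 0 < s by rewrite divr_gt0// mulr_gt0.
have e20 : 0 < m * s * (e / 2) by rewrite mulr_gt0 ?divr_gt0// mulr_gt0.
have [M hM] := bL2 _ e20.
near=> N; have /hM hN : (M <= N)%N by near: N; exact: nbhs_infty_ge.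
have mbN : measurable_fun [set: measurableTypeR R] ((fun x => b x - avg mu b N x) : measurableTypeR R -> R).
  by apply: measurable_funB; apply: integ_meas => //; exact: avg_integ.
have [iN2 iN] := integ_sqr mu01 mu_pos mbN hN.
rewrite -(avgB _ _ ibu (ibN N)); apply: le_trans (abs_avg mu_pos n x (integB ibu (ibN N))) _.
have is1 : integ (fun z => s^-1 * (b z - avg mu b N z) ^+ 2) by exact: integZ.
have is2 : integ (fun z => s * u z ^+ 2) by exact: integZ.
apply: (@le_trans _ _ (avg mu (fun z => s^-1 * (b z - avg mu b N z) ^+ 2 + s * u z ^+ 2) n x)).
  apply: le_avg => // [||z _ _].
  - exact: integ_norm (integB ibu (ibN N)).
  - exact: integD.
  rewrite -mulrBl normrM; set t := b z - _.
  rewrite -[t ^+ 2]real_normK ?num_real// -[u z ^+ 2]real_normK ?num_real//.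
  rewrite -(ler_pM2l s0) mulrDr mulVKf ?gt_eqF//.
  have := sqr_ge0 (`|t| - s * `|u z|); have := normr_ge0 t; have := normr_ge0 (u z).
  have : 0 <= s * (`|t| * `|u z|) by apply: mulr_ge0; [exact: ltW|exact: mulr_ge0].
  by rewrite !expr2; lra.
rewrite avgD// (avg_pull (c := fun=> s^-1))// (avg_pull (c := fun=> s))//.
have h1 : avg mu (fun z => (b z - avg mu b N z) ^+ 2) n x <= m^-1 * (m * s * (e / 2)).
  apply: le_trans (avg_le_integral mu_pos n x iN2 (fun y => sqr_ge0 _)) _.
  apply: ler_wpM2l; first by rewrite invr_ge0 ltW.
  rewrite /Rintegral -lee_fin fineK//; exact: integrable_fin_num.
rewrite -mulrA mulKf ?gt_eqF// in h1.
have h2 : s^-1 * avg mu (fun z => (b z - avg mu b N z) ^+ 2) n x <= e / 2.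
  by rewrite ler_pdivrMl.
have h3 : s * V <= e / 2.
  have -> : s * V = (e / 2) * (V / (V + 1)) by rewrite /s; field; rewrite gt_eqF.
  rewrite -[leRHS]mulr1; apply: ler_wpM2l; first by rewrite divr_ge0// ltW.
  by rewrite ler_pdivrMr// mul1r lerDl.
by rewrite -/V; lra.
Unshelve. all: by end_near. Qed.

End GfL2.

Lemma cvg_sqrte {R : realType} (p : nat -> R) : (forall k, 0 <= p k) ->
  (fun N => (Num.sqrt (\sum_(0 <= k < N) p k))%:E) @ \oo -->
  sqrte (\sum_(0 <= k <oo) (p k)%:E)%E.
Proof.
move=> p0; pose S N := \sum_(0 <= k < N) p k.
have S0 N : 0 <= S N by rewrite sumr_ge0.
have c : (fun N => (S N)%:E) @ \oo --> (\sum_(0 <= k <oo) (p k)%:E)%E.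
  have cl := @is_cvg_nneseries R (fun k => (p k)%:E) xpredT 0%N (fun k _ _ => p0 k).
  apply: cvg_trans cl; apply: near_eq_cvg; apply: nearW => N /=; rewrite sumEFin//.
have L0 : (0 <= \sum_(0 <= k <oo) (p k)%:E)%E by apply: nneseries_ge0 => k _ _; rewrite lee_fin.
move: c L0; move: (limn _) => [r||] c L0 //=.
- apply: cvg_EFin_seq; have /fine_cvg c' := c.
  by apply: (@continuous_cvg _ _ _ _ _ S Num.sqrt) => //; exact: sqrt_continuous.
- apply/cvgeyPge => A; have /cvgeyPge /(_ (A ^+ 2)) := c; apply: filterS => N.
  rewrite !lee_fin => h; apply: le_trans (ler_norm A) _.
  by rewrite -sqrtr_sqr ler_wsqrtr.
Qed.

(** * The Hardy space norm *)

Section HardyNorm.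
Context {R : realType} (mu : probability (measurableTypeR R) R).
Hypothesis mu01 : mu `[0%R, 1%R[%classic = 1%E.
Hypothesis mu_pos : forall n k : nat, (k < 2 ^ n)%N -> (0 < mu (dyadic n k))%E.
Let T := dtree mu01 mu_pos.

(** [Sq g N] holds the initial value and N increments, hence the N + 1 differences d_0, ..., d_N. *)
Lemma Sq_square_fun (g : nat -> R -> R) N x : (@Sq R T g N x)%:E =
  sqrte (\sum_(0 <= n < N.+1) (`|g n x - Defs.prev g n x| ^+ 2)%:E)%E.
Proof.
rewrite sumEFin /= /Sq; congr (Num.sqrt _)%:E.
rewrite big_nat_recl//= subr0 real_normK ?num_real// big_mkord.
by congr (_ + _); apply: eq_bigr => k _; rewrite real_normK ?num_real.
Qed.

Lemma cvg_square_fun (g : nat -> R -> R) x :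
  (fun N => (@Sq R T g N x)%:E) @ \oo --> square_fun g x.
Proof.
have cl := @cvg_sqrte R (fun n => `|g n x - Defs.prev g n x| ^+ 2) (fun k => sqr_ge0 _).
rewrite -cvg_shiftS in cl; apply: cvg_trans cl; apply: near_eq_cvg; apply: nearW => N.
by rewrite /= Sq_square_fun sumEFin.
Qed.

Lemma square_fun_ge (g : nat -> R -> R) N x : ((@Sq R T g N x)%:E <= square_fun g x)%E.
Proof.
have c := @cvg_square_fun g x; rewrite -(cvg_lim _ c)//.
apply: lime_ge; first by apply/cvg_ex; eexists; exact: c.
near=> n; rewrite lee_fin; have : (N <= n)%N by near: n; exact: nbhs_infty_ge.
move=> /subnK <-; elim: (n - N)%N => [//|d ih].
by rewrite addSn (le_trans ih)// Sq_mono.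
Unshelve. all: by end_near. Qed.

Lemma square_fun_ge0 (g : nat -> R -> R) x : (0 <= square_fun g x)%E.
Proof. by apply: le_trans (square_fun_ge g 0 x); rewrite lee_fin; exact: Sq_ge0. Qed.

Lemma measurable_Sq (g : nat -> R -> R) N :
  (forall n, measurable_fun [set: measurableTypeR R] (g n : measurableTypeR R -> R)) ->
  measurable_fun [set: measurableTypeR R] ((fun x => (@Sq R T g N x)%:E) : measurableTypeR R -> \bar R).
Proof.
move=> mg; apply/measurable_EFinP; apply: measurableT_comp; first by apply: continuous_measurable_fun; exact: sqrt_continuous.
apply: measurable_funD; first exact: measurable_funX.
apply: measurable_sum => k; apply: measurable_funX; exact: measurable_funB.
Qed.

Lemma measurable_square_fun (g : nat -> R -> R) :
  (forall n, measurable_fun [set: measurableTypeR R] (g n : measurableTypeR R -> R)) ->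
  measurable_fun [set: measurableTypeR R] (square_fun g : measurableTypeR R -> \bar R).
Proof.
move=> mg; have -> : square_fun g = (fun x => limn_esup (fun N => (@Sq R T g N x)%:E)).
  apply/funext => x; have c := @cvg_square_fun g x.
  by rewrite is_cvg_limn_esupE ?(cvg_lim _ c)//; apply/cvg_ex; eexists; exact: c.
by apply: measurable_fun_limn_esup => N; exact: measurable_Sq.
Qed.

Variables (g v : nat -> R -> R).
Hypothesis mg : forall n, measurable_fun [set: measurableTypeR R] (g n : measurableTypeR R -> R).
Hypotheses (mv : @mart R T v) (gv : forall n x, 0 <= x < 1 -> g n x = v n x).

Let Sqgv N x : 0 <= x < 1 -> @Sq R T g N x = @Sq R T v N x.
Proof.
move=> x01; rewrite /Sq gv//; congr (Num.sqrt (_ + _)); apply: eq_bigr => k _.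
by rewrite /incr !gv.
Qed.

Lemma H1_norm_Ex A N : (H1_norm mu g <= A%:E)%E -> @Ex R T N (@Sq R T v N) <= A.
Proof.
move=> gA; rewrite -lee_fin -(integral_ad (mu01 := mu01) (mu_pos := mu_pos) (Sq_ad (n := N) mv)).
have m01 : measurable (`[0%R, 1%R[%classic : set (measurableTypeR R)) by exact: measurable_itv.
have mS : measurable_fun [set: measurableTypeR R] (@Sq R T v N : measurableTypeR R -> R).
  exact: (ad_measurable (Sq_ad (n := N) mv)).
apply: le_trans gA; rewrite /H1_norm Lnorm1.
have S0 x : 0 <= @Sq R T v N x by exact: Sq_ge0.
apply: (@le_trans _ _ (\int[mu]_x (@Sq R T v N x * \1_(`[0%R, 1%R[%classic) x)%:E)%E).
  rewrite le_eqVlt; apply/orP; left; apply/eqP; apply: ae_eq_integral => //.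
  - exact/measurable_EFinP.
  - apply/measurable_EFinP; apply: measurable_funM => //; exact: measurable_indic.
  apply: (ae_imp (P := fun x => 0 <= x < 1)); last exact: ae01.
  by move=> x x01 _; rewrite indicE mem_set ?mulr1//= in_itv.
apply: ge0_le_integral => //.
- by move=> x _; rewrite lee_fin mulr_ge0.
- apply/measurable_EFinP; apply: measurable_funM => //; exact: measurable_indic.
- by apply: measurableT_comp => //; exact: measurable_square_fun.
move=> x _; rewrite gee0_abs ?square_fun_ge0//.
have [x01|x01] := boolP (0 <= x < 1).
  have i01 : (`[0%R, 1%R[%classic : set R) x by rewrite /= in_itv.
  by rewrite indicE (mem_set i01) mulr1 -Sqgv//; exact: square_fun_ge.
have i01 : ~ (`[0%R, 1%R[%classic : set R) x by rewrite /= in_itv /=; exact/negP.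
by rewrite indicE (memNset i01) mulr0 square_fun_ge0.
Qed.

Lemma Ex_H1_norm A :
  (forall N, @Ex R T N (@Sq R T v N) <= A) -> (H1_norm mu g <= A%:E)%E.
Proof.
move=> vA; rewrite /H1_norm Lnorm1.
under eq_integral do rewrite gee0_abs ?square_fun_ge0//.
have mSq N := measurable_Sq N mg.
have -> : (\int[mu]_x square_fun g x = \int[mu]_x (limn (fun N => (@Sq R T g N x)%:E)))%E.
  by apply: eq_integral => x _; rewrite (cvg_lim _ (@cvg_square_fun g x)).
have nd x : nondecreasing_seq (fun N => (@Sq R T g N x)%:E).
  by apply/nondecreasing_seqP => k; rewrite lee_fin; exact: Sq_mono.
have S0 N (x : R) : (0 <= (@Sq R T g N x)%:E)%E by rewrite lee_fin; exact: Sq_ge0.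
rewrite (monotone_convergence mu measurableT mSq (fun N x _ => S0 N x) (fun x _ => nd x)).
apply: lime_le.
  apply: ereal_nondecreasing_is_cvgn; apply/nondecreasing_seqP => k.
  apply: ge0_le_integral => // x _; rewrite lee_fin; exact: Sq_mono.
apply: nearW => N.
rewrite (_ : (\int[mu]_x _ = \int[mu]_x (@Sq R T v N x)%:E)%E); last first.
  apply: ae_eq_integral => //.
    by apply/measurable_EFinP; exact: (ad_measurable (Sq_ad (n := N) mv)).
  apply: (ae_imp (P := fun x => 0 <= x < 1)); last exact: ae01.
  by move=> x x01 _; rewrite Sqgv.
by rewrite (integral_ad (mu01 := mu01) (mu_pos := mu_pos) (Sq_ad (n := N) mv)) lee_fin.
Qed.

End HardyNorm.

Lemma cvge0P {R : realType} (w : nat -> \bar R) : (forall i, (0 <= w i)%E) ->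
  w @ \oo --> 0%E <-> forall e : R, 0 < e -> \forall i \near \oo, (w i <= e%:E)%E.
Proof.
move=> w0; split=> [/fine_cvgP[wf /cvgrPdist_le wc] e e0|we].
  have := wc e e0; apply: filterS2 wf => i fi; rewrite sub0r normrN => h.
  by rewrite -(fineK fi) lee_fin (le_trans _ h)// ler_norm.
have wf : \forall i \near \oo, w i \is a fin_num.
  apply: filterS (we 1 ltr01) => i wi; rewrite ge0_fin_numE//.
  by apply: le_lt_trans wi _; exact: ltry.
apply/fine_cvgP; split=> //; apply/cvgrPdist_le => e e0.
apply: filterS2 wf (we e e0) => i fi wi /=; rewrite sub0r normrN ger0_norm ?fine_ge0//.
by rewrite -lee_fin fineK.
Qed.

Lemma cvgn_esup_einf {R : realType} (u : nat -> R) :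
  let U := fun N => (u N)%:E in
  cvgn u <-> limn_esup U = limn_einf U /\ limn_esup U = (fine (limn_esup U))%:E.
Proof.
move=> U; split=> [/cvg_EFin_seq/cvg_limn_einf_sup[e1 e2]|[e1 e2]].
  by rewrite e1 e2.
have c : U @ \oo --> limn_esup U.
  apply: (@squeeze_cvge _ _ _ _ (einfs U) U (esups U)).
  - apply: nearW => n; apply/andP; split.
      by apply: ereal_inf_lbound; exists n => /=.
    by apply: ereal_sup_ubound; exists n => /=.
  - by rewrite e1 limn_einf_lim; exact: is_cvg_einfs.
  - by rewrite limn_esup_lim; exact: is_cvg_esups.
rewrite e2 in c; have /fine_cvgP[_ h] := c.
by apply/cvg_ex; eexists; exact: h.
Qed.

(** Where there is no convergence [limn] is the default [point], so the convergence set has to be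
    described measurably: equal and finite upper and lower limits. *)
Lemma measurable_limn {d} {S : measurableType d} {R : realType} (h : nat -> S -> R) :
  (forall N, measurable_fun setT (h N)) ->
  measurable_fun setT (fun x => limn (h ^~ x)).
Proof.
move=> mh; pose E x := limn_esup (fun N => (h N x)%:E); pose I x := limn_einf (fun N => (h N x)%:E).
have mE : measurable_fun setT E.
  by apply: measurable_fun_limn_esup => N; exact/measurable_EFinP.
have mI : measurable_fun setT I.
  rewrite /I /limn_einf; apply: measurableT_comp => //.
  by apply: measurable_fun_limn_esup => N; apply: measurableT_comp => //; exact/measurable_EFinP.
have mf : measurable_fun setT (fun x => fine (E x)) by exact: measurableT_comp.
have -> : (fun x => limn (h ^~ x)) =
    (fun x => if (E x == I x) && (E x == (fine (E x))%:E) then fine (E x) else point).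
  apply/funext => x; case: ifPn => [/andP[/eqP e1 /eqP e2]|hN].
    have c : cvgn (h ^~ x) by apply/cvgn_esup_einf.
    have /cvg_EFin_seq/cvg_limn_einf_sup[_] : h ^~ x @ \oo --> limn (h ^~ x) by [].
    by rewrite -/(E x) => ->.
  rewrite dvgP// => /cvgn_esup_einf[e1 e2]; case/negP: hN.
  by apply/andP; split; exact/eqP.
apply: measurable_fun_ifT => //; apply: measurable_and; apply: measurable_fun_eqe => //.
exact/measurable_EFinP.
Qed.

(** * Commutators as continuous extensions *)

Section Abstract.
Context {R : realType} (mu : probability (measurableTypeR R) R).
Implicit Types (Tr : (R -> R) -> R -> R) (b g h : R -> R) (f : nat -> R -> R).
Local Notation meas h := (measurable_fun [set: measurableTypeR R] (h : measurableTypeR R -> R)).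

Lemma weakL1_ge0 h : (0 <= weakL1_norm mu h)%E.
Proof.
apply: le_trans (ereal_sup_ubound _); last by exists 1 => //=; exact: ltr01.
by rewrite mul1e measure_ge0.
Qed.

Lemma H1_norm_ge0 f : (0 <= H1_norm mu f)%E.
Proof. by rewrite /H1_norm Lnorm1; exact: integral_ge0. Qed.

(** A bound linear in the H_1 distance from u to f handles all approximating sequences at once. *)
Lemma is_commutatorI Tr b f g K : meas g -> 0 <= K ->
  (forall u A, u \in Lfun mu 2%:E -> 0 < A ->
    (H1_norm mu (fun n => (martingale_of mu u n \- f n)%R) <= A%:E)%E ->
    (weakL1_norm mu (L2_commutator Tr b u \- g)%R <= (K * A)%:E)%E) ->
  is_commutator mu Tr b f g.
Proof.
move=> mg K0 hK; split=> // u u2 /cvge0P; move=> /(_ (fun i => H1_norm_ge0 _)) uf.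
apply/cvge0P => [i|e e0]; first exact: weakL1_ge0.
have e1 : 0 < e / (K + 1) by rewrite divr_gt0// ltr_wpDl.
apply: filterS (uf _ e1) => i hi; apply: le_trans (hK _ _ (u2 i) e1 hi) _.
rewrite lee_fin mulrCA -[leRHS]mulr1; apply: ler_wpM2l; first exact: ltW.
by rewrite ler_pdivrMr ?ltr_wpDl// mul1r lerDl.
Qed.

Lemma weakL1_ge h t : 0 < t -> (mu [set x | (t < `|h x|)%R] <= t^-1%:E * weakL1_norm mu h)%E.
Proof.
move=> t0; rewrite -(@lee_pmul2l _ t%:E) ?lte_fin//.
rewrite muleA -EFinM mulfV ?gt_eqF// mul1e.
by apply: ereal_sup_ubound; exists t.
Qed.

(** Along one L^2 sequence tending to f both candidates are limits in weak L^1; splitting the level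
    t into halves shows that they agree. *)
Lemma is_commutator_unique Tr b f g1 g2 u :
  is_commutator mu Tr b f g1 -> is_commutator mu Tr b f g2 ->
  (forall i, u i \in Lfun mu 2%:E) -> (forall i, meas (L2_commutator Tr b (u i))) ->
  H1_norm mu (fun n => (martingale_of mu (u i) n \- f n)%R) @[i --> \oo] --> 0%E ->
  {ae mu, forall x, g1 x = g2 x}.
Proof.
move=> [mg1 c1] [mg2 c2] u2 mu_ uf; have {}c1 := c1 u u2 uf; have {}c2 := c2 u u2 uf.
have mg12 : meas (g1 \- g2)%R by exact: measurable_funB.
have z t : 0 < t -> (mu [set x | (t < `|(g1 \- g2) x|)%R] <= 0)%E.
  move=> t0; apply/lee_addgt0Pr => e e0; rewrite add0e.
  have t20 : 0 < t / 2 by rewrite divr_gt0.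
  have s0 : 0 < e / 2 * (t / 2) by rewrite mulr_gt0 ?divr_gt0.
  have n1 := (cvge0P (fun i => weakL1_ge0 _)).1 c1 _ s0.
  have n2 := (cvge0P (fun i => weakL1_ge0 _)).1 c2 _ s0.
  have [N _ /(_ N (leqnn N)) [h1 h2]] := filterI n1 n2.
  set h := L2_commutator Tr b (u N) in h1 h2.
  have mh : meas h by exact: mu_.
  have mh1 : meas (h \- g1)%R by exact: measurable_funB.
  have mh2 : meas (h \- g2)%R by exact: measurable_funB.
  apply: (@le_trans _ _ (mu ([set x | (t / 2 < `|(h \- g1) x|)%R] `|` [set x | (t / 2 < `|(h \- g2) x|)%R]))).
    apply: le_measure; rewrite ?inE; [exact: measurable_exceeds|apply: measurableU; exact: measurable_exceeds|].
    move=> x /= tx; have [h1x|h1x] := ltP (t / 2) `|h x - g1 x|; [by left|right].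
    have := ler_distD (h x) (g1 x) (g2 x); rewrite (distrC (g1 x) (h x)) => hx.
    by rewrite /=; lra.
  apply: le_trans (measureU2 _ _ _) _; [exact: measurable_exceeds|exact: measurable_exceeds|].
  have b1 (g : R -> R) : (weakL1_norm mu (h \- g)%R <= (e / 2 * (t / 2))%:E)%E ->
      (mu [set x | (t / 2 < `|(h \- g) x|)%R] <= (e / 2)%:E)%E.
    move=> hg; apply: le_trans (weakL1_ge (h \- g)%R t20) _.
    apply: (@le_trans _ _ ((t / 2)^-1%:E * (e / 2 * (t / 2))%:E)%E).
      by apply: lee_wpmul2l => //; rewrite lee_fin invr_ge0 ltW.
    by rewrite -EFinM lee_fin mulrC mulfK// gt_eqF.
  by apply: le_trans (leeD (b1 _ h1) (b1 _ h2)) _; rewrite -EFinD -splitr.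
pose F N : set R := [set x | ((N.+1%:R)^-1 < `|(g1 \- g2) x|)%R].
have F0 N : (mu (F N) <= 0)%E by apply: z; rewrite invr_gt0.
have FS N : F N `<=` F N.+1.
  by move=> x; rewrite /F /=; apply: le_lt_trans; rewrite lef_pV2 ?posrE// ler_nat.
have mF N : measurable (F N : set (measurableTypeR R)) by exact: measurable_exceeds.
have F00 : mu (\bigcup_N F N) = 0%E.
  by apply/eqP; rewrite eq_le measure_ge0 andbT; exact: mu_bigcup_le.
exists (\bigcup_N F N); split=> //; first exact: bigcup_measurable.
move=> x /= nx; have d0 : 0 < `|g1 x - g2 x| by rewrite normr_gt0 subr_eq0; exact/eqP.
exists (Num.truncn (`|g1 x - g2 x|^-1)) => //; rewrite /F /=.
by rewrite invf_plt ?posrE//; exact: Num.Theory.truncnS_gt.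
Qed.

Lemma weakL1_le_L1 h K : meas h -> (\int[mu]_x (`|h x|)%:E <= K%:E)%E ->
  (weakL1_norm mu h <= K%:E)%E.
Proof.
move=> mh hK; apply: ge_ereal_sup => _ [t /= t0 <-].
apply: le_trans hK; have mE := measurable_exceeds t mh.
rewrite -[X in mu X]setIT -(integral_indic mu measurableT mE).
rewrite -ge0_integralZl//=; last 2 first.
- by apply/measurable_EFinP; exact: measurable_indic.
- by rewrite lee_fin ltW.
apply: ge0_le_integral => //.
- by move=> x _; rewrite mule_ge0// lee_fin ltW.
- by apply: measurable_funeM; apply/measurable_EFinP; exact: measurable_indic.
- by apply/measurable_EFinP; exact: measurableT_comp.
move=> x _; rewrite -EFinM lee_fin indicE; case: (boolP (x \in _)) => [|_].
  by rewrite inE /= mulr1 => /ltW.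
by rewrite mulr0.
Qed.

Lemma Fn_measurableT n g : Fn_measurable n g -> meas g.
Proof.
move=> mg _ B mB; have := mg measurableT B mB; rewrite !setTI => h.
have s : <<s dyadics n >> `<=` (measurable : set (set (measurableTypeR R))).
  apply: smallest_sub; first exact: sigma_algebra_measurable.
  by move=> _ [k _ <-]; exact: measurable_dyadic.
exact: s.
Qed.

Lemma measurable_cond_exp n u : mu.-integrable setT (EFin \o u) -> meas (cond_exp mu n u).
Proof.
move=> iu; rewrite (_ : cond_exp mu n u = fun x => \sum_(k < 2 ^ n) \1_(dyadic n k) x *
  ((mass mu n k)^-1 * fine (\int[mu]_(y in dyadic n k) (u y)%:E))).
  apply: measurable_sum => k; apply: measurable_funM => //.
  by apply: measurable_indic; exact: measurable_dyadic.
by apply/funext => x; exact: cond_expE.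
Qed.

Lemma measurable_dyadic_hilbert u : meas (dyadic_hilbert mu u).
Proof.
apply: measurable_limn => N; rewrite /series /=.
apply: measurable_sum => i; apply: measurable_sum => j.
apply: measurable_funM => //; rewrite /haar; apply: measurable_funM => //.
by apply: measurable_funB; apply: measurable_funM => //; apply: measurable_indic; exact: measurable_dyadic.
Qed.

Lemma Lfun2_integ u : u \in Lfun mu 2%:E ->
  mu.-integrable setT (EFin \o u) /\ mu.-integrable setT (EFin \o (fun x => u x ^+ 2)).
Proof.
move=> u2; split; last exact: Lfun2_integrable_sqr.
by apply/Lfun1_integrable; apply: (Lfun_subset12 _ u2); rewrite fin_num_measure.
Qed.

Lemma Lfun2_bounded h M : meas h -> (forall x, `|h x| <= M) -> h \in Lfun mu 2%:E.
Proof.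
move=> mh hM; rewrite inE; apply/andP; split; rewrite inE//= /finite_norm.
have M0 : 0 <= M by apply: le_trans (hM 0); exact: normr_ge0.
have := Lfun_cst mu M 2; rewrite inE => /andP[_]; rewrite inE /= /finite_norm.
apply: le_lt_trans; rewrite unlock; apply: gt0_ler_poweR => //.
- by rewrite in_itv /= leey integral_ge0// => x _; exact: poweR_ge0.
- by rewrite in_itv /= leey integral_ge0// => x _; exact: poweR_ge0.
apply: ge0_le_integral => //.
- by move=> x _; exact: poweR_ge0.
- apply/measurable_EFinP; apply: (@measurableT_comp _ _ _ _ _ _ (fun x : R => x `^ 2)%R) => //.
  exact: measurableT_comp.
- exact: (measurable_cst (`|M%:E| `^ 2)%E).
move=> x _; rewrite /= lee_fin; apply: ge0_ler_powR => //; rewrite ?nnegrE//.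
by rewrite (ger0_norm M0).
Qed.

End Abstract.

Section Density.
Context {R : realType} (mu : probability (measurableTypeR R) R).
Hypothesis mu01 : mu `[0%R, 1%R[%classic = 1%E.
Hypothesis mu_pos : forall n k : nat, (k < 2 ^ n)%N -> (0 < mu (dyadic n k))%E.
Let T := dtree mu01 mu_pos.
Local Notation integ g := (mu.-integrable setT (EFin \o g)).
Local Notation meas h := (measurable_fun [set: measurableTypeR R] (h : measurableTypeR R -> R)).

Lemma ad_bounded n X x : @ad R T n X -> `|X x| <= \sum_(k < 2 ^ n) `|X (crep n k)|.
Proof.
move=> aX; have xl := cidx_lt n x.
have -> : X x = X (crep n (cidx n x)) by apply: aX; rewrite /= cidx_crep.
by rewrite (bigD1 (Ordinal xl))//= lerDl sumr_ge0.
Qed.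

Lemma tr_ad f n : is_martingale mu f -> @ad R T n (tr f n).
Proof. by move=> [mf _]; exact: clip_ad. Qed.

Lemma Lfun2_tr f i : is_martingale mu f -> tr f i \in Lfun mu 2%:E.
Proof.
move=> mf; apply: (@Lfun2_bounded R mu (tr f i) (\sum_(k < 2 ^ i) `|tr f i (crep i k)|)).
  exact: (ad_measurable (tr_ad (n := i) mf)).
by move=> x; exact: (ad_bounded x (tr_ad (n := i) mf)).
Qed.

Lemma H1le_tr f A : H1 mu f -> 0 < A -> (H1_norm mu f <= A%:E)%E -> @H1le R T (tr f) A.
Proof.
move=> [mf _] A0 fA; have mt := mart_tr mu01 mu_pos mf; split=> // N.
apply: (H1_norm_Ex (mu01 := mu01) (mu_pos := mu_pos) (g := f)) => //.
- by move=> n; case: mf => mf _; exact: Fn_measurableT (mf n).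
- by move=> n x x01; rewrite /tr clip_id.
Qed.

Lemma H1_tr f : H1 mu f -> exists A, @H1le R T (tr f) A.
Proof.
move=> fH; have [mf f1] := fH; exists (fine (H1_norm mu f) + 1); apply: H1le_tr => //.
  by rewrite ltr_wpDl// fine_ge0// H1_norm_ge0.
rewrite EFinD fineK; first by rewrite leeDl// lee_fin.
by rewrite ge0_fin_numE// H1_norm_ge0.
Qed.

Lemma martingale_ofE u n x : integ u -> 0 <= x < 1 -> martingale_of mu u n x = avg mu u n x.
Proof. exact: cond_exp_avg. Qed.

Lemma H1le_diff f u A : is_martingale mu f -> integ u -> 0 < A ->
  (H1_norm mu (fun n => (martingale_of mu u n \- f n)%R) <= A%:E)%E ->
  @H1le R T (fun n x => avg mu u n x - tr f n x) A.
Proof.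
move=> mf iu A0 hA; have mv := mart_sub (avg_mart mu01 mu_pos iu) (mart_tr mu01 mu_pos mf).
split=> // N; apply: (H1_norm_Ex (mu01 := mu01) (mu_pos := mu_pos)
  (g := fun n => (martingale_of mu u n \- f n)%R)) => //.
  move=> n; apply: measurable_funB; first exact: measurable_cond_exp.
  by case: mf => mf _; exact: Fn_measurableT (mf n).
by move=> n x x01; rewrite /= martingale_ofE// /tr clip_id.
Qed.

(** The martingale of f_i is f stopped at i, so this is the density of L^2 in H_1. Without such a
    sequence [is_commutator] would hold vacuously and determine nothing. *)
Lemma cvg_tr f : H1 mu f ->
  H1_norm mu (fun n => (martingale_of mu (tr f i) n \- f n)%R) @[i --> \oo] --> 0%E.
Proof.
move=> fH; have [mf _] := fH; apply/cvge0P => [i|e e0]; first exact: H1_norm_ge0.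
have [A fA] := H1_tr fH; have [M hM] := H1le_tail fA e0.
near=> i; have Mi : (M <= i)%N by near: i; exact: nbhs_infty_ge.
have iu : integ (tr f i) by have [] := Lfun2_integ (Lfun2_tr i mf).
have [mv _ hv] := hM i Mi.
have mw := mart_sub (mart_stopped i (mart_tr mu01 mu_pos mf)) (mart_tr mu01 mu_pos mf).
apply: (Ex_H1_norm (mu01 := mu01) (mu_pos := mu_pos)
  (g := fun n => (martingale_of mu (tr f i) n \- f n)%R)
  (v := fun n x => @stopped R T (tr f) i n x - tr f n x)) => //.
- move=> n; apply: measurable_funB; first exact: measurable_cond_exp.
  by case: mf => mf _; exact: Fn_measurableT (mf n).
- move=> n x x01; rewrite /= martingale_ofE// -(avg_stopped mu01 mu_pos i n x mf).
  by congr (_ - _); [apply: eq_avg => y y01|]; rewrite /tr clip_id.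
move=> N; apply: le_trans (hv N); apply: le_Ex => x.
rewrite /Sq /incr; rewrite -sqrrN opprB; under [X in _ + X]eq_bigr do rewrite -sqrrN.
rewrite le_eqVlt; apply/orP; left; apply/eqP; congr (Num.sqrt (_ + _)).
by apply: eq_bigr => k _; congr (_ ^+ 2); ring.
Unshelve. all: by end_near. Qed.

End Density.

(** * The commutator with the dyadic Hilbert transform *)

Section HilbertCommutator.
Context {R : realType} (mu : probability (measurableTypeR R) R).
Hypothesis mu01 : mu `[0%R, 1%R[%classic = 1%E.
Hypothesis mu_pos : forall n k : nat, (k < 2 ^ n)%N -> (0 < mu (dyadic n k))%E.
Let T := dtree mu01 mu_pos.
Local Notation integ g := (mu.-integrable setT (EFin \o g)).
Local Notation meas h := (measurable_fun [set: measurableTypeR R] (h : measurableTypeR R -> R)).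
Variables (b : R -> R) (B C : R).
Hypotheses (ib : integ b) (bB : @bmo2 R T (avg mu b) B).
Hypotheses (C0 : 0 < C) (mC : forall n (x : T), mI n.+1 x <= C * mI n x).
Let mb : @mart R T (avg mu b). Proof. by case: bB. Qed.
Let bae : {ae mu, forall x, avg mu b ^~ x @ \oo --> b x}.
Proof. by have [] := avg_ae_L2 ib bB. Qed.
Let ib2 : integ (fun x => b x ^+ 2).
Proof. by have [_ []] := avg_ae_L2 ib bB. Qed.

Lemma Gf_L2 u n x : integ u -> integ (fun x => u x ^+ 2) ->
  @Gf R T (avg mu b) (avg mu u) n x =
  @PiN R T (avg mu b) (avg mu u) n x - avg mu b n x * avg mu u n x +
  avg mu (fun y => b y * u y) n x.
Proof.
by move=> iu iu2; apply: Gf_avg => //; have [_ []] := avg_ae_L2 ib bB.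
Qed.

Lemma L2_commutator_meas_hilbert u : integ u -> integ (fun x => u x ^+ 2) ->
  meas (L2_commutator (dyadic_hilbert mu) b u).
Proof.
move=> iu iu2; apply: measurable_funB; first exact: measurable_dyadic_hilbert.
apply: (measurable_funM (f := b)); last exact: measurable_dyadic_hilbert.
exact: (integ_meas ib).
Qed.

(** b u is only known to be integrable, so its transform is not known beforehand to converge. Its
    convergence is deduced from that of [cN], of b_N and of the transform of u. *)
Lemma cvg_cN_L2 u : integ u -> integ (fun x => u x ^+ 2) ->
  {ae mu, forall x, @cN R T (avg mu b) (avg mu u) ^~ x @ \oo -->
    L2_commutator (dyadic_hilbert mu) b u x}.
Proof.
move=> iu iu2; have ibu := integ_mul ib iu ib2 iu2.
have uA := H1le_avg mu01 mu_pos iu iu2.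
have cE N x := cN_commutator N x mb (avg_mart mu01 mu_pos iu) (fun n y => Gf_L2 n y iu iu2).
have h1 := ae_cvg_cN C0 mC bB uA; have h2 := ae_cvg_Hs C0 mC uA.
have h3 := ae01 mu01 (fun x (h : 0 <= x < 1) => h).
apply: (ae_imp2 _ bae (ae_imp2 (fun x p q => conj p q) h1 (ae_imp2 (fun x p q => conj p q) h2 h3))).
move=> x bx [cx [Hx x01]].
pose w := avg mu (fun y => b y * u y).
have hT v : integ v -> dyadic_hilbert mu v x = limn (@Hs R T (avg mu v) ^~ x).
  move=> iv; rewrite /dyadic_hilbert; congr (limn _); apply/funext => N.
  exact: (hilbert_series mu01 mu_pos N iv x01).
have bS : (fun N => avg mu b N.+1 x) @ \oo --> b x by rewrite (cvg_shiftS (avg mu b ^~ x)).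
have cH : (fun N => avg mu b N.+1 x * @Hs R T (avg mu u) N x) @ \oo -->
   b x * limn (@Hs R T (avg mu u) ^~ x) by apply: cvgM.
have cw : cvgn (@Hs R T w ^~ x).
  rewrite (_ : @Hs R T w ^~ x = fun N => @cN R T (avg mu b) (avg mu u) N x +
      avg mu b N.+1 x * @Hs R T (avg mu u) N x).
    by apply: is_cvgD => //; apply/cvg_ex; eexists; exact: cH.
  by apply/funext => N; rewrite cE subrK.
rewrite /L2_commutator /= !hT//.
by under eq_fun do rewrite cE; exact: (cvgB cw cH).
Qed.

Let cNsub f g A1 A2 N x : @H1le R T f A1 -> @H1le R T g A2 ->
  @cN R T (avg mu b) (fun n x => f n x - g n x) N x =
  @cN R T (avg mu b) f N x - @cN R T (avg mu b) g N x.
Proof.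
move=> fA gA; have [mf _ _] := fA; have [mg _ _] := gA.
exact: (cNB (D := T) N x mb mf mg (H1le_dual bB fA) (H1le_dual bB gA)).
Qed.

Definition hilbert_comm (f : nat -> R -> R) x : R :=
  limn (@cN R T (avg mu b) (tr f) ^~ x).

Lemma measurable_hilbert_comm f : is_martingale mu f -> meas (hilbert_comm f).
Proof.
move=> mf; apply: measurable_limn => N.
exact: (ad_measurable (cN_ad (n := N) mb (mart_tr mu01 mu_pos mf))).
Qed.

Lemma cvg_hilbert_comm f : H1 mu f -> {ae mu, forall x,
  @cN R T (avg mu b) (tr f) ^~ x @ \oo --> hilbert_comm f x}.
Proof.
move=> fH; have [A fA] := H1_tr mu01 mu_pos fH.
exact: (ae_imp (fun x h => h) (ae_cvg_cN C0 mC bB fA)).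
Qed.

(** By linearity of [cN] the error is the limit of [cN] at u - f, to which [H1le_weak] applies. *)
Lemma hilbert_commutator f : H1 mu f ->
  is_commutator mu (dyadic_hilbert mu) b f (hilbert_comm f).
Proof.
move=> fH; have [mf _] := fH; have [A1 fA1] := H1_tr mu01 mu_pos fH.
apply: (is_commutatorI (K := @KW R T C B (avg mu b))); first exact: measurable_hilbert_comm.
  exact: (KW_ge0 C bB).
move=> u A u2 A0 uA; have [iu iu2] := Lfun2_integ u2.
have vA := H1le_diff mu01 mu_pos mf iu A0 uA.
have mv : @mart R T (fun n x => avg mu u n x - tr f n x) by case: vA.
apply: (weak_limit (mu01 := mu01) (mu_pos := mu_pos)
  (Y := @cN R T (avg mu b) (fun n x => avg mu u n x - tr f n x))).
- by move=> k; exact: cN_ad.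
- apply: measurable_funB; last exact: measurable_hilbert_comm.
  exact: L2_commutator_meas_hilbert.
- apply: ae_imp2 (cvg_cN_L2 iu iu2) (cvg_hilbert_comm fH) => x c1 c2.
  under eq_fun do rewrite (cNsub _ x (H1le_avg mu01 mu_pos iu iu2) fA1).
  exact: (cvgB c1 c2).
- by move=> t N t0; exact: (H1le_weak C0 mC bB N vA t0).
Qed.

Lemma hilbert_commutator_ae f g : H1 mu f ->
  is_commutator mu (dyadic_hilbert mu) b f g ->
  {ae mu, forall x, @cN R T (avg mu b) (tr f) ^~ x @ \oo --> g x}.
Proof.
move=> fH fg; have [mf _] := fH.
have h : {ae mu, forall x, hilbert_comm f x = g x}.
  apply: (is_commutator_unique (hilbert_commutator fH) fg (u := tr f)).
  - by move=> i; exact: (Lfun2_tr mu01 mu_pos).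
  - move=> i; have [i1 i2] := Lfun2_integ (Lfun2_tr mu01 mu_pos i mf).
    exact: L2_commutator_meas_hilbert.
  - exact: (cvg_tr mu01 mu_pos).
by apply: ae_imp2 (cvg_hilbert_comm fH) h => x c <-.
Qed.

Lemma hilbert_weak f g A : H1 mu f -> is_commutator mu (dyadic_hilbert mu) b f g ->
  0 < A -> (H1_norm mu f <= A%:E)%E -> (weakL1_norm mu g <= (@KW R T C B (avg mu b) * A)%:E)%E.
Proof.
move=> fH fg A0 fA; have tA := H1le_tr mu01 mu_pos fH A0 fA.
apply: (weak_limit (mu01 := mu01) (mu_pos := mu_pos) (Y := @cN R T (avg mu b) (tr f))).
- by move=> k; apply: cN_ad => //; case: tA.
- by case: fg.
- exact: hilbert_commutator_ae.
- by move=> t N t0; exact: (H1le_weak C0 mC bB N tA t0).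
Qed.

End HilbertCommutator.

Lemma PiNB {R : realType} {D : tree R} (b f g : nat -> D -> R) N x :
  PiN b (fun n y => f n y - g n y) N x = PiN b f N x - PiN b g N x.
Proof.
rewrite /PiN mulrBr opprD addrACA -sumrB; congr (_ + _).
by apply: eq_bigr => k _; rewrite /incr; ring.
Qed.

Lemma mx_widen {R : realType} {D : tree R} (f : nat -> D -> R) n N x :
  (n <= N)%N -> mx f n x <= mx f N x.
Proof.
by move=> /subnK <-; elim: (N - n)%N => [//|d ih]; rewrite addSn (le_trans ih)// mx_mono.
Qed.

Lemma cvg_mx {R : realType} {D : tree R} (F : nat -> nat -> D -> R) (f : nat -> D -> R) n x :
  (forall k, F ^~ k ^~ x @ \oo --> f k x) ->
  (fun M => mx (F M) n x) @ \oo --> mx f n x.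
Proof.
move=> Ff; elim: n => [|n ih] /=; first exact: cvg_norm.
have c : (fun M => `|F M n.+1 x|) @ \oo --> `|f n.+1 x| by exact: cvg_norm.
have maxE (s t : R) : Num.max s t = (s + t + `|s - t|) / 2.
  case: (leP s t) => h; [rewrite ler0_norm ?subr_le0//|rewrite gtr0_norm ?subr_gt0//]; lra.
rewrite maxE (_ : (fun M => Num.max (mx (F M) n x) `|F M n.+1 x|) = fun M =>
  (mx (F M) n x + `|F M n.+1 x| + `|mx (F M) n x - `|F M n.+1 x| |) / 2); last first.
  apply/funext => M; rewrite maxE; reflexivity.
have c1 : (fun M => `|mx (F M) n x - `|F M n.+1 x| |) @ \oo --> `|mx f n x - `|f n.+1 x| |.
  by apply: cvg_norm; exact: cvgB.
by apply: cvgM; [apply: cvgD => //; exact: cvgD|exact: cvg_cst].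
Qed.

Section IntegralBounds.
Context {R : realType} (mu : probability (measurableTypeR R) R).
Implicit Types F G H : measurableTypeR R -> \bar R.

Lemma integral_le_add F G H : measurable_fun setT F -> measurable_fun setT G ->
  measurable_fun setT H -> (forall x, 0 <= F x)%E -> (forall x, 0 <= G x)%E ->
  (forall x, 0 <= H x)%E -> {ae mu, forall x, (H x <= F x + G x)%E} ->
  (\int[mu]_x H x <= \int[mu]_x F x + \int[mu]_x G x)%E.
Proof.
move=> mF mG mH F0 G0 H0 HFG; rewrite -ge0_integralD//.
apply: ae_ge0_le_integral => //.
- by move=> x _; exact: adde_ge0.
- exact: emeasurable_funD.
- by apply: filterS HFG => x h _.
Qed.

End IntegralBounds.

(** * Commutators with conditional expectations and the strong bound *)

Section AverageCommutator.
Context {R : realType} (mu : probability (measurableTypeR R) R).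
Hypothesis mu01 : mu `[0%R, 1%R[%classic = 1%E.
Hypothesis mu_pos : forall n k : nat, (k < 2 ^ n)%N -> (0 < mu (dyadic n k))%E.
Let T := dtree mu01 mu_pos.
Local Notation integ g := (mu.-integrable setT (EFin \o g)).
Local Notation meas h := (measurable_fun [set: measurableTypeR R] (h : measurableTypeR R -> R)).
Variables (b : R -> R) (B : R).
Hypotheses (ib : integ b) (bB : @bmo2 R T (avg mu b) B).
Local Notation bn := (avg mu b).
Let mb : @mart R T bn. Proof. by case: bB. Qed.
Let bae : {ae mu, forall x, bn ^~ x @ \oo --> b x}.
Proof. by have [] := avg_ae_L2 ib bB. Qed.
Let ib2 : integ (fun x => b x ^+ 2).
Proof. by have [_ []] := avg_ae_L2 ib bB. Qed.
Let mbn n : meas (bn n).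
Proof. exact: (ad_measurable (avg_ad (mu01 := mu01) (mu_pos := mu_pos) b (n := n))). Qed.
Let mbb : meas b. Proof. exact: integ_meas ib. Qed.

Definition gap (v : nat -> R -> R) n x : R := v n x * (b x - bn n x).

(** This expression makes sense for all f in H_1. It is the commutator for f in L^2 by
    [avg_comm_L2], and the continuous extension by [avg_commutator]. *)
Definition avg_comm (v : nat -> R -> R) n x : R :=
  @Gf R T bn v n x - @PiN R T bn v n x - gap v n x.

Lemma avg_commB f g A1 A2 n x : @H1le R T f A1 -> @H1le R T g A2 ->
  avg_comm (fun n x => f n x - g n x) n x = avg_comm f n x - avg_comm g n x.
Proof.
move=> fA gA; have [mf _ _] := fA; have [mg _ _] := gA.
rewrite /avg_comm (GfB (D := T) n x mb mf mg (H1le_dual bB fA) (H1le_dual bB gA)) PiNB /gap.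
by ring.
Qed.

Let mgap v n : @mart R T v -> meas (gap v n).
Proof.
move=> [av _]; apply: measurable_funM; first exact: (ad_measurable (av n)).
exact: measurable_funB.
Qed.

Lemma measurable_mx (F : nat -> R -> R) N : (forall n, meas (F n)) -> meas (@mx R T F N).
Proof.
move=> mF; elim: N => [|N ih] /=; first exact: measurableT_comp.
by apply: measurable_maxr => //; exact: measurableT_comp.
Qed.

Lemma integral_gap v A N : @H1le R T v A ->
  (\int[mu]_x (@mx R T (gap v) N x)%:E <= ((1 + 4 * B) * 31 * A)%:E)%E.
Proof.
move=> vA; have [mv A0 _] := vA; have [av _] := mv.
(* b is replaced by its average at level M + N, so that [H1le_gap] applies; Fatou's lemma lets M
   tend to infinity. *)
pose F M n x := v n x * (bn (M + N) x - bn n x).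
have aF M n : (n <= N)%N -> @ad R T (M + N) (F M n).
  move=> nN x y xy; rewrite /F (av n _ _ (idxW (leq_trans nN (leq_addl M N)) xy)).
  rewrite (avg_ad (mu01 := mu01) (mu_pos := mu_pos) b xy).
  by rewrite (avg_ad (mu01 := mu01) (mu_pos := mu_pos) b (idxW (leq_trans nN (leq_addl M N)) xy)).
have amx M n : (n <= N)%N -> @ad R T (M + N) (@mx R T (F M) n).
  elim: n => [|n ih] nN x y xy /=; first by rewrite (aF _ _ nN _ _ xy).
  by rewrite (ih (ltnW nN) _ _ xy) (aF _ _ nN _ _ xy).
apply: (fatou_le (h := fun M => @mx R T (F M) N)).
- by move=> M; exact: (ad_measurable (amx M N (leqnn N))).
- by move=> M x; exact: mx_ge0.
- by apply: measurable_mx => n; exact: mgap.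
- apply: ae_imp bae => x bx; apply: (cvg_mx (D := T)) => k.
  apply: cvgMl_tmp; apply: cvgB; last exact: cvg_cst.
  by rewrite (cvg_shiftn N (bn ^~ x)).
move=> M; rewrite (integral_ad (amx M N (leqnn N))) lee_fin.
apply: le_trans (H1le_gap bB (M + N) vA); apply: le_Ex => x.
by apply: le_trans (mx_widen _ x (leq_addl M N)) _.
Qed.

Let KG := `|bn 0%N (rep T 0 0)| + (1 + 2 * B) * 5.

Let PiAbs v N x := `|bn 0%N x * v 0%N x| + \sum_(k < N) `|@incr R T bn k x| * `|@incr R T v k x|.

Let PiAbs_ad v N : @mart R T v -> @ad R T N (PiAbs v N).
Proof.
move=> mv x y xy; have [aib _] := mart_mdiff mb; have [aiv _] := mart_mdiff mv.
have [ab _] := mb; have [av _] := mv.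
rewrite /PiAbs (ab _ _ _ (idxW (leq0n N) xy)) (av _ _ _ (idxW (leq0n N) xy)); congr (_ + _).
by apply: eq_bigr => k _; rewrite (aib _ _ _ (idxW (ltn_ord k) xy)) (aiv _ _ _ (idxW (ltn_ord k) xy)).
Qed.

Let le_PiAbs v n N x : (n <= N)%N -> `|@PiN R T bn v n x| <= PiAbs v N x.
Proof.
move=> nN; apply: le_trans (ler_normD _ _) _; rewrite lerD2l.
apply: le_trans (ler_norm_sum _ _ _) _.
apply: (@le_trans _ _ (\sum_(k < n) `|@incr R T bn k x| * `|@incr R T v k x|)).
  by apply: ler_sum => k _; rewrite mulrC normrM.
rewrite -!(big_mkord xpredT (fun k => `|@incr R T bn k x| * `|@incr R T v k x|)).
by rewrite [leRHS](big_cat_nat (n := n))//= lerDl sumr_ge0.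
Qed.

Definition avg_comm_cst := KG + KG + (1 + 4 * B) * 31.

Lemma measurable_avg_comm v A n : @H1le R T v A -> meas (avg_comm v n).
Proof.
move=> vA; have [mv _ _] := vA; have [aG _] := mart_Gf mb mv (H1le_dual bB vA).
apply: measurable_funB; last exact: mgap.
apply: measurable_funB; first exact: (ad_measurable (aG n)).
exact: (ad_measurable (PiN_ad (N := n) mb mv)).
Qed.

Lemma integral_avg_comm v A n : @H1le R T v A ->
  (\int[mu]_x `|avg_comm v n x|%:E <= (avg_comm_cst * A)%:E)%E.
Proof.
move=> vA; have [mv A0 _] := vA; have [aG _] := mart_Gf mb mv (H1le_dual bB vA).
pose X x := `|@Gf R T bn v n x| + PiAbs v n x.
have aX : @ad R T n X.
  by move=> x y xy; rewrite /X (aG _ _ _ xy) (PiAbs_ad mv xy).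
have P0 x : 0 <= PiAbs v n x by rewrite addr_ge0// sumr_ge0// => k _; exact: mulr_ge0.
have h : (\int[mu]_x `|avg_comm v n x|%:E <=
    \int[mu]_x (X x)%:E + \int[mu]_x (@mx R T (gap v) n x)%:E)%E.
  apply: integral_le_add.
  - by apply/measurable_EFinP; exact: (ad_measurable aX).
  - by apply/measurable_EFinP; apply: measurable_mx => k; exact: mgap.
  - by apply/measurable_EFinP; apply: measurableT_comp => //; exact: measurable_avg_comm vA.
  - by move=> x; rewrite lee_fin addr_ge0.
  - by move=> x; rewrite lee_fin mx_ge0.
  - by move=> x; rewrite lee_fin.
  apply: aeW => x; rewrite -EFinD lee_fin /avg_comm.
  apply: le_trans (ler_normB _ _) _; apply: lerD; last exact: (mx_ge (D := T)).
  by apply: le_trans (ler_normB _ _) _; rewrite lerD2l; exact: le_PiAbs.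
apply: le_trans h _; rewrite (integral_ad aX) /avg_comm_cst mulrDl EFinD.
apply: leeD; last exact: integral_gap.
rewrite lee_fin /X ExD mulrDl; apply: lerD; first exact: (H1le_Gf bB n vA).
exact: (H1le_PiN bB n vA).
Qed.

Lemma avg_comm_cst_ge0 : 0 <= avg_comm_cst.
Proof.
have B0 : 0 <= B by exact: bmo2_ge0 (rep T 0 0) bB.
have h : 0 <= `|bn 0%N (rep T 0 0)| by [].
by rewrite /avg_comm_cst /KG; lra.
Qed.

Lemma avg_comm_L2 u n x : integ u -> integ (fun x => u x ^+ 2) -> 0 <= x < 1 ->
  L2_commutator (cond_exp mu n) b u x = avg_comm (avg mu u) n x.
Proof.
move=> iu iu2 x01; have ibu := integ_mul ib iu ib2 iu2.
rewrite /L2_commutator /= !cond_exp_avg// /avg_comm (Gf_L2 ib bB n x iu iu2) /gap.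
by ring.
Qed.

Lemma measurable_L2_avg u n : integ u -> integ (fun x => u x ^+ 2) ->
  meas (L2_commutator (cond_exp mu n) b u).
Proof.
move=> iu iu2; have ibu := integ_mul ib iu ib2 iu2.
apply: measurable_funB; first exact: measurable_cond_exp.
by apply: (measurable_funM (f := b)) => //; exact: measurable_cond_exp.
Qed.

Lemma avg_commutator f n : H1 mu f ->
  is_commutator mu (cond_exp mu n) b f (avg_comm (tr f) n).
Proof.
move=> fH; have [mf _] := fH; have [A1 fA1] := H1_tr mu01 mu_pos fH.
have mc := measurable_avg_comm n fA1.
apply: (is_commutatorI (K := avg_comm_cst)) => //; first exact: avg_comm_cst_ge0.
move=> u A u2 A0 uA; have [iu iu2] := Lfun2_integ u2.
have vA := H1le_diff mu01 mu_pos mf iu A0 uA.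
have mL := measurable_L2_avg n iu iu2.
have mh : meas (L2_commutator (cond_exp mu n) b u \- avg_comm (tr f) n)%R by exact: measurable_funB.
apply: weakL1_le_L1 => //; apply: le_trans (integral_avg_comm n vA).
rewrite le_eqVlt; apply/orP; left; apply/eqP; apply: ae_eq_integral => //.
- by apply/measurable_EFinP; exact: measurableT_comp.
- by apply/measurable_EFinP; apply: measurableT_comp => //; exact: measurable_avg_comm vA.
apply: (ae_imp (P := fun x => 0 <= x < 1)); last exact: ae01.
move=> x x01 _; congr (`|_|%:E).
by rewrite (avg_commB n x (H1le_avg mu01 mu_pos iu iu2) fA1) -avg_comm_L2.
Qed.

Lemma avg_commutator_ae f n g : H1 mu f -> is_commutator mu (cond_exp mu n) b f g ->
  {ae mu, forall x, avg_comm (tr f) n x = g x}.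
Proof.
move=> fH fg; have [mf _] := fH.
apply: (is_commutator_unique (avg_commutator n fH) fg (u := tr f)).
- by move=> i; exact: (Lfun2_tr mu01 mu_pos).
- move=> i; have [i1 i2] := Lfun2_integ (Lfun2_tr mu01 mu_pos i mf).
  exact: measurable_L2_avg.
- exact: (cvg_tr mu01 mu_pos).
Qed.

Lemma commutatorP Tr f g : is_commutator mu Tr b f g ->
  is_commutator mu Tr b f (commutator mu Tr b f).
Proof. by move=> fg; apply: (@xgetPex _ (cst 0) [set g | is_commutator mu Tr b f g]); exists g. Qed.

Lemma measurable_commutator_max f : H1 mu f ->
  measurable_fun [set: measurableTypeR R] (commutator_max mu b f : measurableTypeR R -> \bar R).
Proof.
move=> fH; pose c n x := `|commutator mu (cond_exp mu n) b f x|%:E.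
have mc n : measurable_fun [set: measurableTypeR R] (c n : measurableTypeR R -> \bar R).
  apply/measurable_EFinP; apply: measurableT_comp => //.
  by case: (commutatorP (avg_commutator n fH)).
rewrite (_ : commutator_max mu b f = fun x => esups (c ^~ x) 0); first exact: measurable_fun_esups.
apply/funext => x; rewrite /commutator_max /esups /=; congr ereal_sup.
by rewrite /sdrop; apply/seteqP; split=> _ [n _ <-]; exists n.
Qed.

(** The formula of [avg_comm] is solved for [Gf]. Each commutator is known up to a null set, so the
    exceptional sets of all n are first gathered in [cae]; the maximum up to N is attained at some
    n, which leaves a pointwise bound. *)
Lemma Ex_mx_Gf f A N (c : R) : H1 mu f -> @H1le R T (tr f) A ->
  (\int[mu]_x commutator_max mu b f x <= c%:E)%E ->
  @Ex R T N (@mx R T (@Gf R T bn (tr f)) N) <= c + (KG + (1 + 4 * B) * 31) * A.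
Proof.
move=> fH fA hc; have [mf A0 _] := fA; have [aG _] := mart_Gf mb mf (H1le_dual bB fA).
have P0 x : 0 <= PiAbs (tr f) N x by rewrite addr_ge0// sumr_ge0// => k _; exact: mulr_ge0.
have mP : measurable_fun [set: measurableTypeR R] ((fun x => (PiAbs (tr f) N x)%:E) : measurableTypeR R -> \bar R).
  by apply/measurable_EFinP; exact: (ad_measurable (PiAbs_ad (N := N) mf)).
have mg : measurable_fun [set: measurableTypeR R] ((fun x => (@mx R T (gap (tr f)) N x)%:E) : measurableTypeR R -> \bar R).
  by apply/measurable_EFinP; apply: measurable_mx => k; exact: mgap.
have mm := measurable_commutator_max fH.
have m0 x : (0 <= commutator_max mu b f x)%E.
  by apply: le_trans (ereal_sup_ubound _); last (by exists 0%N); rewrite lee_fin.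
have mPg : measurable_fun [set: measurableTypeR R] ((fun x => (PiAbs (tr f) N x)%:E + (@mx R T (gap (tr f)) N x)%:E)%E : measurableTypeR R -> \bar R).
  exact: emeasurable_funD.
have g0 x : (0 <= (@mx R T (gap (tr f)) N x)%:E)%E by rewrite lee_fin mx_ge0.
have P0' x : (0 <= (PiAbs (tr f) N x)%:E)%E by rewrite lee_fin.
have aM := mx_ad (n := N) aG.
rewrite -lee_fin -(integral_ad aM).
have cae : {ae mu, forall x, forall n, avg_comm (tr f) n x = commutator mu (cond_exp mu n) b f x}.
  apply: (@ae_foralln _ (measurableTypeR R)) => n.
  exact: (avg_commutator_ae fH (commutatorP (avg_commutator n fH))).
apply: (@le_trans _ _ (\int[mu]_x commutator_max mu b f x +
    \int[mu]_x ((PiAbs (tr f) N x)%:E + (@mx R T (gap (tr f)) N x)%:E))%E).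
  apply: integral_le_add => //.
  - by apply/measurable_EFinP; exact: (ad_measurable aM).
  - by move=> x; exact: adde_ge0.
  - by move=> x; rewrite lee_fin mx_ge0.
  apply: ae_imp cae => x hx.
  have key n : (n <= N)%N -> (`|@Gf R T bn (tr f) n x|%:E <=
      commutator_max mu b f x + ((PiAbs (tr f) N x)%:E + (@mx R T (gap (tr f)) N x)%:E))%E.
    move=> nN; apply: (@le_trans _ _ (`|avg_comm (tr f) n x|%:E +
       ((PiAbs (tr f) N x)%:E + (@mx R T (gap (tr f)) N x)%:E))%E).
      rewrite -!EFinD lee_fin.
      have -> : @Gf R T bn (tr f) n x = avg_comm (tr f) n x + (@PiN R T bn (tr f) n x + gap (tr f) n x).
        by rewrite /avg_comm; ring.
      apply: le_trans (ler_normD _ _) _; rewrite lerD2l; apply: le_trans (ler_normD _ _) _.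
      by apply: lerD; [exact: le_PiAbs|exact: (mx_ge (D := T))].
    by apply: leeD => //; rewrite hx; apply: ereal_sup_ubound; exists n.
  have : exists2 n, (n <= N)%N & @mx R T (@Gf R T bn (tr f)) N x = `|@Gf R T bn (tr f) n x|.
    elim: (N) => [|n [k kn e]] /=; first by exists 0%N.
    case: (leP (@mx R T (@Gf R T bn (tr f)) n x) `|@Gf R T bn (tr f) n.+1 x|) => h.
      by exists n.+1.
    by exists k => //; exact: leqW.
  by move=> [n nN ->]; exact: key.
rewrite EFinD; apply: leeD => //; rewrite ge0_integralD// mulrDl EFinD.
apply: leeD; last exact: integral_gap.
rewrite (integral_ad (PiAbs_ad (N := N) mf)) lee_fin.
exact: (H1le_PiN bB N fA).
Qed.

Lemma hilbert_strong C f g A c : 0 < C -> (forall n (x : T), mI n.+1 x <= C * mI n x) ->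
  H1 mu f -> is_commutator mu (dyadic_hilbert mu) b f g -> @H1le R T (tr f) A ->
  (\int[mu]_x commutator_max mu b f x <= c%:E)%E -> 0 <= c ->
  (\int[mu]_x `|g x|%:E <= (KP C B * 5 * A +
     (9 + 4 * Num.sqrt C) * 72 * (c + (KG + (1 + 4 * B) * 31) * A))%:E)%E.
Proof.
move=> C0 mC fH fg fA hc c0; have [mf A0 _] := fA.
have B0 : 0 <= B by exact: bmo2_ge0 (rep T 0 0) bB.
have K0 : 0 < KG + (1 + 4 * B) * 31.
  by have : 0 <= `|bn 0%N (rep T 0 0)| by []; rewrite /KG; lra.
have A20 : 0 < c + (KG + (1 + 4 * B) * 31) * A by rewrite ltr_wpDl// mulr_gt0.
have acN n : @ad R T n.+1 (fun x => `|@cN R T bn (tr f) n x|).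
  by move=> x y xy; rewrite (cN_ad (n := n) mb mf xy).
apply: (fatou_le (h := fun N x => `|@cN R T bn (tr f) N x|)).
- by move=> N; exact: (ad_measurable (acN N)).
- by [].
- by apply: measurableT_comp => //; case: fg.
- by apply: ae_imp (hilbert_commutator_ae ib bB C0 mC fH fg) => x cx; exact: cvg_norm.
move=> N; rewrite (integral_ad (acN N)) lee_fin.
apply: le_trans (H1le_strong C0 mC bB fA A20 (Ex_mx_Gf N.+1 fH fA hc)).
by apply: le_Ex => x; exact: mx_ge.
Qed.

(** Separate coefficients for A and c match the two terms of [H1b_norm]. *)
Lemma hilbert_strong_cst C : 0 < C -> (forall n (x : T), mI n.+1 x <= C * mI n x) ->
  exists c1 c2 : R, [/\ 0 <= c1, 0 <= c2 & forall f g A c,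
    H1 mu f -> is_commutator mu (dyadic_hilbert mu) b f g -> @H1le R T (tr f) A ->
    (\int[mu]_x commutator_max mu b f x <= c%:E)%E -> 0 <= c ->
    (\int[mu]_x `|g x|%:E <= (c1 * A + c2 * c)%:E)%E].
Proof.
move=> C0 mC; have B0 : 0 <= B by exact: bmo2_ge0 (rep T 0 0) bB.
have s0 := sqrtr_ge0 C; have Bs0 : 0 <= B * Num.sqrt C by exact: mulr_ge0.
have K0 : 0 <= KG + (1 + 4 * B) * 31.
  by have : 0 <= `|bn 0%N (rep T 0 0)| by []; rewrite /KG; lra.
have K1 : 0 <= (9 + 4 * Num.sqrt C) * 72 by lra.
exists (KP C B * 5 + (9 + 4 * Num.sqrt C) * 72 * (KG + (1 + 4 * B) * 31)).
exists ((9 + 4 * Num.sqrt C) * 72); split=> //.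
  by apply: addr_ge0; [rewrite /KP; lra|exact: mulr_ge0].
move=> f g A c fH fg fA hc c0; apply: le_trans (hilbert_strong C0 mC fH fg fA hc c0) _.
by rewrite lee_fin le_eqVlt; apply/orP; left; apply/eqP; ring.
Qed.

End AverageCommutator.

(** * From uniform estimates to norm inequalities *)

Lemma BMO_norm_gt0 {R : realType} (mu : probability (measurableTypeR R) R)
    (mu01 : mu `[0%R, 1%R[%classic = 1%E)
    (mu_pos : forall n k : nat, (k < 2 ^ n)%N -> (0 < mu (dyadic n k))%E) (p : R) (b : R -> R) :
  1 <= p -> BMO mu p b -> ~ (exists c : R, {ae mu, forall x, b x = c}) ->
  (0 < BMO_norm mu p b)%E.
Proof.
move=> p1 bB nc; rewrite ltNge; apply/negP => b0; apply: nc; exists 0.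
(* By the convention b_{-1} = 0 the term n = 0 of the norm is the L^p norm of b, so a zero norm
   forces b = 0 almost everywhere. *)
have p0 : 0 < p by exact: lt_le_trans p1.
have N0 : BMO_norm mu p b = 0%E.
  apply/eqP; rewrite eq_le b0 /=; apply: ereal_sup_ge.
  eexists; first by exists 0%N.
  exact: poweR_ge0.
have := bmo_cell mu01 mu_pos 0 0 p1 bB; rewrite N0 poweR0r ?gt_eqF//= mul0r.
set D := dyadic 0 (cidx 0 0) => I0.
have mD : measurable (D : set (measurableTypeR R)) by exact: measurable_dyadic.
have [/Lfun1_integrable ib _] := bB.
have mb := integ_meas ib.
have mbp : measurable_fun [set: measurableTypeR R] (fun z : measurableTypeR R => `|b z - 0| `^ p).
  apply: (measurableT_comp (measurable_powR _)); apply: measurableT_comp => //.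
  by apply: measurable_funB.
have h : ae_eq mu D (fun z => (`|b z - 0| `^ p)%:E) (cst 0%E).
  apply/(ae_eq_integral_abs mu mD); first by apply: measurable_funTS; exact/measurable_EFinP.
  apply/eqP; rewrite eq_le integral_ge0// andbT; apply: le_trans I0.
  by under eq_integral do rewrite gee0_abs ?lee_fin ?powR_ge0//.
apply: (ae_imp2 _ (ae01 mu01 (fun x (h : 0 <= x < 1) => h)) h) => x x01 /= hx.
have Dx : D x.
  have := dyadic_cidx 0 x01; rewrite /D; have := cidx_lt 0 x; have := @cidx_lt R 0 0.
  by rewrite expn0 !ltnS !leqn0 => /eqP -> /eqP ->.
by have /(_ Dx)[/powR_eq0_eq0/eqP] := hx; rewrite subr0 normr_eq0 => /eqP.
Qed.

(** The estimates require A > 0, whereas the H_1 norm may be 0; they are used for all A strictly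
    above the norm. *)
Lemma lee_mulr_approx {R : realType} (X : \bar R) (h c d : R) : 0 <= c ->
  (forall A, h < A -> (X <= (c * A + d)%:E)%E) -> (X <= (c * h + d)%:E)%E.
Proof.
move=> c0 hX; apply/lee_addgt0Pr => e e0.
have c1 : 0 < c + 1 by rewrite ltr_wpDl.
apply: le_trans (hX (h + e / (c + 1)) _) _; first by rewrite ltrDl divr_gt0.
rewrite -EFinD lee_fin mulrDr addrAC lerD2l mulrCA -[leRHS]mulr1.
by apply: ler_wpM2l; [exact: ltW|rewrite ler_pdivrMr// mul1r lerDl].
Qed.

Theorem corollary5p9 (R : realType) (mu : probability (measurableTypeR R) R)
    (mu01 : mu `[0%R, 1%R[%classic = 1%E)
    (mu_pos : forall n k : nat, (k < 2 ^ n)%N -> (0 < mu (dyadic n k))%E)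
    (mu_incr : m_increasing mu)
    (p : R) (p_ge1 : 1 <= p)
    (b : R -> R) (bBMO : BMO mu p b)
    (b_nonconst : ~ exists c : R, {ae mu, forall x, b x = c}) :
  (* the extension of [H_D, b] to H_1(mu) exists *)
  (forall f : nat -> R -> R, H1 mu f ->
     is_commutator mu (dyadic_hilbert mu) b f
       (commutator mu (dyadic_hilbert mu) b f)) /\
  (exists C : R, forall f : nat -> R -> R, H1 mu f ->
     (weakL1_norm mu (commutator mu (dyadic_hilbert mu) b f)
        <= C%:E * H1_norm mu f)%E) /\
  (exists C : R, forall f : nat -> R -> R, H1b mu p b f ->
     ('N[mu]_1[EFin \o commutator mu (dyadic_hilbert mu) b f]
        <= C%:E * H1b_norm mu p b f)%E).
Proof.
have ib : mu.-integrable setT (EFin \o b) by apply/Lfun1_integrable; case: bBMO.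
have [B bB] := bmo_bmo2 mu01 mu_pos p_ge1 bBMO.
have [C C0 mC] := m_increasing_tree mu01 mu_pos mu_incr.
have comm f : H1 mu f -> is_commutator mu (dyadic_hilbert mu) b f
    (commutator mu (dyadic_hilbert mu) b f).
  by move=> fH; exact: (commutatorP (hilbert_commutator ib bB C0 mC fH)).
have H1_ge0 f : 0 <= fine (H1_norm mu f) by apply: fine_ge0; exact: H1_norm_ge0.
have H1E f : H1 mu f -> H1_norm mu f = (fine (H1_norm mu f))%:E.
  by move=> [_ f1]; rewrite fineK// ge0_fin_numE// H1_norm_ge0.
split=> //; split.
  exists (@KW R (dtree mu01 mu_pos) C B (avg mu b)) => f fH; rewrite H1E// -EFinM -[_ * _]addr0.
  apply: lee_mulr_approx => [|A hA]; first exact: (KW_ge0 C bB).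
  have A0 : 0 < A by exact: (le_lt_trans (H1_ge0 f) hA).
  rewrite addr0; apply: (hilbert_weak ib bB C0 mC fH (comm f fH) A0).
  by rewrite H1E// lee_fin ltW.
have M0 := BMO_norm_gt0 mu01 mu_pos p_ge1 bBMO b_nonconst.
have Mfin : (BMO_norm mu p b < +oo)%E by case: bBMO.
pose M := fine (BMO_norm mu p b).
have ME : BMO_norm mu p b = M%:E by rewrite fineK// ge0_fin_numE// ltW.
have {}M0 : 0 < M by rewrite -lte_fin -ME.
have [c1 [c2 [c10 c20 hc]]] := hilbert_strong_cst ib bB C0 mC.
(* In [H1b_norm] the H_1 norm is multiplied by M, the BMO norm of b, so c1 is divided by M; M > 0
   because b is not constant. *)
exists (c1 / M + c2) => f [fH]; rewrite /H1b_norm H1E// ME.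
set h := fine (H1_norm mu f); rewrite -EFinM.
have -> : ('N[mu]_1[commutator_max mu b f] = \int[mu]_x commutator_max mu b f x)%E.
  rewrite Lnorm1; apply: eq_integral => x _; rewrite gee0_abs//.
  by apply: le_trans (ereal_sup_ubound _); last (by exists 0%N); rewrite lee_fin.
set I := (\int[mu]_x _)%E => hI.
have I0 : (0 <= I)%E.
  apply: integral_ge0 => x _.
  by apply: le_trans (ereal_sup_ubound _); last (by exists 0%N); rewrite lee_fin.
have IE : I = (fine I)%:E.
  rewrite fineK// ge0_fin_numE//; apply: le_lt_trans hI.
  by rewrite leeDr// lee_fin mulr_ge0 ?H1_ge0// ltW.
have c0 : 0 <= fine I by exact: fine_ge0.
rewrite Lnorm1 IE -EFinD -EFinM.
apply: (@le_trans _ _ (c1 * h + c2 * fine I)%:E).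
  apply: lee_mulr_approx => // A hA; have A0 : 0 < A by exact: (le_lt_trans (H1_ge0 f) hA).
  have fA : @H1le R (dtree mu01 mu_pos) (tr f) A.
    by apply: H1le_tr => //; rewrite H1E// lee_fin ltW.
  have hI' : (\int[mu]_x commutator_max mu b f x <= (fine I)%:E)%E by rewrite -IE.
  exact: (hc f _ A (fine I) fH (comm f fH) fA hI' c0).
have -> : (c1 / M + c2) * (h * M + fine I) = c1 * h + c2 * fine I + (c1 / M * fine I + c2 * (h * M)).
  by field; rewrite gt_eqF.
rewrite lee_fin lerDl; apply: addr_ge0; apply: mulr_ge0 => //.
  by apply: divr_ge0 => //; exact: ltW.
by apply: mulr_ge0; [exact: H1_ge0|exact: ltW].
Qed.
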